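(* The $C_0$-semigroup $(e^{t\mathcal A})_{t\ge0}$ generated by the operator $\mathcal A$ on $\mathcal H$ is not exponentially stable, i.e. there do not exist constants $M\ge1$ and $\omega>0$ such that $\|e^{t\mathcal A}\|_{\mathcal L(\mathcal H)}\le Me^{-\omega t}$ for all $t\ge0$.
   Context: Parameters: $\rho>0$, $0<\tilde\alpha<1$, $\wp\ge 0$, $\eta(\xi)=|\xi|^{(2\tilde\alpha-1)/2}$ for $\xi\in\mathbb R$, and $\zeta=\rho\pi^{-1}\sin(\tilde\alpha\pi)$. All functions are complex-valued. The function $\tau\in C([0,1])\cap C^1((0,1])$ satisfies $\tau(0)=0$, $\tau(x)>0$ for all $x\in(0,1]$, $m_\tau:=\sup_{0<x\le 1}\frac{x|\tau'(x)|}{\tau(x)}<2$, and $\tau\in C^{[m_\tau]}([0,1])$, where $[\cdot]$ is the integer part. Spaces: $H^1_\tau(0,1)=\{\psi\in L^2(0,1):\psi \text{ locally absolutely continuous in }(0,1],\ \sqrt{\tau}\,\psi_x\in L^2(0,1)\}$; $H^1_{0,\tau}(0,1)=\{\psi\in H^1_\tau(0,1):\psi(0)=0\}$; $H^2_\tau(0,1)=\{\psi\in H^1_\tau(0,1):\tau\psi_x\in H^1(0,1)\}$; $W^1_\tau(0,1)=H^1_{0,\tau}(0,1)$ if $0\le m_\tau<1$ and $W^1_\tau(0,1)=H^1_\tau(0,1)$ if $1\le m_\tau<2$. State space: $\mathcal H=L^2(0,1)\times L^2(\mathbb R)$ with inner product $\langle(\psi,\vartheta),(\tilde\psi,\tilde\vartheta)\rangle_{\mathcal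 H}=\int_0^1\psi\overline{\tilde\psi}\,dx+\zeta\int_{-\infty}^{+\infty}\vartheta\overline{\tilde\vartheta}\,d\xi$. The operator $\mathcal A$ is $\mathcal A(\psi,\vartheta)=\big(i(\tau\psi_x)_x,\ -(\xi^2+\wp)\vartheta+\eta(\xi)\psi(1)\big)$ with domain $D(\mathcal A)$ the set of $(\psi,\vartheta)\in\mathcal H$ such that $\psi\in H^2_\tau(0,1)\cap W^1_\tau(0,1)$, $(\tau\psi_x)(1)=i\zeta\int_{-\infty}^{+\infty}\eta(\xi)\vartheta(\xi)\,d\xi$, $-(\xi^2+\wp)\vartheta+\eta(\xi)\psi(1)\in L^2(\mathbb R)$ and $|\xi|\vartheta\in L^2(\mathbb R)$. $\mathcal A$ generates a $C_0$-semigroup of contractions on $\mathcal H$. *)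

(* Defs.v *)
From HB Require Import structures.
From mathcomp Require Import all_boot all_order all_algebra.
From mathcomp Require Import ring_quotient.
From mathcomp Require Import all_classical all_reals all_analysis.
From mathcomp Require Import complex ring.
From mathcomp Require Import measurable_realfun.

Set Implicit Arguments.
Unset Strict Implicit.
Unset Printing Implicit Defensive.

Import Order.TTheory GRing.Theory Num.Theory.
Import numFieldNormedType.Exports.
Import Normc.

Local Open Scope classical_set_scope.
Local Open Scope ring_scope.
Local Open Scope complex_scope.
Local Open Scope quotient_scope.

(* The notations Re and Im of numClosedFieldType are R[i]-valued. *)
Local Notation cRe := complex.Re.
Local Notation cIm := complex.Im.

Section SquareIntegrable.
Context {R : realType} (I : interval R).
Local Notation mu := (@lebesgue_measure R).

(* Only the values on I matter. *)
Definition sqint : {pred R -> R[i]} := mem [set f : R -> R[i] |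
  [/\ measurable_fun [set` I] (fun x => cRe (f x)),
      measurable_fun [set` I] (fun x => cIm (f x)) &
      mu.-integrable [set` I] (fun x => (normc (f x) ^+ 2)%:E)]].

Lemma sqintP (f : R -> R[i]) : reflect
  [/\ measurable_fun [set` I] (fun x => cRe (f x)),
      measurable_fun [set` I] (fun x => cIm (f x)) &
      mu.-integrable [set` I] (fun x => (normc (f x) ^+ 2)%:E)] (f \in sqint).
Proof. by apply: (iffP idP) => [/set_mem//|?]; exact/mem_set. Qed.

Lemma normc2E (z : R[i]) : normc z ^+ 2 = cRe z ^+ 2 + cIm z ^+ 2.
Proof. by case: z => a b /=; rewrite sqr_sqrtr// addr_ge0// sqr_ge0. Qed.

Lemma normc2D_le (a y z : R[i]) :
  normc (a * y + z) ^+ 2 <= 2 * (normc a ^+ 2 * normc y ^+ 2) + 2 * normc z ^+ 2.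
Proof.
rewrite -exprMn -normcM; set w := a * y.
rewrite !normc2E raddfD/= -subr_ge0.
rewrite [leRHS](_ : _ = (cRe w - cRe z) ^+ 2 + (cIm w - cIm z) ^+ 2).
  by rewrite addr_ge0 ?sqr_ge0.
by case: w => w1 w2; case: z => z1 z2 /=; ring.
Qed.

Lemma cReMD (a y z : R[i]) :
  cRe (a * y + z) = cRe a * cRe y - cIm a * cIm y + cRe z.
Proof. by case: a y z => ? ? [? ?] [? ?]. Qed.

Lemma cImMD (a y z : R[i]) :
  cIm (a * y + z) = cRe a * cIm y + cIm a * cRe y + cIm z.
Proof. by case: a y z => ? ? [? ?] [? ?]. Qed.

Lemma sqint_submod_closed : submod_closed sqint.
Proof.
split=> [|a f g /sqintP[mf1 mf2 mf] /sqintP[mg1 mg2 mg]]; apply/sqintP.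
  split => /=; [exact: measurable_cst|exact: measurable_cst|].
  have -> : (fun x : R => (normc ((0 : R -> R[i]) x) ^+ 2)%:E) = cst 0%E.
    by apply/funext => x; rewrite (normc2E (_ x)) /= expr0n addr0.
  exact: integrable0.
have mI : measurable [set` I] by exact: measurable_itv.
have m1 : measurable_fun [set` I] (fun x => cRe ((a *: f + g) x)).
  have -> : (fun x => cRe ((a *: f + g) x)) =
      (fun x => cRe a * cRe (f x) - cIm a * cIm (f x) + cRe (g x)).
    by apply/funext => x; exact: cReMD.
  by apply: measurable_funD => //; apply: measurable_funB; apply: measurable_funM.
have m2 : measurable_fun [set` I] (fun x => cIm ((a *: f + g) x)).
  have -> : (fun x => cIm ((a *: f + g) x)) =
      (fun x => cRe a * cIm (f x) + cIm a * cRe (f x) + cIm (g x)).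
    by apply/funext => x; exact: cImMD.
  by apply: measurable_funD => //; apply: measurable_funD; apply: measurable_funM.
split=> //.
apply: (@le_integrable _ _ _ mu _ mI _
  (fun x => (2 * normc a ^+ 2)%:E * (normc (f x) ^+ 2)%:E +
            2%:E * (normc (g x) ^+ 2)%:E)%E).
- apply/measurable_EFinP.
  have -> : (fun x => normc ((a *: f + g) x) ^+ 2) = (fun x =>
      cRe ((a *: f + g) x) ^+ 2 + cIm ((a *: f + g) x) ^+ 2).
    by apply/funext => x; exact: normc2E.
  by apply: measurable_funD; exact: measurable_funX.
- move=> x _; have n0 (z : R[i]) : 0 <= normc z ^+ 2 by exact: sqr_ge0.
  rewrite -!EFinM -EFinD lee_fin (ger0_norm (n0 _)) ger0_norm; last first.
    by apply: addr_ge0; apply: mulr_ge0 => //; exact: mulr_ge0.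
  by rewrite -mulrA; exact: normc2D_le.
- by apply: integrableD => //; exact: integrableZl.
Qed.

HB.instance Definition _ :=
  GRing.isSubmodClosed.Build R[i] (R -> R[i]) sqint sqint_submod_closed.

Record sqint_fun := SqintFun {
  sqint_val :> R -> R[i];
  sqint_valP : sqint_val \in sqint }.
HB.instance Definition _ := [isSub for sqint_val].
HB.instance Definition _ := [Choice of sqint_fun by <:].
HB.instance Definition _ := [SubChoice_isSubLmodule of sqint_fun by <:].

Definition ae_zero : {pred sqint_fun} :=
  mem [set f : sqint_fun | (f : R -> R[i]) = cst 0 %[ae mu in [set` I]]].

Lemma ae_zero_submod_closed : submod_closed ae_zero.
Proof.
split=> [|a f g /set_mem/= f0 /set_mem/= g0]; apply/mem_set => /=.
  exact: aeW.
move: f0 g0; apply: filterS2; first exact: (ae_filter_ringOfSetsType mu).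
move=> x f0 g0 Ix.
by rewrite [LHS](_ : _ = a * f x + g x)// f0// g0// mulr0 addr0.
Qed.

HB.instance Definition _ :=
  GRing.isSubmodClosed.Build R[i] sqint_fun ae_zero ae_zero_submod_closed.

Definition L2 : Type := Quotient.quot ae_zero.
HB.instance Definition _ := Choice.on L2.
HB.instance Definition _ := GRing.Zmodule.on L2.
HB.instance Definition _ := EqQuotient.on L2.

Definition L2_scale (a : R[i]) (x : L2) : L2 := \pi_L2 (a *: repr x).

Lemma piL2_eq (f g : sqint_fun) : \pi_L2 f = \pi_L2 g <->
  (f : R -> R[i]) = g %[ae mu in [set` I]].
Proof.
split=> [/eqP|fg]; last apply/eqP;
  rewrite -[X in is_true X]Quotient.idealrBE.
  move=> /set_mem /= fg.
  move: fg; apply: filterS; first exact: (ae_filter_ringOfSetsType mu).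
  by move=> x fg Ix; apply/eqP; rewrite -subr_eq0; apply/eqP; exact: fg.
apply/mem_set => /=; move: fg; apply: filterS.
  exact: (ae_filter_ringOfSetsType mu).
move=> x fg Ix.
by rewrite [LHS](_ : _ = f x - g x)// fg// subrr.
Qed.

Lemma piL2D (f g : sqint_fun) : \pi_L2 (f + g) = \pi_L2 f + \pi_L2 g.
Proof. exact: (raddfD (\pi_(Quotient.quot ae_zero))). Qed.

Lemma piL2Z (a : R[i]) (f : sqint_fun) :
  \pi_L2 (a *: f) = L2_scale a (\pi_L2 f).
Proof.
apply/piL2_eq; have /piL2_eq : \pi_L2 f = \pi_L2 (repr (\pi_L2 f)).
  by rewrite reprK.
apply: filterS; first exact: (ae_filter_ringOfSetsType mu).
by move=> x fx Ix; rewrite [LHS](_ : _ = a * f x)// fx.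
Qed.

Lemma L2_scaleA (a b : R[i]) (x : L2) :
  L2_scale a (L2_scale b x) = L2_scale (a * b) x.
Proof. by rewrite [L2_scale b x]/L2_scale -(piL2Z a) scalerA. Qed.

Lemma L2_scale1 : left_id 1 L2_scale.
Proof. by move=> x; rewrite /L2_scale scale1r reprK. Qed.

Lemma L2_scaleDr : right_distributive L2_scale +%R.
Proof.
move=> a x y; rewrite -[in LHS](reprK x) -[in LHS](reprK y) -piL2D -(piL2Z a).
by rewrite scalerDr piL2D.
Qed.

Lemma L2_scaleDl (x : L2) : {morph L2_scale^~ x : a b / a + b}.
Proof. by move=> a b; rewrite /L2_scale scalerDl piL2D. Qed.

HB.instance Definition _ := GRing.Zmodule_isLmodule.Build R[i] L2
  L2_scaleA L2_scale1 L2_scaleDr L2_scaleDl.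

Lemma repr_piL2 (f : sqint_fun) :
  (repr (\pi_L2 f) : R -> R[i]) = f %[ae mu in [set` I]].
Proof. by apply/piL2_eq; rewrite reprK. Qed.

Lemma reprL2D (x y : L2) : (repr (x + y) : R -> R[i]) =
  (fun t => repr x t + repr y t) %[ae mu in [set` I]].
Proof.
by have := repr_piL2 (repr x + repr y); rewrite piL2D !reprK.
Qed.

Lemma reprL2Z (a : R[i]) (x : L2) : (repr (a *: x) : R -> R[i]) =
  (fun t => a * repr x t) %[ae mu in [set` I]].
Proof. exact: (repr_piL2 (a *: repr x)). Qed.

Definition cintegral (f : R -> R[i]) : R[i] :=
  (\int[mu]_(x in [set` I]) cRe (f x)) +i* (\int[mu]_(x in [set` I]) cIm (f x)).

Definition L2inner (x y : L2) : R[i] :=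
  cintegral (fun t => repr x t * (repr y t)^*).

(* Membership in L^2(I) of a function known up to a.e. equality. *)
Definition inL2 (f : R -> R[i]) : Prop :=
  exists2 g, g \in sqint & f = g %[ae mu in [set` I]].

End SquareIntegrable.

Section Semigroup.
Context {R : realType} {V : lmodType R[i]} (nrm : V -> R).
Implicit Types (S : R -> V -> V) (A : V -> V -> Prop).

Definition opnorm (T : V -> V) : \bar R :=
  ereal_sup [set (nrm (T u))%:E | u in [set u | nrm u <= 1]].

(* Only the values S t for t >= 0 matter. *)
Record C0_semigroup S : Prop := {
  C0_linear : forall t, 0 <= t -> linear (S t);
  C0_bounded : forall t, 0 <= t -> (opnorm (S t) < +oo)%E;
  C0_zero : forall u, S 0 u = u;
  C0_add : forall s t, 0 <= s -> 0 <= t -> forall u, S (s + t) u = S s (S t u);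
  C0_continuous : forall u, nrm (S t u - u) @[t --> 0^'+] --> (0 : R) }.

(* u is in the domain of the infinitesimal generator of S, with image v. *)
Definition infinitesimal_generator S (u v : V) : Prop :=
  nrm ((t^-1)%:C *: (S t u - u) - v) @[t --> 0^'+] --> (0 : R).

(* The operator A is given by its graph. *)
Definition generates A S : Prop :=
  C0_semigroup S /\ forall u v, A u v <-> infinitesimal_generator S u v.

Definition exponentially_stable S : Prop :=
  exists M omega : R, [/\ 1 <= M, 0 < omega &
    forall t, 0 <= t -> (opnorm (S t) <= (M * expR (- omega * t))%:E)%E].

End Semigroup.

Section Regularity.
Context {R : realType}.
Implicit Types (A : set R) (f : R -> R) (g : R -> R[i]).

Definition diff_quotient f (x y : R) : R := (f y - f x) / (y - x).

(* Derivative relative to A, hence one-sided at an endpoint of an interval. *)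
Definition derive_in A f (x : R) : R :=
  lim (diff_quotient f x y @[y --> within A x^']).

Fixpoint continuously_differentiable n A f : Prop :=
  {within A, continuous f} /\
  if n is n'.+1 then
    (forall x, A x -> cvg (diff_quotient f x y @[y --> within A x^'])) /\
    continuously_differentiable n' A (derive_in A f)
  else True.

(* Pointwise derivative: it is the weak derivative of g, a.e. defined, when g  *)
(* is locally absolutely continuous.                                          *)
Definition cderive g (x : R) : R[i] :=
  derive1 (fun t => cRe (g t)) x +i* derive1 (fun t => cIm (g t)) x.

Definition absolutely_continuous (a b : R) g : Prop :=
  forall e : R, 0 < e -> exists2 d : R, 0 < d &
    forall (n : nat) (x y : 'I_n -> R),
      (forall i, a <= x i /\ x i <= y i /\ y i <= b) ->
      (forall i j, i != j -> y i <= x j \/ y j <= x i) ->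
      \sum_(i < n) (y i - x i) < d ->
      \sum_(i < n) normc (g (y i) - g (x i)) < e.

End Regularity.

Section Model.
Variable R : realType.
Variables (rho alpha wp : R) (tau : R -> R).
Local Notation mu := (@lebesgue_measure R).
Local Notation I01 := (`]0, 1[ : interval R).
Local Notation line := (`]-oo, +oo[ : interval R).
Implicit Types (psi q : R -> R[i]).

(* The junk value at xi = 0 when alpha < 1/2 is on a null set. *)
Definition eta (xi : R) : R := `|xi| `^ ((2 * alpha - 1) / 2).

Definition zeta : R := rho * pi^-1 * sin (alpha * pi).

Definition m_tau : \bar R := ereal_sup
  [set (x * `|derive_in `]0, 1] tau x| / tau x)%:E | x in `]0, 1]].

Definition H1 q : Prop :=
  [/\ absolutely_continuous 0 1 q, inL2 I01 q & inL2 I01 (cderive q)].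

Definition H1tau psi : Prop :=
  [/\ inL2 I01 psi,
      forall a, 0 < a -> a <= 1 -> absolutely_continuous a 1 psi &
      inL2 I01 (fun x => (Num.sqrt (tau x))%:C * cderive psi x)].

(* The value of the function psi at 0 is arbitrary, so psi(0) = 0 is read as  *)
(* a limit.                                                                   *)
Definition H10tau psi : Prop :=
  H1tau psi /\ normc (psi x) @[x --> 0^'+] --> (0 : R).

(* q is the absolutely continuous representative of tau psi_x. *)
Definition H2tau psi q : Prop :=
  [/\ H1tau psi, H1 q &
      q = (fun x => (tau x)%:C * cderive psi x) %[ae mu in [set` I01]]].

Definition W1tau psi : Prop :=
  if (m_tau < 1)%E then H10tau psi else H1tau psi.

Definition state : Type := (L2 I01 * L2 line)%type.
HB.instance Definition _ := GRing.Lmodule.on state.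

Definition state_inner (u v : state) : R[i] :=
  L2inner u.1 v.1 + zeta%:C * L2inner u.2 v.2.

Definition state_norm (u : state) : R := Num.sqrt (cRe (state_inner u u)).

Definition opA_snd psi (theta : R -> R[i]) (xi : R) : R[i] :=
  - (xi ^+ 2 + wp)%:C * theta xi + (eta xi)%:C * psi 1.

(* u is in D(A); psi is the representative of u.1 that is locally absolutely  *)
(* continuous in ]0, 1], and q that of tau psi_x.                             *)
Definition opA_domain (u : state) psi q : Prop :=
  [/\ (repr u.1 : R -> R[i]) = psi %[ae mu in [set` I01]],
      H2tau psi q /\ W1tau psi,
      q 1 = 'i * zeta%:C * cintegral line (fun xi => (eta xi)%:C * repr u.2 xi),
      inL2 line (opA_snd psi (repr u.2)) &
      inL2 line (fun xi => `|xi|%:C * repr u.2 xi)].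

(* The graph of the operator A. *)
Definition opA (u v : state) : Prop :=
  exists psi q, [/\ opA_domain u psi q,
    (repr v.1 : R -> R[i]) = (fun x => 'i * cderive q x)
      %[ae mu in [set` I01]] &
    (repr v.2 : R -> R[i]) = opA_snd psi (repr u.2) %[ae mu in [set` line]]].

End Model.

(* Main.v *)
Require Import Defs.
From mathcomp Require Import all_boot all_order all_algebra.
From mathcomp Require Import all_classical all_reals all_analysis.
From mathcomp Require Import complex.
From mathcomp Require Import ring lra measurable_realfun.

Set Implicit Arguments.
Unset Strict Implicit.
Unset Printing Implicit Defensive.

Import Order.TTheory GRing.Theory Num.Theory.
Import numFieldNormedType.Exports.
Import Normc.

Local Open Scope classical_set_scope.
Local Open Scope ring_scope.

Local Notation cRe := complex.Re.
Local Notation cIm := complex.Im.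

(** An exponentially stable semigroup has a uniformly bounded resolvent on the
imaginary axis: [nrm u <= C * nrm (A u - i a u)] for all [u] in the domain and
all real [a] ([exponentially_stable_resolvent_bound]).  It is therefore enough
to find quasi-modes, that is, states [u] with [A u - i a u] small compared
with [u].  They exist at high frequency because the memory variable responds
to a signal of frequency [z] with a gain [kappa] that decays like a negative
power of [z] ([kappa_bound]), so that the boundary condition at [1]
approaches the conservative one [(tau psi_x)(1) = 0].

Put [a = - z].  Eliminating the memory variable leaves
[(tau psi')' + z psi = 0] with [(tau psi')(1) = i kappa psi(1)].  Let [psi(z)]
be the real solution that satisfies the boundary condition at [0]; it is an
entire function of [z], constructed as a power series ([solution]) whose
coefficients decay factorially because the order [m] of degeneracy is less
than [2].  Write [D], [B] for [psi(1)], [(tau psi')(1)], and [N] for the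
integral of [psi^2].

- The Rellich multiplier [x psi'] gives, uniformly in [z],
  [B^2 + z tau(1) D^2 - K D B <= C z N] ([multiplier_estimate]).
- With the Lagrange identity [B' D - B D' = - N], where the prime is the
  derivative in [z], it turns into a Riccati inequality for [D / B], whose
  solutions blow up; hence [B] vanishes for arbitrarily large [z]
  ([riccati_oscillation], [eigenvalues_unbounded]).
- At a zero of [B] the derivative of [psi] with respect to [z] solves the
  equation with right-hand side [- psi].  A small complex multiple
  [r = O(kappa)] of it corrects the boundary condition, at the price of an
  error [r psi] in the equation ([quasimode]).

The corrected function could be much smaller than [psi].  But the bound to be
contradicted says that its norm is at most [C |r|] times that of [psi]; the
multiplier applied to the corrected function then bounds [D^2] by
[|kappa|^2 D^2], up to a constant, which is impossible for small [kappa]. *)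

(** * Derivatives and primitives of real functions *)
Section PointwiseDerivatives.
Context {R : realType}.
Implicit Types (f g : R -> R) (x a b k : R).

(** The rules are stated for explicit abstractions so that they compose, by
unification alone, into the derivative of a formula. *)
Lemma is_derive_addf f g x a b : is_derive x 1 f a -> is_derive x 1 g b ->
  is_derive x 1 (fun y => f y + g y) (a + b).
Proof. exact: is_deriveD. Qed.

Lemma is_derive_subf f g x a b : is_derive x 1 f a -> is_derive x 1 g b ->
  is_derive x 1 (fun y => f y - g y) (a - b).
Proof. exact: is_deriveB. Qed.

Lemma is_derive_mulf f g x a b : is_derive x 1 f a -> is_derive x 1 g b ->
  is_derive x 1 (fun y => f y * g y) (a * g x + f x * b).
Proof.
move=> df dg; have := is_deriveM df dg.
by rewrite /GRing.scale/= addrC (mulrC (g x)).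
Qed.

Lemma is_derive_scalef k f x a : is_derive x 1 f a -> is_derive x 1 (fun y => k * f y) (k * a).
Proof. exact: is_deriveZ. Qed.

Lemma is_derive_cstf k x : is_derive x 1 (fun _ : R => k) 0.
Proof. exact: is_derive_cst. Qed.

Lemma is_derive_idf x : is_derive x 1 (fun y : R => y) 1.
Proof. exact: is_derive_id. Qed.

Lemma is_derive_invf f x a : f x != 0 -> is_derive x 1 f a ->
  is_derive x 1 (fun y => (f y)^-1) (- a / f x ^+ 2).
Proof.
move=> f0 df; have := is_deriveV f0 df.
by rewrite /GRing.scale/= mulNr mulrC mulNr.
Qed.

Lemma is_derive_compf f g x a b : is_derive (g x) 1 f a -> is_derive x 1 g b ->
  is_derive x 1 (fun y => f (g y)) (a * b).
Proof. exact: is_derive1_comp. Qed.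

Lemma is_derive_expf n f x a : is_derive x 1 f a ->
  is_derive x 1 (fun y => f y ^+ n) (n%:R * f x ^+ n.-1 * a).
Proof.
move=> df; elim: n => [|n IHn].
  by rewrite mul0r mul0r (_ : (fun y => _) = (fun=> 1)); [exact: is_derive_cstf|exact/funext].
rewrite (_ : (fun y => _) = (fun y => f y * f y ^+ n)); last first.
  by apply/funext => y; rewrite exprS.
have -> : n.+1%:R * f x ^+ n.+1.-1 * a =
    a * f x ^+ n + f x * (n%:R * f x ^+ n.-1 * a).
  by case: n {IHn} => [|n] /=; rewrite ?expr0 ?exprS -natr1; ring.
exact: is_derive_mulf.
Qed.

Lemma is_derive_near f g x a : (\forall y \near x, f y = g y) ->
  is_derive x 1 f a -> is_derive x 1 g a.
Proof.
exact: near_eq_is_derive.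
Qed.

End PointwiseDerivatives.

Section Primitive.
Context {R : realType}.
Local Notation mu := (@lebesgue_measure R).
Implicit Types (f g : R -> R) (c x y C : R).

Lemma is_derive_continuous f x a : is_derive x 1 f a -> {for x, continuous f}.
Proof.
by move=> [fx _]; apply: differentiable_continuous; exact/derivable1_diffP.
Qed.

Lemma continuous_in_within f (A : set R) :
  (forall x, A x -> {for x, continuous f}) -> {within A, continuous f}.
Proof.
by move=> cf; apply: continuous_in_subspaceT => x /set_mem; exact: cf.
Qed.

Lemma integral_derive (F f : R -> R) a b : a < b ->
  (forall y, a <= y <= b -> {for y, continuous f}) ->
  (forall y, a <= y <= b -> is_derive y 1 F (f y)) ->
  (\int[mu]_(y in `[a, b]) (f y)%:E = (F b - F a)%:E)%E.
Proof.
move=> ab cf dF; rewrite EFinB.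
apply: continuous_FTC2 => //.
- by apply: continuous_in_within => y /=; rewrite in_itv/=; exact: cf.
- split.
  + move=> y; rewrite in_itv/= => /andP[ay yb].
    by have [] := dF y (introT andP (conj (ltW ay) (ltW yb))).
  + apply: cvg_at_right_filter; apply: is_derive_continuous (dF a _).
    by rewrite lexx ltW.
  + apply: cvg_at_left_filter; apply: is_derive_continuous (dF b _).
    by rewrite lexx ltW.
- move=> y; rewrite in_itv/= => /andP[ay yb].
  by have [_] := dF y (introT andP (conj (ltW ay) (ltW yb))); rewrite derive1E.
Qed.

Lemma integral_powR_segment c a x : c + 1 != 0 -> 0 < a -> a < x ->
  (\int[mu]_(y in `[a, x]) (y `^ c)%:E =
   (x `^ (c + 1) / (c + 1) - a `^ (c + 1) / (c + 1))%:E)%E.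
Proof.
move=> c10 a0 ax.
apply: (@integral_derive (fun y => y `^ (c + 1) / (c + 1))) => // y /andP[ay _].
  exact: is_derive_continuous (is_derive1_powR c (lt_le_trans a0 ay)).
have dp := is_derive1_powR (c + 1) (lt_le_trans a0 ay).
have -> : (fun y => y `^ (c + 1) / (c + 1)) =
    (fun y => (c + 1)^-1 * y `^ (c + 1)).
  by apply/funext => z; rewrite mulrC.
by have := is_derive_scalef (c + 1)^-1 dp; rewrite addrK mulKf.
Qed.

Lemma oc_bigcup_segment x : 0 < x ->
  `]0, x]%classic = \bigcup_n `[x / n.+2%:R, x]%classic.
Proof.
move=> x0; apply/seteqP; split => y /=.
  rewrite in_itv/= => /andP[y0 yx].
  exists (Num.truncn (x / y)) => //=; rewrite in_itv/= yx andbT.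
  rewrite ler_pdivrMr ?ltr0n// mulrC -ler_pdivrMr//.
  apply: ltW; apply: lt_trans (truncnS_gt _) _.
  by rewrite ltr_nat.
move=> [n _] /=; rewrite !in_itv/= => /andP[ny ->]; rewrite andbT.
by apply: lt_le_trans ny; rewrite divr_gt0// ltr0n.
Qed.

(** Monotone convergence as an upper bound: the form in which the improper
integrals below are estimated. *)
Lemma integral_bigcup_le (F : (set R)^nat) (f : R -> \bar R) (C : \bar R) :
  nondecreasing_seq F -> (forall n, measurable (F n)) ->
  (forall n, measurable_fun (F n) f) -> (forall x, 0%:E <= f x)%E ->
  (forall n, \int[mu]_(x in F n) f x <= C)%E ->
  (\int[mu]_(x in \bigcup_n F n) f x <= C)%E.
Proof.
move=> nF mF mf f0 FC.
have cvgF : (\int[mu]_(y in F i) f y @[i --> \oo] -->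
    \int[mu]_(y in \bigcup_i F i) f y)%E.
  by apply: ge0_nondecreasing_set_cvg_integral => // n y _; exact: f0.
rewrite -(cvg_lim _ cvgF)//; apply: lime_le; first exact: cvgP cvgF.
exact: nearW.
Qed.

Lemma integral_powR_le c x : -1 < c -> 0 < x ->
  (\int[mu]_(y in `]0%R, x]) (y `^ c)%:E <= (x `^ (c + 1) / (c + 1))%:E)%E.
Proof.
move=> c1 x0; rewrite oc_bigcup_segment//; apply: integral_bigcup_le.
- apply/nondecreasing_seqP => n; rewrite subsetEset => y /=.
  rewrite !in_itv/= => /andP[ny ->]; rewrite andbT; apply: le_trans ny.
  by rewrite ler_pM2l// lef_pV2 ?posrE ?ltr0n// ler_nat.
- by move=> n; exact: measurable_itv.
- by move=> n; apply/measurable_EFinP; exact: measurable_funTS (measurable_powR _).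
- by move=> y; rewrite lee_fin powR_ge0.
move=> n; rewrite integral_powR_segment//.
- by rewrite lee_fin gerBl divr_ge0 ?powR_ge0//; lra.
- by rewrite gt_eqF// -ltrBlDr sub0r.
- by rewrite divr_gt0// ltr0n.
- by rewrite ltr_pdivrMr ?ltr0n// ltr_pMr// ltr1n.
Qed.

(** The interval is open at [0], where the integrands may be singular. *)
Definition primitive f x : R := \int[mu]_(y in `]0, x]) f y.

Section Bounded.
Variables (f : R -> R) (b C c : R).
Hypothesis cf : forall y, 0 < y < b -> {for y, continuous f}.
Hypothesis fC : forall y, 0 < y < b -> `|f y| <= C * y `^ c.
Hypothesis c1 : -1 < c.

Lemma primitive_integrable x : x < b -> mu.-integrable `]0, x] (EFin \o f).
Proof.
move=> xb; have [x0|x0] := ltP 0 x; last first.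
  by rewrite set_itv_ge ?bnd_simp -?leNgt//; exact: integrable_set0.
have ip : mu.-integrable `]0, x] (fun y => (y `^ c)%:E).
  apply/integrableP; split.
    by apply/measurable_EFinP; exact: measurable_funTS (measurable_powR _).
  under eq_integral do rewrite gee0_abs ?lee_fin ?powR_ge0//.
  exact: le_lt_trans (integral_powR_le c1 x0) (ltry _).
apply: (@le_integrable _ _ _ mu _ _ _ (fun y => (C%:E * (y `^ c)%:E)%E)) => //.
- apply/measurable_EFinP.
  apply: (@measurable_funS _ _ _ _ `]0, b[%classic) => //.
    by apply: subset_itvl; rewrite bnd_simp.
  apply: open_continuous_measurable_fun => //.
  by move=> y /set_mem/=; rewrite in_itv/=; exact: cf.
- move=> y /=; rewrite in_itv/= => /andP[y0 yx].
  rewrite lee_fin; apply: le_trans (ler_norm _).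
  by apply: fC; rewrite y0 (le_lt_trans yx).
- exact: integrableZl.
Qed.

Lemma is_derive_primitive x : 0 < x < b -> is_derive x 1 (primitive f) (f x).
Proof.
move=> /andP[x0 xb]; pose u := (x + b) / 2.
have xu : x < u by rewrite /u; lra.
have ub : u < b by rewrite /u; lra.
have := @continuous_FTC1 _ f (BRight 0) x u xu (primitive_integrable ub).
have x0' : (BRight 0 < BRight x)%O by rewrite bnd_simp.
have cfx : {for x, continuous f} by apply: cf; rewrite x0.
by move=> /(_ x0' cfx)[dx f'x]; split; rewrite -?derive1E.
Qed.

Lemma primitive_normr_le x : 0 < x < b ->
  `|primitive f x| <= C * (x `^ (c + 1) / (c + 1)).
Proof.
move=> /andP[x0 xb]; have C0 : 0 <= C.
  have := le_trans (normr_ge0 _) (fC (introT andP (conj x0 xb))).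
  by rewrite pmulr_lge0// powR_gt0.
have fi := primitive_integrable xb.
apply: le_trans (le_normr_Rintegral _ fi) _ => //.
rewrite -lee_fin /Rintegral fineK; last first.
  by apply: integrable_fin_num => //; exact: integrable_norm fi.
apply: (@le_trans _ _ (\int[mu]_(y in `]0%R, x]) (C%:E * (y `^ c)%:E))%E).
  apply: ge0_le_integral => //.
  - by apply/measurable_EFinP; apply: measurableT_comp => //; apply/measurable_EFinP;
      case/integrableP: fi.
  - apply/measurable_EFinP; apply: measurable_funM => //.
    exact: measurable_funTS (measurable_powR _).
  - move=> y /=; rewrite in_itv/= => /andP[y0 yx].
    by rewrite lee_fin fC// y0 (le_lt_trans yx).
rewrite ge0_integralZl//.
- by rewrite EFinM lee_wpmul2l ?lee_fin//; exact: integral_powR_le.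
- by apply/measurable_EFinP; exact: measurable_funTS (measurable_powR _).
- by move=> y _; rewrite lee_fin powR_ge0.
Qed.

Lemma primitive0 : primitive f 0 = 0.
Proof.
by rewrite /primitive set_itv_ge ?bnd_simp ?ltxx// Rintegral_set0.
Qed.

End Bounded.
End Primitive.

(** * Termwise differentiation of series *)
Section Termwise.
Context {R : realType}.
Implicit Types (f : R -> R) (x y a b : R) (u M : R ^nat).

Lemma mean_value f f' a b : a < b ->
  (forall y, a <= y <= b -> is_derive y 1 f (f' y)) ->
  exists c, [/\ a < c, c < b & f b - f a = f' c * (b - a)].
Proof.
move=> ab df.
have [y yab||c cab fab] := @MVT R f f' a b ab.
- by apply: df; move: yab; rewrite in_itv/= => /andP[/ltW -> /ltW ->].
- apply: continuous_in_within => y /=; rewrite in_itv/= => /df.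
  exact: is_derive_continuous.
- by exists c; move: cab; rewrite in_itv/= => /andP[].
Qed.

Lemma mean_value_bound f f' a b (M : R) : a <= b ->
  (forall y, a <= y <= b -> is_derive y 1 f (f' y)) ->
  (forall y, a <= y <= b -> `|f' y| <= M) ->
  `|f b - f a| <= M * (b - a).
Proof.
rewrite le_eqVlt => /predU1P[->|ab] df fM; first by rewrite !subrr normr0 mulr0.
have [c [ac cb ->]] := mean_value ab df.
rewrite normrM (gtr0_norm (_ : 0 < b - a)) ?subr_gt0//.
by rewrite ler_wpM2r ?subr_ge0 ?(ltW ab)// fM// (ltW ac) ltW.
Qed.

Lemma series_diff_le u M (m n : nat) : (forall k, `|u k| <= M k) -> (m <= n)%N ->
  `|series u n - series u m| <= series M n - series M m.
Proof.
move=> uM mn; rewrite !sub_series_geq//.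
by apply: le_trans (ler_norm_sum _ _ _) _; apply: ler_sum => i _; exact: uM.
Qed.

Lemma series_dominated u M : (forall k, `|u k| <= M k) -> cvgn (series M) ->
  cvgn (series u).
Proof.
move=> uM cM; apply: normed_cvg; apply: series_le_cvg cM => k //=.
by apply: le_trans (uM k).
Qed.

Lemma series_tail_le u M (n : nat) : (forall k, `|u k| <= M k) ->
  cvgn (series M) ->
  `|limn (series u) - series u n| <= limn (series M) - series M n.
Proof.
move=> uM cM; have cu := series_dominated uM cM.
have cu' : `|series u k - series u n| @[k --> \oo] -->
    `|limn (series u) - series u n|.
  by apply: cvg_norm; apply: cvgB => //; exact: cvg_cst.
have cM' : series M k - series M n @[k --> \oo] --> limn (series M) - series M n.
  by apply: cvgB => //; exact: cvg_cst.
rewrite -(cvg_lim _ cu')// -(cvg_lim _ cM')//.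
apply: ler_lim; [exact: cvgP cu'|exact: cvgP cM'|].
by exists n => // k /= nk; exact: series_diff_le.
Qed.

Lemma series_norm_le u M : (forall k, `|u k| <= M k) -> cvgn (series M) ->
  `|limn (series u)| <= limn (series M).
Proof.
by move=> uM cM; have := series_tail_le 0 uM cM; rewrite /series/= !big_geq// !subr0.
Qed.

(** By the mean value theorem the difference quotients of [F k] are bounded by
[M k], so the tails of the series are small uniformly in the increment, and
only finitely many terms have to converge. *)
Lemma is_derive_series (F G : nat -> R -> R) M a b x : a < x < b ->
  (forall k y, a < y < b -> is_derive y 1 (F k) (G k y)) ->
  (forall k y, a < y < b -> `|G k y| <= M k) ->
  (forall y, a < y < b -> cvgn (series (F^~ y))) ->
  cvgn (series M) ->
  is_derive x 1 (fun y => limn (series (F^~ y))) (limn (series (G^~ x))).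
Proof.
move=> axb dF GM cF cM.
pose D h k := h^-1 * (F k (h + x) - F k x).
have DM (h : R) k : h != 0 -> a < h + x < b -> `|D h k| <= M k.
  move=> h0 hab; rewrite normrM normfV -ler_pdivlMl ?invr_gt0 ?normr_gt0// invrK.
  have [hp|hn] := ltP 0 h.
    rewrite (gtr0_norm hp) mulrC; have := @mean_value_bound (F k) (G k) x (h + x) (M k).
    rewrite addrK; apply; [lra| |] => y ?; [apply: dF|apply: GM]; lra.
  have hn' : h < 0 by rewrite lt_neqAle h0.
  rewrite (ltr0_norm hn') mulrC; have := @mean_value_bound (F k) (G k) (h + x) x (M k).
  rewrite opprD addrCA subrr addr0 distrC.
  apply; [lra| |] => y ?; [apply: dF|apply: GM]; lra.
have Dlim k : D h k @[h --> 0^'] --> G k x.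
  have [/cvg_ex[l dl] <-] := dF k x axb.
  rewrite /derive; have -> : (fun h => h^-1 *: ((F k \o shift x) (h *: 1) - F k x)) =
    D^~ k by apply/funext => h; rewrite /D /= /GRing.scale/= mulr1.
  have dl' : D h k @[h --> 0^'] --> l.
    apply: cvg_trans dl; apply: near_eq_cvg; apply: nearW => h.
    by rewrite /D /= /GRing.scale/= mulr1.
  by rewrite (cvg_lim _ dl').
have SD (h : R) : h != 0 -> a < h + x < b ->
    h^-1 * (limn (series (F^~ (h + x))) - limn (series (F^~ x))) = limn (series (D h)).
  move=> h0 hab; apply/esym/cvg_lim => //.
  have -> : series (D h) =
      (fun n => h^-1 * (series (F^~ (h + x)) n - series (F^~ x) n)).
    by apply/funext => n; rewrite /series/= -sumrB mulr_sumr.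
  by apply: cvgMr; apply: cvgB; exact: cF.
have main : h^-1 * (limn (series (F^~ (h + x))) - limn (series (F^~ x)))
    @[h --> 0^'] --> limn (series (G^~ x)).
  apply/cvgrPdist_lt => e e0; have e4 : 0 < e / 4 by lra.
  have /cvgrPdist_lt/(_ _ e4)[N _ tailN] := cM.
  have {tailN} tailN := le_lt_trans (ler_norm _) (tailN N (leqnn N)).
  have SN : series (D h) N @[h --> 0^'] --> series (G^~ x) N.
    elim: (N) => [|n IHn].
      rewrite /series/= big_geq//.
      by under eq_fun do rewrite big_geq//; exact: cvg_cst.
    rewrite seriesSr; under eq_fun do rewrite seriesSr.
    by apply: cvgD => //; exact: Dlim.
  move/cvgrPdist_lt : SN => /(_ _ e4) SN.
  (* three pieces below e / 4: two tails and a finite part *)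
  near=> h.
  have h0 : h != 0 by near: h; exact: nbhs_dnbhs_neq.
  have hab : a < h + x < b.
    have : `|h| < Num.min (x - a) (b - x).
      near: h; apply: dnbhs0_lt; rewrite lt_min !subr_gt0; lra.
    by rewrite lt_min !ltr_norml; lra.
  rewrite SD//.
  have t1 := series_tail_le N (fun k => DM h k h0 hab) cM.
  have t2 := series_tail_le N (fun k => GM k x axb) cM.
  have t3 : `|series (G^~ x) N - series (D h) N| < e / 4 by near: h.
  have t0 := tailN; move: t0 t1 t2 t3.
  move: (limn _ : R) (limn (series M) : R) (limn _ : R) (series M N : R)
    (series (D h) N : R) (series (G^~ x) N : R) => A B C B' A' C' t0.
  by rewrite !ler_norml !ltr_norml => /andP[? ?] /andP[? ?] /andP[? ?]; lra.
have E : (fun h => h^-1 *: (((fun y => limn (series (F^~ y))) \o shift x) (h *: 1) -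
     limn (series (F^~ x)))) =
   (fun h => h^-1 * (limn (series (F^~ (h + x))) - limn (series (F^~ x)))).
  by apply/funext => h; rewrite /= /GRing.scale/= mulr1.
split; first by apply/cvg_ex; exists (limn (series (G^~ x))); rewrite E.
by rewrite /derive E; exact: cvg_lim.
Unshelve. all: by end_near. Qed.

End Termwise.

(** * Solutions of the eigenvalue equation as power series in the parameter *)
Section SeriesShift.
Context {R : realType}.
Implicit Types u v : R ^nat.

Lemma series_recl u n : series u n.+1 = u 0%N + series (fun k => u k.+1) n.
Proof. by rewrite /series/= big_nat_recl. Qed.

Lemma cvg_series_recl u l : series (fun k => u k.+1) @ \oo --> l ->
  series u @ \oo --> u 0%N + l.
Proof.
move=> cu; rewrite -cvg_shiftS; under eq_fun do rewrite series_recl.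
by apply: cvgD => //; exact: cvg_cst.
Qed.

Lemma is_cvg_series_recl u : cvgn (series (fun k => u k.+1)) -> cvgn (series u).
Proof. by move=> /cvg_series_recl /cvgP. Qed.

Lemma lim_series_recl u : cvgn (series (fun k => u k.+1)) ->
  limn (series u) = u 0%N + limn (series (fun k => u k.+1)).
Proof. by move=> /cvg_series_recl /cvg_lim; exact. Qed.

Lemma is_cvg_series_behead u : cvgn (series u) -> cvgn (series (fun k => u k.+1)).
Proof.
move=> cu; apply/cvg_ex; exists (limn (series u) - u 0%N).
have -> : series (fun k => u k.+1) = (fun n => series u n.+1 - u 0%N).
  by apply/funext => n; rewrite series_recl addrC addKr.
by apply: cvgB; [rewrite (cvg_shiftS (series u))|exact: cvg_cst].
Qed.

Lemma series_norm_leM u v (s : R) : (forall k, `|u k| <= s * v k) ->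
  cvgn (series v) -> `|limn (series u)| <= s * limn (series v).
Proof.
move=> uv cv; have e : series (fun k => s * v k) = (fun n => s * series v n).
  by apply/funext => n; rewrite /series/= mulr_sumr.
have cs : series (fun k => s * v k) @ \oo --> s * limn (series v).
  by rewrite e; apply: cvgMr.
by rewrite -(cvg_lim _ cs)//; apply: series_norm_le uv (cvgP _ cs).
Qed.

Lemma lim_series_comb u v (s t : R) : cvgn (series u) -> cvgn (series v) ->
  limn (series (fun k => s * u k + t * v k)) =
  s * limn (series u) + t * limn (series v).
Proof.
move=> cu cv; apply/cvg_lim => //.
have -> : series (fun k => s * u k + t * v k) =
    (fun n => s * series u n + t * series v n).
  by apply/funext => n; rewrite /series/= big_split/= !mulr_sumr.
by apply: cvgD; apply: cvgMr.
Qed.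

Lemma cvg_series_expr_exp_coeff (K r L : R) :
  cvgn (series (fun k => K * r ^+ k * exp_coeff L k)).
Proof.
have -> : (fun k => K * r ^+ k * exp_coeff L k) = K *: exp_coeff (r * L).
  apply/funext => k; rewrite /exp_coeff/= /GRing.scale/= exprMn.
  by rewrite [RHS]mulrA [in RHS]mulrA mulrA.
by apply: is_cvg_seriesZ; exact: is_cvg_series_exp_coeff.
Qed.

End SeriesShift.

(** The data at [0] of the equation [(v' / w)' + z v = 0] on the interval [(0, 2)],
where [w] is the reciprocal of the coefficient: [phi0] is the solution for
[z = 0] and [p0] its constant flux [v' / w].  The two boundary conditions at
[0] are treated together, as [phi0 = 1], [p0 = 0], or as [phi0] the primitive
of [w], [p0 = 1].  The last field is what makes the boundary terms at [0]
vanish. *)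
Record fundamental_data {R : realType} (w phi0 : R -> R) (p0 Cw m C0 : R) : Prop := {
  fd_continuous : forall y : R, 0 < y < 2 -> {for y, continuous w};
  fd_le : forall y : R, 0 < y < 2 -> `|w y| <= Cw * y `^ (- m);
  fd_m_ge0 : 0 <= m;
  fd_m_lt2 : m < 2;
  fd_deriv : forall y : R, 0 < y < 2 -> is_derive y 1 phi0 (p0 * w y);
  fd_phi0_le : forall y : R, 0 < y < 2 -> `|phi0 y| <= C0;
  fd_flux : p0 * phi0 x @[x --> (0 : R)^'+] --> (0 : R) }.

Section FundamentalSeries.
Context {R : realType}.
Variables (w phi0 : R -> R) (p0 Cw m C0 : R).

(** The coefficient of [(- z) ^+ k] in the solution for the parameter [z]:
integrating the equation twice maps [phi k] to [phi k.+1]. *)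
Fixpoint phi k : R -> R :=
  if k is k'.+1 then primitive (fun y => primitive (phi k') y * w y) else phi0.

Definition phi_int k : R -> R := primitive (phi k).

Hypothesis H : fundamental_data w phi0 p0 Cw m C0.
Let cw := fd_continuous H.
Let wC := fd_le H.
Let m0 := fd_m_ge0 H.
Let m2 := fd_m_lt2 H.
Let dphi0 := fd_deriv H.
Let phi0C := fd_phi0_le H.

Let b : R := 2 - m.
Let A : R := Cw / b.
Let L : R := A * 2 `^ b.

Let b0 : 0 < b. Proof. by rewrite subr_gt0. Qed.

Let Cw0 : 0 <= Cw.
Proof.
have h : 0 < (1 : R) < 2 by lra.
by have := le_trans (normr_ge0 _) (wC h); rewrite powR1 mulr1.
Qed.

Let C00 : 0 <= C0.
Proof.
have h : 0 < (1 : R) < 2 by lra.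
exact: le_trans (normr_ge0 _) (phi0C h).
Qed.

Let A0 : 0 <= A. Proof. by rewrite divr_ge0 ?(ltW b0). Qed.

(** Each step gains a factor [(Cw / b) * y `^ b / k.+1] with [b = 2 - m], because the
integrand [phi_int k * w] is of order [y `^ (k.+1 * b - 1)].  This is where a
degeneracy of order less than [2] is needed; the resulting factorials make the
series entire in the parameter. *)
Let phi_phi_int k :
  [/\ forall y : R, 0 < y < 2 -> {for y, continuous (phi k)},
      forall y : R, 0 < y < 2 -> `|phi k y| <= C0 * exp_coeff A k * y `^ (k%:R * b),
      forall y : R, 0 < y < 2 -> is_derive y 1 (phi_int k) (phi k y) &
      forall y : R, 0 < y < 2 ->
        `|phi_int k y| <= C0 * exp_coeff A k * y `^ (k%:R * b + 1)].
Proof.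
have step j : (forall y : R, 0 < y < 2 -> {for y, continuous (phi j)}) ->
    (forall y : R, 0 < y < 2 -> `|phi j y| <= C0 * exp_coeff A j * y `^ (j%:R * b)) ->
    (forall y : R, 0 < y < 2 -> is_derive y 1 (phi_int j) (phi j y)) /\
    (forall y : R, 0 < y < 2 ->
        `|phi_int j y| <= C0 * exp_coeff A j * y `^ (j%:R * b + 1)).
  move=> cp bp.
  have jb : 0 <= j%:R * b by rewrite mulr_ge0 ?(ltW b0).
  have jb1 : -1 < j%:R * b by lra.
  split => y y02; first exact: is_derive_primitive cp bp jb1 y y02.
  apply: le_trans (primitive_normr_le cp bp jb1 y02) _.
  apply: ler_wpM2l; first by rewrite mulr_ge0// exp_coeff_ge0.
  rewrite ler_pdivrMr; last by lra.
  by rewrite ler_peMr ?powR_ge0//; lra.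
elim: k => [|k [cp bp dm bm]].
  have cp : forall y : R, 0 < y < 2 -> {for y, continuous (phi 0)}.
    by move=> y /dphi0; exact: is_derive_continuous.
  have bp : forall y : R, 0 < y < 2 ->
      `|phi 0 y| <= C0 * exp_coeff A 0 * y `^ (0%:R * b).
    by move=> y /phi0C; rewrite /exp_coeff/= mul0r powRr0 expr0 fact0 divr1 !mulr1.
  by have [? ?] := step 0%N cp bp.
have kb : k%:R * b + 1 - m = k.+1%:R * b - 1 by rewrite /b -natr1; ring.
have kb0 : 0 < k.+1%:R * b by rewrite mulr_gt0.
have kb1 : -1 < k.+1%:R * b - 1 by lra.
have cg (y : R) : 0 < y < 2 -> {for y, continuous (fun y => phi_int k y * w y)}.
  by move=> y02; apply: cvgM; [exact: is_derive_continuous (dm y y02)|exact: cw].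
have bg (y : R) : 0 < y < 2 -> `|phi_int k y * w y| <=
    (C0 * exp_coeff A k * Cw) * y `^ (k.+1%:R * b - 1).
  move=> y02; rewrite normrM.
  apply: le_trans (ler_pM (normr_ge0 _) (normr_ge0 _) (bm y y02) (wC y02)) _.
  rewrite -kb (@powRD _ y (_ + 1) (- m)); last by apply/implyP; case/andP: y02 => /lt0r_neq0.
  by rewrite le_eqVlt; apply/orP; left; apply/eqP; ring.
have cp' : forall y : R, 0 < y < 2 -> {for y, continuous (phi k.+1)}.
  move=> y y02; apply: is_derive_continuous.
  exact: is_derive_primitive cg bg kb1 y y02.
have bp' : forall y : R, 0 < y < 2 ->
    `|phi k.+1 y| <= C0 * exp_coeff A k.+1 * y `^ (k.+1%:R * b).
  move=> y y02; apply: le_trans (primitive_normr_le cg bg kb1 y02) _.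
  rewrite subrK le_eqVlt; apply/orP; left; apply/eqP.
  rewrite /exp_coeff/= exprS factS natrM invfM /A.
  have ? : k`!%:R != 0 :> R by rewrite pnatr_eq0 -lt0n fact_gt0.
  have ? : k.+1%:R != 0 :> R by rewrite pnatr_eq0.
  have ? : b != 0 by rewrite gt_eqF.
  by field; apply/and3P.
by have [? ?] := step k.+1 cp' bp'.
Qed.

Lemma is_derive_phi_int k (y : R) : 0 < y < 2 -> is_derive y 1 (phi_int k) (phi k y).
Proof. by move=> y02; have [_ _ h _] := phi_phi_int k; exact: h. Qed.

Definition dphi k (y : R) : R := (if k is k'.+1 then phi_int k' y else p0) * w y.

Lemma is_derive_phi k (y : R) : 0 < y < 2 -> is_derive y 1 (phi k) (dphi k y).
Proof.
case: k => [|k] y02; first exact: dphi0.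
have [_ _ dm bm] := phi_phi_int k.
apply: (@is_derive_primitive _ _ 2 (C0 * exp_coeff A k * Cw)
  (k%:R * b + 1 - m)) => // [z z02|z z02|].
- by apply: cvgM; [exact: is_derive_continuous (dm z z02)|exact: cw].
- rewrite normrM (@powRD _ z (_ + 1) (- m)); last first.
    by apply/implyP; case/andP: z02 => /lt0r_neq0.
  apply: le_trans (ler_pM (normr_ge0 _) (normr_ge0 _) (bm z z02) (wC z02)) _.
  by rewrite le_eqVlt; apply/orP; left; apply/eqP; ring.
- have : 0 <= k%:R * b by rewrite mulr_ge0 ?(ltW b0).
  by move: m2; lra.
Qed.

Let powR_le k (y : R) : 0 < y < 2 -> y `^ (k%:R * b) <= (2 `^ b) ^+ k.
Proof.
move=> /andP[y0 y2]; rewrite -powR_mulrn ?powR_ge0// -powRrM mulrC.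
apply: ge0_ler_powR; rewrite ?nnegrE ?(ltW y0) ?(ltW y2)//.
by rewrite mulr_ge0 ?(ltW b0).
Qed.

Let exp_coeff_L k : exp_coeff A k * (2 `^ b) ^+ k = exp_coeff L k.
Proof. by rewrite /exp_coeff/= [in RHS]/L [in RHS](exprMn _ A) [LHS]mulrAC. Qed.

Lemma phi_le k (y : R) : 0 < y < 2 -> `|phi k y| <= C0 * exp_coeff L k.
Proof.
move=> y02; have [_ h _ _] := phi_phi_int k; apply: le_trans (h y y02) _.
rewrite -exp_coeff_L (mulrA C0 _ (_ ^+ _)).
by apply: ler_wpM2l; [rewrite mulr_ge0 ?exp_coeff_ge0|exact: powR_le].
Qed.

Lemma phi_int_le k (y : R) : 0 < y < 2 -> `|phi_int k y| <= C0 * exp_coeff L k * y.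
Proof.
move=> y02; have [_ _ _ h] := phi_phi_int k; apply: le_trans (h y y02) _.
have [y0 _] := andP y02.
rewrite powRD; last by rewrite (gt_eqF y0) implybT.
rewrite (powRr1 (ltW y0)) (mulrA _ _ y) -exp_coeff_L (mulrA C0 _ (_ ^+ _)).
apply: ler_wpM2r; first exact: ltW.
by apply: ler_wpM2l; [rewrite mulr_ge0 ?exp_coeff_ge0|exact: powR_le].
Qed.

Lemma phiS_le k (y : R) : 0 < y < 2 ->
  `|phi k.+1 y| <= C0 * exp_coeff L k.+1 * y `^ b.
Proof.
move=> y02; have [_ h _ _] := phi_phi_int k.+1; apply: le_trans (h y y02) _.
have [y0 _] := andP y02.
have -> : k.+1%:R * b = k%:R * b + b by rewrite -natr1; ring.
rewrite powRD; last by rewrite (gt_eqF y0) implybT.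
rewrite (mulrA _ _ (y `^ b)) -exp_coeff_L (mulrA C0 _ (_ ^+ _)).
apply: ler_wpM2r; first exact: powR_ge0.
apply: ler_wpM2l; first by rewrite mulr_ge0 ?exp_coeff_ge0.
apply: le_trans (powR_le k y02) _; rewrite exprS ler_peMl ?exprn_ge0 ?powR_ge0//.
have := @ler_powR R 2 (ler1n _ 2) 0 b (ltW b0); by rewrite powRr0.
Qed.

(** Coefficients for which the series of the [c k * phi k] converges; the
powers of [- z] and their derivatives in [z] are of this kind. *)
Definition geometric (c : R ^nat) : Prop :=
  exists K r : R, [/\ 0 <= K, 0 <= r & forall k, `|c k| <= K * r ^+ k].

(** On coefficients, the shift is the operator [v |-> (v' / w)']: see
[is_derive_solution] and [is_derive_flux]. *)
Definition shift_coeff (c : R ^nat) : R ^nat := fun k => c k.+1.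

Lemma geometric_shift c : geometric c -> geometric (shift_coeff c).
Proof.
move=> [K [r [K0 r0 cKr]]]; exists (K * r), r; split=> //; first exact: mulr_ge0.
by move=> k; rewrite -mulrA -exprS; exact: cKr.
Qed.

Lemma geometric_comb c d (s t : R) : geometric c -> geometric d ->
  geometric (fun k => s * c k + t * d k).
Proof.
move=> [K [r [K0 r0 cKr]]] [K' [r' [K'0 r'0 cKr']]].
exists (`|s| * K + `|t| * K'), (r + r').
split; [by rewrite addr_ge0 ?mulr_ge0|exact: addr_ge0|move=> k].
apply: le_trans (ler_normD _ _) _; rewrite !normrM mulrDl -!mulrA.
apply: lerD; (apply: ler_wpM2l; first exact: normr_ge0).
  apply: le_trans (cKr k) _; apply: ler_wpM2l => //.
  by apply: lerXn2r; rewrite ?nnegrE ?addr_ge0// lerDl.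
apply: le_trans (cKr' k) _; apply: ler_wpM2l => //.
by apply: lerXn2r; rewrite ?nnegrE ?addr_ge0// lerDr.
Qed.

(** General coefficients put a solution, its derivative in the parameter and
their linear combinations on the same footing. *)
Definition solution (c : R ^nat) (x : R) : R :=
  limn (series (fun k => c k * phi k x)).

(** The quotient [v' / w] for [v = solution c]. *)
Definition flux (c : R ^nat) (x : R) : R :=
  c 0%N * p0 + limn (series (fun k => c k.+1 * phi_int k x)).

Let E k := C0 * exp_coeff L k.

Let E0 k : 0 <= E k.
Proof.
by apply: mulr_ge0 => //; apply: exp_coeff_ge0; exact: mulr_ge0 A0 (powR_ge0 _ _).
Qed.

Let cvgE (K r : R) : cvgn (series (fun k => K * r ^+ k * E k)).
Proof.
have -> : (fun k => K * r ^+ k * E k) = (fun k => (K * C0) * r ^+ k * exp_coeff L k).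
  by apply/funext => k; rewrite /E; ring.
exact: cvg_series_expr_exp_coeff.
Qed.

Let solution_term c K r k (y : R) : (forall k, `|c k| <= K * r ^+ k) ->
  0 < y < 2 -> `|c k * phi k y| <= K * r ^+ k * E k.
Proof.
move=> cKr y02; rewrite normrM; apply: ler_pM => //; exact: phi_le.
Qed.

Let flux_term c K r k (y : R) : 0 <= K -> 0 <= r ->
  (forall k, `|c k| <= K * r ^+ k) ->
  0 < y < 2 -> `|c k.+1 * phi_int k y| <= 2 * (K * r * r ^+ k * E k).
Proof.
move=> K0 r0 cKr y02; rewrite normrM mulrC mulrCA -(mulrA K) -exprS.
rewrite [leRHS]mulrC (mulrC 2); apply: ler_pM => //.
apply: le_trans (phi_int_le k y02) _; apply: ler_wpM2l; first exact: E0.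
by move: y02; lra.
Qed.

Lemma is_cvg_solution c (y : R) : geometric c -> 0 < y < 2 ->
  cvgn (series (fun k => c k * phi k y)).
Proof.
move=> [K [r [K0 r0 cKr]]] y02.
apply: (@series_dominated _ _ (fun k => K * r ^+ k * E k)) => [k|].
  exact: solution_term.
exact: cvgE.
Qed.

Let cvg2E (K r : R) : cvgn (series (fun k => 2 * (K * r * r ^+ k * E k))).
Proof. by apply: is_cvg_seriesZ; exact: cvgE. Qed.

Lemma is_cvg_flux c (y : R) : geometric c -> 0 < y < 2 ->
  cvgn (series (fun k => c k.+1 * phi_int k y)).
Proof.
move=> [K [r [K0 r0 cKr]]] y02.
apply: (@series_dominated _ _ (fun k => 2 * (K * r * r ^+ k * E k))) => [k|].
  exact: flux_term.
exact: cvg2E.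
Qed.

Lemma is_derive_flux c (y : R) : geometric c -> 0 < y < 2 ->
  is_derive y 1 (flux c) (solution (shift_coeff c) y).
Proof.
move=> cg y02; have [K [r [K0 r0 cKr]]] := geometric_shift cg.
suff h : is_derive y 1 (fun x => limn (series (fun k => c k.+1 * phi_int k x)))
    (solution (shift_coeff c) y).
  by have := is_derive_addf (is_derive_cstf (c 0%N * p0) y) h; rewrite add0r.
apply: (@is_derive_series _ (fun k x => c k.+1 * phi_int k x)
  (fun k x => shift_coeff c k * phi k x) (fun k => K * r ^+ k * E k) 0 2) => //.
- by move=> k z z02; apply: is_derive_scalef; exact: is_derive_phi_int.
- by move=> k z z02; exact: solution_term.
- by move=> z z02; exact: is_cvg_flux.
Qed.

Lemma is_derive_solution c (y : R) : geometric c -> 0 < y < 2 ->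
  is_derive y 1 (solution c) (flux c y * w y).
Proof.
move=> cg y02; have [K [r [K0 r0 cKr]]] := cg; have [y0 y2] := andP y02.
have y2' : y / 2 < y < 2 by lra.
have sub z : y / 2 < z < 2 -> 0 < z < 2 by lra.
have -> : flux c y * w y = limn (series (fun k => c k * dphi k y)).
  apply/esym/cvg_lim => //.
  have -> : flux c y * w y = c 0%N * dphi 0 y +
      limn (series (fun k => c k.+1 * phi_int k y)) * w y.
    by rewrite /flux /dphi; ring.
  apply: cvg_series_recl.
  have -> : series (fun k => c k.+1 * dphi k.+1 y) =
      (fun n => series (fun k => c k.+1 * phi_int k y) n * w y).
    apply/funext => n; rewrite /series/= mulr_suml; apply: eq_bigr => k _.
    by rewrite /dphi mulrA.
  by apply: cvgMl; exact: is_cvg_flux.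
pose W := Cw * (y / 2) `^ (- m).
have wW z : y / 2 < z < 2 -> `|w z| <= W.
  move=> z2; have z02 := sub z z2; apply: le_trans (wC z02) _.
  apply: ler_wpM2l; first exact: Cw0.
  rewrite !powRN lef_pV2 ?posrE ?powR_gt0; try lra.
  by apply: ge0_ler_powR; rewrite ?nnegrE//; lra.
(* the first term of the series has derivative p0 * w, the others phi_int * w *)
pose M k := if k is k'.+1 then W * (2 * (K * r * r ^+ k' * E k')) else `|c 0%N * p0| * W.
apply: (@is_derive_series _ (fun k x => c k * phi k x)
  (fun k x => c k * dphi k x) M (y / 2) 2) => //.
- by move=> k z z2; apply: is_derive_scalef; apply: is_derive_phi; exact: sub.
- move=> [|k] z z2; rewrite /dphi mulrA normrM.
    by apply: ler_wpM2l => //; exact: wW.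
  rewrite /M mulrC; apply: ler_pM => //; first exact: wW.
  by apply: flux_term => //; exact: sub.
- by move=> z z2; apply: is_cvg_solution => //; exact: sub.
- by apply: is_cvg_series_recl; apply: is_cvg_seriesZ; exact: cvg2E.
Qed.

Lemma flux0 c : flux c 0 = c 0%N * p0.
Proof.
rewrite /flux; have -> : (fun k => c k.+1 * phi_int k 0) = (fun=> 0).
  by apply/funext => k; rewrite /phi_int primitive0 mulr0.
have -> : series (fun=> 0) = (fun=> 0) :> R ^nat.
  by apply/funext => n; rewrite /series/= big1.
by rewrite lim_cst ?addr0.
Qed.

(** A factor [y `^ (2 - m)], resp. [y], is taken out of every term but the leading
one.  All boundary terms at [0] are computed from these rates. *)
Lemma solution_flux_bound c : geometric c -> exists K : R, 0 <= K /\
  forall y : R, 0 < y < 2 ->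
  [/\ `|solution c y| <= K, `|solution c y - c 0%N * phi0 y| <= K * y `^ (2 - m)
    & `|flux c y - c 0%N * p0| <= K * y].
Proof.
move=> cg; have [K [r [K0 r0 cKr]]] := cg.
pose K1 := limn (series (fun k => K * r ^+ k * E k)).
pose K2 := limn (series (fun k => K * r ^+ k.+1 * E k.+1)).
pose K3 := limn (series (fun k => K * r * r ^+ k * E k)).
have pos (u : R ^nat) : cvgn (series u) -> (forall k, 0 <= u k) -> 0 <= limn (series u).
  move=> cu u0; apply: le_trans (normr_ge0 _) (@series_norm_le _ (fun=> 0) u _ cu) => k.
  by rewrite normr0.
have t0 (a : R) i j : 0 <= a -> 0 <= a * r ^+ i * E j.
  by move=> a0; apply: mulr_ge0 (E0 j); apply: mulr_ge0 => //; exact: exprn_ge0.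
have K10 : 0 <= K1 by apply: pos => // k; exact: t0.
have c2 : cvgn (series (fun k => K * r ^+ k.+1 * E k.+1)).
  exact: (is_cvg_series_behead (@cvgE K r)).
have K20 : 0 <= K2 by apply: pos => // k; exact: t0.
have K30 : 0 <= K3 by apply: pos => // k; apply: t0; exact: mulr_ge0.
exists (K1 + K2 + K3); split; first by rewrite !addr_ge0.
move=> y y02; have [y0 y2] := andP y02; split.
- apply: (@le_trans _ _ K1); last by rewrite -addrA lerDl addr_ge0.
  by apply: series_norm_le (@cvgE K r) => k; exact: solution_term.
- apply: (@le_trans _ _ (K2 * y `^ b)); last first.
    by apply: ler_wpM2r; rewrite ?powR_ge0// addrAC lerDr addr_ge0.
  have cs : cvgn (series (fun k => c k.+1 * phi k.+1 y)).
    exact: (is_cvg_series_behead (is_cvg_solution cg y02)).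
  rewrite /solution lim_series_recl// addrC addKr mulrC.
  apply: series_norm_leM c2 => k; rewrite normrM.
  rewrite [leRHS](_ : _ = (K * r ^+ k.+1) * (E k.+1 * y `^ b)); last by ring.
  by apply: ler_pM => //; exact: phiS_le.
- apply: (@le_trans _ _ (K3 * y)); last first.
    by apply: ler_wpM2r; rewrite ?(ltW y0)// lerDr addr_ge0.
  rewrite /flux addrC addKr mulrC; apply: series_norm_leM (@cvgE (K * r) r) => k.
  rewrite normrM [leRHS](_ : _ = (K * r ^+ k.+1) * (E k * y)); last by rewrite exprS; ring.
  by apply: ler_pM => //; exact: phi_int_le.
Qed.

Lemma solution_comb c d (s t y : R) : geometric c -> geometric d -> 0 < y < 2 ->
  solution (fun k => s * c k + t * d k) y = s * solution c y + t * solution d y.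
Proof.
move=> cg dg y02; rewrite /solution -lim_series_comb; try exact: is_cvg_solution.
by congr (limn (series _)); apply/funext => k; ring.
Qed.

Lemma flux_comb c d (s t y : R) : geometric c -> geometric d -> 0 < y < 2 ->
  flux (fun k => s * c k + t * d k) y = s * flux c y + t * flux d y.
Proof.
move=> cg dg y02; rewrite /flux [RHS](_ : _ = (s * c 0%N + t * d 0%N) * p0 +
  (s * limn (series (fun k => c k.+1 * phi_int k y)) +
   t * limn (series (fun k => d k.+1 * phi_int k y)))); last by ring.
rewrite -lim_series_comb; try exact: is_cvg_flux.
by congr (_ + limn (series _)); apply/funext => k; ring.
Qed.

Definition power_coeff (z : R) : R ^nat := fun k => (- z) ^+ k.
Definition dpower_coeff (z : R) : R ^nat := fun k => - (k%:R * (- z) ^+ k.-1).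

Lemma is_derive_power_coeff k (z : R) :
  is_derive z 1 (fun z => power_coeff z k) (dpower_coeff z k).
Proof.
have h : is_derive z 1 (fun z => - z) (- 1) by exact: is_deriveNid.
by have := is_derive_expf k h; rewrite mulrN1.
Qed.

Let dpower_le k (z T : R) : `|z| <= T -> `|dpower_coeff z k| <= 1 * (2 * (1 + T)) ^+ k.
Proof.
move=> zT; have T0 := le_trans (normr_ge0 _) zT.
rewrite mul1r exprMn normrN normrM; apply: ler_pM => //.
  by rewrite normr_nat -natrX ler_nat ltnW// ltn_expl.
rewrite normrX normrN; apply: (@le_trans _ _ ((1 + T) ^+ k.-1)).
  by apply: lerXn2r; rewrite ?nnegrE ?addr_ge0// (le_trans zT)// lerDr.
by apply: ler_weXn2l; rewrite ?lerDl// leq_pred.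
Qed.

Lemma geometric_power z : geometric (power_coeff z).
Proof.
exists 1, `|z|; split=> // k; rewrite mul1r /power_coeff normrX normrN.
exact: lexx.
Qed.

Lemma geometric_dpower z : geometric (dpower_coeff z).
Proof.
exists 1, (2 * (1 + `|z|)); split=> // k; exact: dpower_le.
Qed.

(** The eigenvalue equation; the second, null term brings it to the shape of
an equation with a right-hand side. *)
Lemma shift_power z :
  shift_coeff (power_coeff z) = (fun k => (- z) * power_coeff z k + 0 * power_coeff z k).
Proof. by apply/funext => k; rewrite mul0r addr0 -exprS. Qed.

(** The derivative of the eigenvalue equation with respect to the parameter. *)
Lemma shift_dpower z : shift_coeff (dpower_coeff z) =
  (fun k => (- z) * dpower_coeff z k + (- 1) * power_coeff z k).
Proof.
apply/funext => -[|k]; rewrite /shift_coeff /dpower_coeff /power_coeff/=.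
  by rewrite !expr0; ring.
by rewrite !exprS -[k.+2%:R]natr1; ring.
Qed.

Lemma is_derive_solution_param (y z : R) : 0 < y < 2 ->
  is_derive z 1 (fun z => solution (power_coeff z) y) (solution (dpower_coeff z) y).
Proof.
move=> y02; pose T := `|z| + 1.
have zT x : - T < x < T -> `|x| <= T by rewrite ler_norml => /andP[/ltW -> /ltW ->].
apply: (@is_derive_series _ (fun k z => power_coeff z k * phi k y)
  (fun k z => dpower_coeff z k * phi k y)
  (fun k => 1 * (2 * (1 + T)) ^+ k * E k) (- T) T) => //.
- have := ler_norm z; have := ler_norm (- z); rewrite normrN /T; lra.
- move=> k x _; have -> : (fun z => power_coeff z k * phi k y) =
    (fun z => phi k y * power_coeff z k) by apply/funext => u; rewrite mulrC.
  by rewrite mulrC; apply: is_derive_scalef; exact: is_derive_power_coeff.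
- move=> k x xT; rewrite normrM; apply: ler_pM => //; last exact: phi_le.
  by apply: dpower_le; exact: zT.
- by move=> x _; apply: is_cvg_solution => //; exact: geometric_power.
Qed.

Lemma is_derive_flux_param (y z : R) : 0 < y < 2 ->
  is_derive z 1 (fun z => flux (power_coeff z) y) (flux (dpower_coeff z) y).
Proof.
move=> y02; pose T := `|z| + 1.
have zT x : - T < x < T -> `|x| <= T by rewrite ler_norml => /andP[/ltW -> /ltW ->].
apply: is_derive_addf.
  have -> : (fun z => power_coeff z 0 * p0) = (fun=> p0).
    by apply/funext => u; rewrite /power_coeff expr0 mul1r.
  by rewrite /dpower_coeff mul0r oppr0 mul0r; exact: is_derive_cstf.
apply: (@is_derive_series _ (fun k z => power_coeff z k.+1 * phi_int k y)
  (fun k z => dpower_coeff z k.+1 * phi_int k y)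
  (fun k => 2 * (1 * (2 * (1 + T)) * (2 * (1 + T)) ^+ k * E k)) (- T) T) => //.
- have := ler_norm z; have := ler_norm (- z); rewrite normrN /T; lra.
- move=> k x _; have -> : (fun z => power_coeff z k.+1 * phi_int k y) =
    (fun z => phi_int k y * power_coeff z k.+1) by apply/funext => u; rewrite mulrC.
  by rewrite mulrC; apply: is_derive_scalef; exact: is_derive_power_coeff.
- move=> k x xT; apply: flux_term => // [|j].
    by rewrite mulr_ge0// addr_ge0// addr_ge0.
  by apply: dpower_le; exact: zT.
- by move=> x _; apply: is_cvg_flux => //; exact: geometric_power.
Qed.

End FundamentalSeries.

(** * The Rellich multiplier and a Riccati inequality *)
Section Comparison.
Context {R : realType}.
Implicit Types (f F : R -> R).

Lemma le0_of_derive_le0 F (F' : R -> R) (b : R) : 0 < b ->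
  (forall x : R, 0 < x < b -> is_derive x 1 F (F' x)) ->
  (forall x : R, 0 < x < b -> F' x <= 0) ->
  {for b, continuous F} ->
  F x @[x --> (0 : R)^'+] --> (0 : R) -> F b <= 0.
Proof.
move=> b0 dF F'0 cF F0; rewrite leNgt; apply/negP => Fb.
have [x /andP[x0 xb] Fx] : exists2 x : R, 0 < x < b & F x < F b.
  near (0 : R)^'+ => x; exists x.
    by apply/andP; split; near: x; [exact: nbhs_right_gt|exact: nbhs_right_lt].
  near: x; exact: (cvgr_lt _ F0).
have [y||c cxb FbFx] := @MVT R F F' x b xb.
- by rewrite in_itv/= => /andP[xy yb]; apply: dF; rewrite (lt_trans x0).
- apply: continuous_in_within => y /=; rewrite in_itv/= => /andP[xy].
  rewrite le_eqVlt => /predU1P[->//|yb]; apply: is_derive_continuous (dF y _).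
  by rewrite (lt_le_trans x0).
have : F b - F x <= 0.
  rewrite FbFx mulr_le0_ge0 ?subr_ge0 ?(ltW xb)//; apply: F'0.
  by move: cxb; rewrite in_itv/= => /andP[xc ->]; rewrite (lt_trans x0 xc).
by rewrite subr_le0 leNgt Fx.
Unshelve. all: by end_near. Qed.

Lemma primitive_bounded_cvg0 f (K b : R) : 0 < b ->
  (forall x : R, 0 < x < b -> {for x, continuous f}) ->
  (forall x : R, 0 < x < b -> `|f x| <= K) ->
  primitive f x @[x --> (0 : R)^'+] --> (0 : R).
Proof.
move=> b0 cf fK; have fK' x : 0 < x < b -> `|f x| <= K * x `^ 0.
  by move=> xb; rewrite powRr0 mulr1 fK.
have N10 : -1 < 0 :> R by rewrite ltrN10.
have K0 : 0 <= K by apply: le_trans (normr_ge0 _) (fK (b / 2) _); lra.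
apply: norm_cvg0; apply: (@squeeze_cvgr _ _ _ _ (fun=> 0) (fun x => K * x)).
- near=> x; rewrite normr_ge0/=.
  have x0 : 0 < x by near: x; exact: nbhs_right_gt.
  have xb : x < b by near: x; exact: nbhs_right_lt.
  have := primitive_normr_le cf fK' N10 (introT andP (conj x0 xb)).
  by rewrite add0r divr1 powRr1 ?(ltW x0).
- exact: cvg_cst.
- rewrite -[X in _ --> X](mulr0 K); apply: cvgMr.
  exact: cvg_at_right_filter.
Unshelve. all: by end_near. Qed.

Lemma is_derive_primitive_bounded f (K b : R) :
  (forall x : R, 0 < x < b -> {for x, continuous f}) ->
  (forall x : R, 0 < x < b -> `|f x| <= K) ->
  forall x : R, 0 < x < b -> is_derive x 1 (primitive f) (f x).
Proof.
move=> cf fK x xb; apply: (@is_derive_primitive _ _ b K 0) => //.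
by move=> y yb; rewrite powRr0 mulr1 fK.
Qed.

Lemma eq0_of_derive_eq0 F (b x : R) : 0 < x < b ->
  (forall x : R, 0 < x < b -> is_derive x 1 F 0) ->
  F x @[x --> (0 : R)^'+] --> (0 : R) -> F x = 0.
Proof.
move=> xb dF F0; have [x0 x_b] := andP xb.
have sub y : 0 < y < x -> 0 < y < b by lra.
have cF := is_derive_continuous (dF x xb).
have dF1 y (yx : 0 < y < x) := dF y (sub y yx).
apply/eqP; rewrite eq_le; apply/andP; split.
  exact: (@le0_of_derive_le0 _ (fun=> 0) x x0 dF1 _ cF F0).
rewrite -oppr_le0.
apply: (@le0_of_derive_le0 (fun x => - F x) (fun=> 0) x x0) => //.
- move=> y yx; have := is_derive_scalef (- 1) (dF1 y yx).
  by rewrite mulr0; under eq_fun do rewrite mulN1r.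
- by apply: cvgN.
- by rewrite -[X in _ --> X]oppr0; apply: cvgN.
Qed.

End Comparison.

Section Multiplier.
Context {R : realType}.
Variables (T T' w : R -> R) (Tm : R).
Hypothesis T0 : forall x : R, 0 < x < 2 -> 0 < T x.
Hypothesis Tw : forall x : R, 0 < x < 2 -> T x * w x = 1.
Hypothesis TTm : forall x : R, 0 < x < 2 -> T x <= Tm.
Hypothesis cT : forall x : R, 0 < x < 2 -> {for x, continuous T}.
Hypothesis dT : forall x : R, 0 < x < 1 -> is_derive x 1 T (T' x).
Hypothesis xT' : forall x : R, 0 < x < 1 -> x * `|T' x| <= 2 * T x.

(** The Rellich multiplier.  The function
[x * (q ^+ 2 + mu * T * v ^+ 2) - 2 * Tm * (v * q)] vanishes at [0], and its derivative
is at most [(7 * Tm + 1) * (mu * v ^+ 2 + f ^+ 2)]: the terms [mu * v * q] cancel,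
[2 * Tm * w * q ^+ 2 >= 2 * q ^+ 2] absorbs the squares of [q] produced by the first
part, and [x * T' x] is at most [2 * T x].  Thus boundary values at [1] are controlled
by the mean square of [v], without any bound on its derivative. *)
Lemma multiplier_estimate (mu K : R) (v q f : R -> R) : 1 <= mu ->
  (forall x : R, 0 < x < 2 -> is_derive x 1 v (q x * w x)) ->
  (forall x : R, 0 < x < 2 -> is_derive x 1 q (- mu * v x - f x)) ->
  (forall x : R, 0 < x < 2 -> {for x, continuous f}) ->
  (forall x : R, 0 < x < 2 -> [/\ `|v x| <= K, `|q x| <= K & `|f x| <= K]) ->
  v x * q x @[x --> (0 : R)^'+] --> (0 : R) ->
  q 1 ^+ 2 + mu * T 1 * v 1 ^+ 2 - 2 * Tm * (v 1 * q 1) <=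
  (7 * Tm + 1) * (mu * primitive (fun x => v x ^+ 2) 1 +
                  primitive (fun x => f x ^+ 2) 1).
Proof.
move=> mu1 dv dq cf bd vq0.
have Tm0 : 0 <= Tm.
  have h : 0 < (1 : R) < 2 by lra.
  exact: le_trans (ltW (T0 h)) (TTm h).
have sq (a : R) : `|a| <= K -> `|a ^+ 2| <= K ^+ 2.
  by move=> aK; rewrite normrX lerXn2r ?nnegrE// (le_trans (normr_ge0 _) aK).
have cv2 (x : R) : 0 < x < 2 -> {for x, continuous (fun x => v x ^+ 2)}.
  by move=> x2; apply: is_derive_continuous (is_derive_expf 2 (dv x x2)).
have cf2 (x : R) : 0 < x < 2 -> {for x, continuous (fun x => f x ^+ 2)}.
  move=> x2; rewrite (_ : (fun x => _) = (fun x => f x * f x)).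
    by apply: cvgM; exact: cf.
  by apply/funext => y; rewrite expr2.
have bv2 (x : R) : 0 < x < 2 -> `|v x ^+ 2| <= K ^+ 2.
  by move=> /bd[h _ _]; exact: sq.
have bf2 (x : R) : 0 < x < 2 -> `|f x ^+ 2| <= K ^+ 2.
  by move=> /bd[_ _ h]; exact: sq.
pose Q x := x * (q x ^+ 2 + mu * T x * v x ^+ 2) - 2 * Tm * (v x * q x) -
  (7 * Tm + 1) * (mu * primitive (fun x => v x ^+ 2) x +
                  primitive (fun x => f x ^+ 2) x).
have dV x (x2 : 0 < x < 2) := is_derive_primitive_bounded cv2 bv2 x2.
have dF x (x2 : 0 < x < 2) := is_derive_primitive_bounded cf2 bf2 x2.
suff : Q 1 <= 0 by rewrite /Q mul1r subr_le0.
pose Q' x := q x ^+ 2 + mu * T x * v x ^+ 2 - 2 * x * q x * f x +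
   x * mu * T' x * v x ^+ 2 - 2 * Tm * w x * q x ^+ 2 + 2 * Tm * mu * v x ^+ 2 +
   2 * Tm * v x * f x - (7 * Tm + 1) * (mu * v x ^+ 2 + f x ^+ 2).
apply: (@le0_of_derive_le0 _ Q Q') => // [x x1|x x1||].
- have x2 : 0 < x < 2 by lra.
  have := is_derive_subf (is_derive_subf (is_derive_mulf (is_derive_idf x) (is_derive_addf (is_derive_expf 2 (dq x x2))
    (is_derive_mulf (is_derive_scalef mu (dT x1)) (is_derive_expf 2 (dv x x2)))))
    (is_derive_scalef (2 * Tm) (is_derive_mulf (dv x x2) (dq x x2))))
    (is_derive_scalef (7 * Tm + 1) (is_derive_addf (is_derive_scalef mu (dV x x2)) (dF x x2))).
  move=> dQ; apply: is_derive_eq dQ _; rewrite /Q' /=.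
  have /mulr1_eq h := Tw x2; rewrite /= !expr1.
  have := Tw x2; move: (T x) (w x) => t u tu.
  rewrite -[RHS]addr0 -[X in _ = _ + X](_ : x * mu * 2 * v x * q x * (t * u - 1) = 0); last first.
    by rewrite tu subrr mulr0.
  ring.
- have x2 : 0 < x < 2 by lra.
  have := T0 x2; have := TTm x2; have := xT' x1; have := Tw x2; rewrite /Q'.
  move: (T x) (w x) (q x) (v x) (f x) => t u q' v' f' tu.
  have [x0 x1'] := andP x1; rewrite -[X in X * `|_|](gtr0_norm x0) -normrM ler_norml.
  have -> : x * mu * T' x = (x * T' x) * mu by ring.
  move: (x * T' x) => s /andP[_ st] tTm t0.
  have u0 : 0 < u by rewrite -(pmulr_rgt0 _ t0) tu.
  have mu0 : 0 <= mu by lra.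
  have h1 : 0 <= (Tm - t) * u * q' ^+ 2.
    apply: mulr_ge0 (sqr_ge0 _); apply: mulr_ge0 (ltW u0).
    by rewrite subr_ge0.
  have v0 : 0 <= mu * v' ^+ 2 by apply: mulr_ge0 (sqr_ge0 _).
  have h2 : 0 <= (Tm - t) * (mu * v' ^+ 2) by apply: mulr_ge0 => //; lra.
  have h3 : 0 <= (2 * t - s) * (mu * v' ^+ 2) by apply: mulr_ge0 => //; lra.
  have h4 : 0 <= (x * q' + f') ^+ 2 by exact: sqr_ge0.
  have h5 : 0 <= Tm * (v' - f') ^+ 2 by apply: mulr_ge0 (sqr_ge0 _).
  have h6 : 0 <= Tm * ((mu - 1) * v' ^+ 2).
    by apply: mulr_ge0 => //; apply: mulr_ge0 (sqr_ge0 _); lra.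
  have h7 : 0 <= (1 - x ^+ 2) * q' ^+ 2.
    by apply: mulr_ge0 (sqr_ge0 _); rewrite subr_ge0 expr_le1// ltW.
  have h8 : 0 <= Tm * (mu * v' ^+ 2) by apply: mulr_ge0.
  have h10 : t * u * q' ^+ 2 = q' ^+ 2 by rewrite tu mul1r.
  have h9 : 0 <= Tm * f' ^+ 2 by apply: mulr_ge0 (sqr_ge0 _).
  clear -h1 h2 h3 h4 h5 h6 h7 h8 h9 h10 v0; lra.
- have h : 0 < (1 : R) < 2 by lra.
  have cont (g : R -> R) a : is_derive (1 : R) 1 g a -> {for (1 : R), continuous g}.
    exact: is_derive_continuous.
  apply: cvgB; first apply: cvgB.
  + apply: cvgM; first exact: (cont _ _ (is_derive_idf 1)).
    apply: cvgD; first exact: (cont _ _ (is_derive_expf 2 (dq 1 h))).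
    apply: cvgM; last exact: (cont _ _ (is_derive_expf 2 (dv 1 h))).
    by apply: cvgM; [exact: cvg_cst|exact: cT].
  + exact: (cont _ _ (is_derive_scalef (2 * Tm) (is_derive_mulf (dv 1 h) (dq 1 h)))).
  + exact: (cont _ _ (is_derive_scalef (7 * Tm + 1) (is_derive_addf (is_derive_scalef mu (dV 1 h)) (dF 1 h)))).
- have z2 : (0 : R) < 2 by [].
  have V0 := primitive_bounded_cvg0 z2 cv2 bv2.
  have F0 := primitive_bounded_cvg0 z2 cf2 bf2.
  have X0 : x * (q x ^+ 2 + mu * T x * v x ^+ 2) @[x --> (0 : R)^'+] --> (0 : R).
    apply: norm_cvg0.
    apply: (@squeeze_cvgr _ _ _ _ (fun=> 0) (fun x => (K ^+ 2 + mu * Tm * K ^+ 2) * x)).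
    + near=> x; rewrite normr_ge0/=.
      have x0 : 0 < x by near: x; exact: nbhs_right_gt.
      have x2 : 0 < x < 2 by rewrite x0; near: x; exact: nbhs_right_lt.
      have [vK qK _] := bd x x2.
      rewrite normrM (gtr0_norm x0) mulrC ler_pM2r//.
      apply: le_trans (ler_normD _ _) _; apply: lerD; first exact: sq.
      rewrite (normrM (mu * T x)) (normrM mu) (ger0_norm (le_trans ler01 mu1)).
      rewrite (gtr0_norm (T0 x2)).
      apply: ler_pM => //; last exact: sq.
        by rewrite mulr_ge0 ?(le_trans ler01 mu1)// ltW// T0.
      by apply: ler_wpM2l; [exact: le_trans ler01 mu1|exact: TTm].
    + exact: cvg_cst.
    + rewrite -[X in _ --> X](mulr0 (K ^+ 2 + mu * Tm * K ^+ 2)); apply: cvgMr.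
      exact: cvg_at_right_filter.
  rewrite /Q -[X in _ --> X](_ : 0 - 2 * Tm * 0 - (7 * Tm + 1) * (mu * 0 + 0) = 0); last by ring.
  apply: cvgB; first by apply: cvgB => //; apply: cvgMr.
  by apply: cvgMr; apply: cvgD => //; apply: cvgMr.
Unshelve. all: by end_near. Qed.

End Multiplier.

Section Riccati.
Context {R : realType}.

(** As long as [B] does not vanish, [G = D / B] satisfies [G' = N / B ^+ 2], hence
[G' >= c * (G ^+ 2 + 1 / z)] for some [c > 0] and all large [z].  In the variable [s], [z = s ^+ 2], this says
that the arctangent of [s * G] grows at least linearly in [s], although it is
bounded. *)
Lemma riccati_oscillation (D B D' B' N : R -> R) (a K C : R) :
  0 < a -> a <= 1 -> 0 <= K -> 0 < C ->
  (forall z : R, is_derive z 1 D (D' z)) ->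
  (forall z : R, is_derive z 1 B (B' z)) ->
  (forall z, B' z * D z - B z * D' z = - N z) ->
  (forall z, 1 <= z ->
     B z ^+ 2 + z * a * D z ^+ 2 - K * (D z * B z) <= C * (z * N z)) ->
  forall M, exists2 z, M <= z & B z = 0.
Proof.
move=> a0 a1 K0 C0 dD dB W E M.
have [//|noz] := pselect (exists2 z, M <= z & B z = 0).
have {}noz z : M <= z -> B z != 0.
  by move=> Mz; apply/eqP => Bz; apply: noz; exists z.
exfalso.
(* beyond S the linear terms in G are absorbed by half of the quadratic ones *)
pose S : R := 1 + `|M| + (C + 2 * K) / a.
have CKa : 0 <= (C + 2 * K) / a by rewrite divr_ge0 ?(ltW a0)//; lra.
have S1 : 1 <= S by rewrite /S -addrA lerDl addr_ge0.
pose c := a / C.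
have c0 : 0 < c by rewrite divr_gt0.
pose H s := s * (D (s ^+ 2) / B (s ^+ 2)).
pose F s := atan (H s) - c * s.
have sM s : S <= s -> M <= s ^+ 2.
  move=> Ss; apply: le_trans (ler_norm M) _; apply: (@le_trans _ _ s).
    by apply: le_trans Ss; rewrite /S; lra.
  by rewrite expr2 ler_peMr//; lra.
pose H' s := D (s ^+ 2) / B (s ^+ 2) + 2 * s ^+ 2 * (N (s ^+ 2) / B (s ^+ 2) ^+ 2).
have dH s : S <= s -> is_derive s 1 H (H' s).
  move=> Ss; have Bn := noz _ (sM s Ss).
  have dsq := is_derive_expf 2 (is_derive_idf s).
  have dD2 := is_derive_compf (g := fun s => s ^+ 2) (dD (s ^+ 2)) dsq.
  have dB2 := is_derive_compf (g := fun s => s ^+ 2) (dB (s ^+ 2)) dsq.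
  have := is_derive_mulf (is_derive_idf s) (is_derive_mulf dD2 (is_derive_invf (f := fun s => B (s ^+ 2)) Bn dB2)).
  move=> dH; apply: is_derive_eq dH _; rewrite /H' /=.
  have -> : N (s ^+ 2) = B (s ^+ 2) * D' (s ^+ 2) - B' (s ^+ 2) * D (s ^+ 2).
    by rewrite -[LHS]opprK -W opprB.
  by rewrite !expr1; field.
have H'ge s : S <= s -> c * (1 + H s ^+ 2) <= H' s.
  move=> Ss; have Bn := noz _ (sM s Ss).
  have s1 : 1 <= s by lra.
  have s0 : 0 < s by lra.
  have := E (s ^+ 2) (exprn_ege1 _ s1).
  rewrite /H' /H; move: Bn.
  set b := B _; set d := D _; set n := N _ => bn En.
  have b2 : 0 < b ^+ 2 by rewrite exprn_even_gt0.
  pose h := s * (d / b).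
  have dE : d = h * b / s by rewrite /h; field; rewrite bn gt_eqF.
  have n1 : (1 + a * h ^+ 2 - K * h / s) <= C * (s ^+ 2 * (n / b ^+ 2)).
    rewrite -(ler_pM2r b2); move: En; rewrite dE.
    rewrite [X in X <= _ -> _](_ : _ = (1 + a * h ^+ 2 - K * h / s) * b ^+ 2); last first.
      by field; rewrite gt_eqF.
    by rewrite (_ : C * (s ^+ 2 * n) = C * (s ^+ 2 * (n / b ^+ 2)) * b ^+ 2)//; field.
  rewrite -/h (_ : d / b = h / s); last by rewrite dE; field; rewrite bn gt_eqF.
  have -> : c * (1 + h ^+ 2) = (a * (1 + h ^+ 2)) / C by rewrite /c; ring.
  rewrite ler_pdivrMr// mulrC.
  have sC : (C + 2 * K) <= a * s.
    rewrite (mulrC a) -ler_pdivrMr//; apply: le_trans Ss.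
    by rewrite /S lerDr addr_ge0.
  have hs : `|h / s| * (C + 2 * K) <= a * (1 + h ^+ 2) / 2.
    apply: (@le_trans _ _ (`|h / s| * (a * s))); first exact: ler_wpM2l.
    rewrite normrM normfV (gtr0_norm s0) mulrCA divfK ?gt_eqF// -mulrA.
    rewrite ler_pM2l// ler_pdivlMr//.
    have := sqr_ge0 (`|h| - 1); rewrite -[h ^+ 2]real_normK ?num_real//; lra.
  have hs' : - (`|h / s| * (C + 2 * K)) <= (C - 2 * K) * (h / s).
    have k1 : - `|h / s| <= h / s by rewrite lerNl -normrN; exact: ler_norm.
    have k2 : h / s <= `|h / s| by exact: ler_norm.
    have k3 : 0 <= C * (h / s + `|h / s|) by rewrite mulr_ge0//; lra.
    have k4 : 0 <= 2 * K * (`|h / s| - h / s) by rewrite mulr_ge0//; lra.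
    lra.
  have a1' : 0 <= (1 - a) by lra.
  have a2' : 0 <= a * h ^+ 2 by rewrite mulr_ge0 ?sqr_ge0// ltW.
  have e : K * h / s = K * (h / s) by ring.
  move: n1 hs hs' a1' a2'; rewrite e; clear; move: (h / s) (`|_|) (n / _) => t t' m; lra.
have dF s : S <= s -> is_derive s 1 F ((1 + H s ^+ 2)^-1 * H' s - c).
  move=> Ss; apply: is_derive_subf; last by have := is_derive_scalef c (is_derive_idf s); rewrite mulr1.
  exact: (@is_derive_compf _ atan H _ _ _ (is_derive1_atan _) (dH s Ss)).
(* a length over which the arctangent would have to grow by more than pi *)
pose s2 := S + (pi + 1) / c.
have pc : 0 < (pi + 1) / c by rewrite divr_gt0// addr_gt0// pi_gt0.
have [s [Ss ss2]] := @mean_value _ F (fun s => (1 + H s ^+ 2)^-1 * H' s - c) S s2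
  (ltac:(rewrite /s2 ltrDl//)) (fun y yS => dF y (proj1 (andP yS))).
have F'0 : 0 <= (1 + H s ^+ 2)^-1 * H' s - c.
  rewrite subr_ge0 mulrC ler_pdivlMr; first by apply: H'ge; exact: ltW.
  by rewrite ltr_pwDl// sqr_ge0.
move=> FF; have : F S <= F s2.
  by rewrite -subr_ge0 FF mulr_ge0// /s2 addrC addKr ltW.
rewrite /F; have := atan_gtNpi2 (H S); have := atan_ltpi2 (H s2).
have -> : c * s2 = c * S + (pi + 1) by rewrite /s2 mulrDr; congr +%R; rewrite mulrC divfK// gt_eqF.
lra.
Qed.

End Riccati.

(** * Large eigenvalues and quasi-modes *)
Section SturmLiouville.
Context {R : realType}.
Variables (w phi0 : R -> R) (p0 Cw m C0 : R).
Hypothesis H : fundamental_data w phi0 p0 Cw m C0.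
Variables (T T' : R -> R) (Tm : R).
Hypothesis T0 : forall x : R, 0 < x < 2 -> 0 < T x.
Hypothesis Tw : forall x : R, 0 < x < 2 -> T x * w x = 1.
Hypothesis TTm : forall x : R, 0 < x < 2 -> T x <= Tm.
Hypothesis cT : forall x : R, 0 < x < 2 -> {for x, continuous T}.
Hypothesis dT : forall x : R, 0 < x < 1 -> is_derive x 1 T (T' x).
Hypothesis xT' : forall x : R, 0 < x < 1 -> x * `|T' x| <= 2 * T x.
Hypothesis nontrivial : p0 = 1 \/ forall x : R, 0 < x < 2 -> phi0 x = 1.

Local Notation sol := (solution w phi0).
Local Notation flx := (flux w phi0 p0).

Let one2 : 0 < (1 : R) < 2. Proof. by lra. Qed.

(** The product of the leading terms is [c 0 * d 0 * (p0 * phi0 x)], which tends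
to [0] under either boundary condition. *)
Lemma solution_flux_cvg0 c d : geometric c -> geometric d ->
  sol c x * flx d x @[x --> (0 : R)^'+] --> (0 : R).
Proof.
move=> cg dg; have [K [K0 bK]] := solution_flux_bound H cg.
have [K' [K'0 bK']] := solution_flux_bound H dg.
have b0 : 0 < 2 - m by rewrite subr_gt0; exact: fd_m_lt2 H.
apply: norm_cvg0; apply: (@squeeze_cvgr _ _ _ _ (fun=> 0)
  (fun x => K * (K' * 2 + `|d 0%N * p0|) * x `^ (2 - m) + `|c 0%N| * C0 * K' * x +
     `|c 0%N * d 0%N| * `|p0 * phi0 x|)).
- near=> x; rewrite normr_ge0/=.
  have x0 : 0 < x by near: x; exact: nbhs_right_gt.
  have x2' : x < 2 by near: x; exact: nbhs_right_lt.
  have x2 : 0 < x < 2 by rewrite x0.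
  have [_ s1 _] := bK x x2; have [_ _ f1] := bK' x x2.
  have -> : sol c x * flx d x = (sol c x - c 0%N * phi0 x) * flx d x +
    c 0%N * phi0 x * (flx d x - d 0%N * p0) + (c 0%N * d 0%N) * (p0 * phi0 x) by ring.
  apply: le_trans (ler_normD _ _) _; rewrite (normrM (c 0%N * _)); apply: lerD => //.
  apply: le_trans (ler_normD _ _) _; apply: lerD.
    rewrite normrM [leRHS]mulrAC; apply: ler_pM => //.
    rewrite -[flx d x](subrK (d 0%N * p0)); apply: le_trans (ler_normD _ _) _.
    by apply: lerD => //; apply: le_trans f1 _; apply: ler_wpM2l => //; exact: ltW.
  rewrite normrM -[leRHS]mulrA; apply: ler_pM => //.
  by rewrite normrM; apply: ler_wpM2l => //; exact: (fd_phi0_le H).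
- exact: cvg_cst.
- have e : K * (K' * 2 + `|d 0%N * p0|) * 0 +
    `|c 0%N| * C0 * K' * 0 + `|c 0%N * d 0%N| * `|0 : R| = 0.
    by rewrite normr0; ring.
  rewrite -[X in _ --> X]e.
  apply: cvgD; [apply: cvgD|].
  + by apply: cvgMr; exact: powR_cvg0.
  + by apply: cvgMr; exact: cvg_at_right_filter.
  + by apply: cvgMr; apply: cvg_norm; exact: fd_flux H.
Unshelve. all: by end_near. Qed.

Lemma is_derive_flux_eq c d (z : R) : geometric c -> geometric d ->
  shift_coeff c = (fun k => (- z) * c k + (- 1) * d k) ->
  forall x : R, 0 < x < 2 -> is_derive x 1 (flx c) (- z * sol c x - sol d x).
Proof.
move=> cg dg e x x2; have := is_derive_flux H cg x2; rewrite e.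
by rewrite (solution_comb H)// mulN1r.
Qed.

Lemma solution_continuous c (x : R) : geometric c -> 0 < x < 2 ->
  {for x, continuous (sol c)}.
Proof. by move=> cg x2; exact: is_derive_continuous (is_derive_solution H cg x2). Qed.

Definition solution_energy c : R := primitive (fun x => sol c x ^+ 2) 1.

Local Notation energy := solution_energy.

Lemma bounded_solution c d : geometric c -> geometric d -> exists K : R,
  forall x : R, 0 < x < 2 -> [/\ `|sol c x| <= K, `|flx c x| <= K & `|sol d x| <= K].
Proof.
move=> cg dg; have [K [K0 bK]] := solution_flux_bound H cg.
have [K' [K'0 bK']] := solution_flux_bound H dg.
exists (K * 2 + `|c 0%N * p0| + K') => x x2; have := andP x2 => -[x0 x2'].
have [s1 _ f1] := bK x x2; have [s2 _ _] := bK' x x2.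
have h : 0 <= `|c 0%N * p0| by exact: normr_ge0.
split; [lra| |lra].
rewrite -[flx c x](subrK (c 0%N * p0)); apply: le_trans (ler_normD _ _) _.
have : K * x <= K * 2 by apply: ler_wpM2l => //; exact: ltW.
lra.
Qed.

Lemma solution_multiplier c d (z : R) : 1 <= z -> geometric c -> geometric d ->
  shift_coeff c = (fun k => (- z) * c k + (- 1) * d k) ->
  flx c 1 ^+ 2 + z * T 1 * sol c 1 ^+ 2 - 2 * Tm * (sol c 1 * flx c 1) <=
  (7 * Tm + 1) * (z * energy c + energy d).
Proof.
move=> z1 cg dg e; have [K bK] := bounded_solution cg dg.
apply: (@multiplier_estimate _ T T' w Tm T0 Tw TTm cT dT xT' z K
  (sol c) (flx c) (sol d) z1) => //.
- by move=> x x2; exact: (is_derive_solution H cg x2).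
- exact: is_derive_flux_eq.
- by move=> x x2; exact: solution_continuous.
- exact: solution_flux_cvg0.
Qed.

Lemma is_derive_energy c (x : R) : geometric c -> 0 < x < 2 ->
  is_derive x 1 (primitive (fun x => sol c x ^+ 2)) (sol c x ^+ 2).
Proof.
move=> cg x2; have [K bK] := bounded_solution cg cg.
apply: (@is_derive_primitive_bounded _ (fun x => sol c x ^+ 2) (K ^+ 2) 2) => // y y2.
  by apply: is_derive_continuous (is_derive_expf 2 (is_derive_solution H cg y2)).
have [sK _ _] := bK y y2.
by rewrite normrX lerXn2r ?nnegrE// (le_trans (normr_ge0 _) sK).
Qed.

Lemma energy_cvg0 c : geometric c ->
  primitive (fun x => sol c x ^+ 2) x @[x --> (0 : R)^'+] --> (0 : R).
Proof.
move=> cg; have [K bK] := bounded_solution cg cg.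
apply: (@primitive_bounded_cvg0 _ (fun x => sol c x ^+ 2) (K ^+ 2) 2) => // y y2.
  by apply: is_derive_continuous (is_derive_expf 2 (is_derive_solution H cg y2)).
have [sK _ _] := bK y y2.
by rewrite normrX lerXn2r ?nnegrE// (le_trans (normr_ge0 _) sK).
Qed.

Lemma geometric0 : geometric (fun=> 0 : R).
Proof. by exists 0, 0; split=> // k; rewrite normr0 mul0r. Qed.

Lemma energy_scale c (r : R) : geometric c ->
  energy (fun k => r * c k + 0 * c k) = r ^+ 2 * energy c.
Proof.
move=> cg; have rg := geometric_comb r 0 cg cg.
apply/eqP; rewrite -subr_eq0; apply/eqP.
apply: (@eq0_of_derive_eq0 _ (fun x => primitive (fun x =>
  sol (fun k => r * c k + 0 * c k) x ^+ 2) x -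
  r ^+ 2 * primitive (fun x => sol c x ^+ 2) x) 2) => // [x x2|].
- have := is_derive_subf (is_derive_energy rg x2) (is_derive_scalef (r ^+ 2) (is_derive_energy cg x2)).
  move=> h; apply: is_derive_eq h _.
  by rewrite (solution_comb H)//; ring.
- have e : 0 - r ^+ 2 * 0 = 0 by ring.
  rewrite -[X in _ --> X]e; apply: cvgB; first exact: energy_cvg0.
  by apply: cvgMr; exact: energy_cvg0.
Qed.

Lemma energy0 : energy (fun=> 0) = 0.
Proof.
have := energy_scale 0 geometric0.
have -> : (fun _ : nat => 0 * 0 + 0 * 0 : R) = (fun=> 0).
  by apply/funext => k; rewrite mul0r addr0.
by rewrite expr0n /= mul0r.
Qed.

Lemma shift_power0 z : shift_coeff (power_coeff z) =
  (fun k => (- z) * power_coeff z k + (- 1) * (0 : R)).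
Proof. by rewrite shift_power; apply/funext => k; ring. Qed.

Lemma solution0 (x : R) : 0 < x < 2 -> sol (fun=> 0) x = 0.
Proof.
move=> x2; have := solution_comb H 0 0 geometric0 geometric0 x2.
by rewrite !mul0r addr0.
Qed.

(** The Wronskian of the solution and of its derivative in the parameter has
derivative [- solution ^+ 2], and vanishes at [0]. *)
Lemma lagrange_identity (z : R) :
  flx (dpower_coeff z) 1 * sol (power_coeff z) 1 -
  flx (power_coeff z) 1 * sol (dpower_coeff z) 1 = - energy (power_coeff z).
Proof.
have gp := geometric_power z; have gd := geometric_dpower z.
pose F x := flx (dpower_coeff z) x * sol (power_coeff z) x -
  flx (power_coeff z) x * sol (dpower_coeff z) x +
  primitive (fun x => sol (power_coeff z) x ^+ 2) x.
have dF (x : R) : 0 < x < 2 -> is_derive x 1 F 0.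
  move=> x2; have dsp := is_derive_solution H gp x2.
  have dsd := is_derive_solution H gd x2.
  have dfp := is_derive_flux_eq gp geometric0 (shift_power0 z) x2.
  have dfd := is_derive_flux_eq gd gp (shift_dpower z) x2.
  have := is_derive_addf (is_derive_subf (is_derive_mulf dfd dsp) (is_derive_mulf dfp dsd)) (is_derive_energy gp x2).
  move=> dFx; apply: is_derive_eq dFx _; rewrite solution0//; ring.
have F0 : F x @[x --> (0 : R)^'+] --> (0 : R).
  rewrite -[X in _ --> X](_ : 0 - 0 + 0 = 0 :> R); last by ring.
  apply: cvgD; [apply: cvgB|exact: energy_cvg0].
  - by under eq_fun do rewrite mulrC; exact: solution_flux_cvg0.
  - by under eq_fun do rewrite mulrC; exact: solution_flux_cvg0.
have : F 1 = 0 by apply: (eq0_of_derive_eq0 (b := 2) (x := 1)) dF F0.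
by rewrite /F -/(energy _) => /eqP; rewrite addr_eq0 => /eqP.
Qed.

(** If the solution vanished on [(0, 1)], so would its flux; but one of the two
tends to [1] at [0]. *)
Lemma energy_gt0 (z : R) : 0 < energy (power_coeff z).
Proof.
have gp := geometric_power z; set c := power_coeff z in gp *.
pose P := primitive (fun x => sol c x ^+ 2).
have dP (x : R) : 0 < x < 2 -> is_derive x 1 P (sol c x ^+ 2).
  by move=> x2; exact: is_derive_energy.
have P_ge0 (x : R) : 0 < x < 2 -> 0 <= P x.
  move=> x2; rewrite -oppr_le0.
  apply: (@le0_of_derive_le0 _ (fun x => - P x) (fun x => - (sol c x ^+ 2)) x).
  - by case/andP: x2.
  - move=> y yx; have y2 : 0 < y < 2 by lra.
    by have := is_derive_scalef (- 1) (dP y y2); rewrite mulN1r; under eq_fun do rewrite mulN1r.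
  - by move=> y _; rewrite oppr_le0 sqr_ge0.
  - by apply: cvgN; exact: is_derive_continuous (dP x x2).
  - by rewrite -[X in _ --> X]oppr0; apply: cvgN; exact: energy_cvg0.
rewrite lt0r P_ge0// andbT; apply/eqP => P1.
have P0 (x : R) : 0 < x < 1 -> P x = 0.
  move=> x1; have [x0 x1'] := andP x1; apply/eqP; rewrite eq_le P_ge0; last by lra.
  rewrite andbT -P1 -subr_ge0.
  have [y yx|y [_ _ ->]] := @mean_value _ P (fun x => sol c x ^+ 2) x 1 x1'.
    by apply: dP; lra.
  by rewrite mulr_ge0 ?sqr_ge0 ?subr_ge0// ltW.
have eqd (g : R -> R) (x a b : R) : is_derive x 1 g a -> is_derive x 1 g b -> a = b.
  by move=> [_ <-] [_ <-].
have near01 (x : R) : 0 < x < 1 -> \forall y \near x, 0 < y < 1.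
  move=> /andP[x0 x1]; near=> y; apply/andP; split; near: y.
    exact: lt_nbhsr.
  exact: lt_nbhsl.
have s0 (x : R) : 0 < x < 1 -> sol c x = 0.
  move=> x1; have x2 : 0 < x < 2 by lra.
  apply/eqP; rewrite -sqrf_eq0; apply/eqP; apply: (eqd P x) (dP x x2) _.
  apply: is_derive_near (is_derive_cstf 0 x).
  by near=> y; rewrite P0//; near: y; exact: near01.
have f0 (x : R) : 0 < x < 1 -> flx c x = 0.
  move=> x1; have x2 : 0 < x < 2 by lra.
  have : flx c x * w x = 0.
    apply: (eqd (sol c) x) (is_derive_solution H gp x2) _.
    apply: is_derive_near (is_derive_cstf 0 x).
    by near=> y; rewrite s0//; near: y; exact: near01.
  move/eqP; rewrite mulf_eq0 => /orP[/eqP//|/eqP w0].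
  by have := Tw x2; rewrite w0 mulr0 => /eqP; rewrite eq_sym oner_eq0.
have [K [K0 bK]] := solution_flux_bound H gp.
have c0 : c 0%N = 1 by rewrite /c /power_coeff expr0.
have lt1 (f : R -> R) : f x @[x --> (0 : R)^'+] --> (0 : R) ->
    exists x : R, 0 < x < 1 /\ K * f x < 1.
  move=> f0'; have Kf : K * f x @[x --> (0 : R)^'+] --> K * 0 by apply: cvgMr.
  near (0 : R)^'+ => x; exists x; split.
    by apply/andP; split; near: x; [exact: nbhs_right_gt|exact: nbhs_right_lt].
  by near: x; apply: (cvgr_lt _ Kf); rewrite mulr0.
have [p01|phi01] := nontrivial.
- have [x [x1 Kx]] := lt1 id (cvg_at_right_filter (@cvg_id _ _)).
  have x2 : 0 < x < 2 by lra.
  have [_ _] := bK x x2.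
  by rewrite f0// c0 p01 sub0r mulr1 normrN1 leNgt Kx.
- have b0 : 0 < 2 - m by rewrite subr_gt0; exact: fd_m_lt2 H.
  have [x [x1 Kx]] := lt1 _ (powR_cvg0 b0).
  have x2 : 0 < x < 2 by lra.
  have [_ + _] := bK x x2.
  by rewrite s0// c0 phi01// sub0r mulr1 normrN1 leNgt Kx.
Unshelve. all: by end_near. Qed.

Lemma eigenvalues_unbounded (M : R) :
  exists2 z, M <= z & flx (power_coeff z) 1 = 0.
Proof.
have Tm0 : 0 <= Tm by exact: le_trans (ltW (T0 one2)) (TTm one2).
have a0 : 0 < Num.min 1 (T 1) by rewrite lt_min ltr01 T0.
have a1 : Num.min 1 (T 1) <= 1 by rewrite ge_min lexx.
have K0 : 0 <= 2 * Tm by rewrite mulr_ge0.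
have C1 : 0 < 7 * Tm + 1 by lra.
have dD (z : R) := is_derive_solution_param H z one2.
have dB (z : R) := is_derive_flux_param H z one2.
have E (z : R) : 1 <= z -> flx (power_coeff z) 1 ^+ 2 +
    z * Num.min 1 (T 1) * sol (power_coeff z) 1 ^+ 2 -
    2 * Tm * (sol (power_coeff z) 1 * flx (power_coeff z) 1) <=
    (7 * Tm + 1) * (z * energy (power_coeff z)).
  move=> z1; have := solution_multiplier z1 (geometric_power z) geometric0 (shift_power0 z).
  rewrite energy0 addr0; apply: le_trans; rewrite lerD2r lerD2l.
  apply: ler_wpM2r; first exact: sqr_ge0.
  by apply: ler_wpM2l; [lra|rewrite ge_min lexx orbT].
exact: (riccati_oscillation a0 a1 K0 C1 dD dB lagrange_identity E M).
Qed.

(** At a zero [z] of the flux, add to the solution the multiple [r1 + i r2] of its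
derivative in [z], normalized to vanish at [1]; the real and imaginary parts have
the coefficients [c1] and [c2].  By the Lagrange identity the multiplier is
determined by the boundary condition of impedance [i (k1 + i k2)], and is at
most [C * sqrt k] with [k = k1 ^+ 2 + k2 ^+ 2].  For the last inequality, suppose
that the sum of the energies of [c1] and [c2] is at most [Cs] times the energy of
the error.  The multiplier estimate for [c1] and [c2] then bounds
[D ^+ 2] by [k * D ^+ 2] up to a constant, where [D] is the value at [1], which is
false for small [k]. *)
Lemma quasimode (Cs : R) : 0 <= Cs -> exists2 e : R, 0 < e &
  forall z k1 k2 : R, 1 <= z -> flx (power_coeff z) 1 = 0 -> k1 ^+ 2 + k2 ^+ 2 <= e ->
  exists c1 c2 : R ^nat, exists r1 r2 : R,
  [/\ geometric c1 /\ geometric c2,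
      shift_coeff c1 = (fun k => (- z) * c1 k + (- 1) *
        (r1 * power_coeff z k + 0 * power_coeff z k)),
      shift_coeff c2 = (fun k => (- z) * c2 k + (- 1) *
        (r2 * power_coeff z k + 0 * power_coeff z k)),
      [/\ sol c2 1 = 0, flx c1 1 = - k2 * sol c1 1 & flx c2 1 = k1 * sol c1 1] &
      Cs * ((r1 ^+ 2 + r2 ^+ 2) * energy (power_coeff z)) < energy c1 + energy c2].
Proof.
move=> Cs0; have t0 := T0 one2; have tTm := TTm one2.
have Tm0 : 0 <= Tm by exact: le_trans (ltW t0) tTm.
pose t := T 1; pose C := 7 * Tm + 1.
(* the two terms of Z control the boundary product and the error, respectively *)
pose Z := 16 * Tm ^+ 2 + 4 * C ^+ 2 * (Cs + 1) + 1.
have C20 : 0 <= C ^+ 2 * (Cs + 1) by rewrite mulr_ge0 ?sqr_ge0// addr_ge0.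
have Z0 : 0 < Z by rewrite /Z; have := sqr_ge0 Tm; lra.
exists (t ^+ 2 / Z); first by rewrite divr_gt0// exprn_gt0.
move=> z k1 k2 z1 Bz kZ.
have gp := geometric_power z; have gd := geometric_dpower z.
pose D := sol (power_coeff z) 1; pose N := energy (power_coeff z).
have N0 : 0 < N := energy_gt0 z.
pose D' := sol (dpower_coeff z) 1; pose B' := flx (dpower_coeff z) 1.
have DB : B' * D = - N by have := lagrange_identity z; rewrite Bz mul0r subr0.
have D0 : D != 0.
  by apply/eqP => D0; move: DB; rewrite D0 mulr0 => /eqP; rewrite eq_sym oppr_eq0 gt_eqF.
have D20 : 0 < D ^+ 2 by rewrite exprn_even_gt0.
pose r1 := D ^+ 2 * k2 / N; pose r2 := - (D ^+ 2 * k1 / N).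
(* a times the solution plus r times its z-derivative, corrected to vanish at 1 *)
pose cp r a : R ^nat := fun k => a * power_coeff z k +
  r * (1 * dpower_coeff z k + (- (D' / D)) * power_coeff z k).
have gt : geometric (fun k => 1 * dpower_coeff z k + (- (D' / D)) * power_coeff z k).
  exact: geometric_comb.
have gcp r a : geometric (cp r a) by exact: geometric_comb.
have scp r a : shift_coeff (cp r a) = (fun k => (- z) * cp r a k + (- 1) *
        (r * power_coeff z k + 0 * power_coeff z k)).
  apply/funext => k; have := congr1 (fun f => f k) (shift_power z).
  have := congr1 (fun f => f k) (shift_dpower z).
  by rewrite /shift_coeff /cp => -> ->; ring.
have sc1 r a : sol (cp r a) 1 = a * D.
  rewrite (solution_comb H _ _ gp gt one2) (solution_comb H _ _ gd gp one2).
  by rewrite -/D -/D'; field.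
have fc1 r a : flx (cp r a) 1 = - (r * N / D).
  rewrite (flux_comb H _ _ gp gt one2) (flux_comb H _ _ gd gp one2) Bz -/B'.
  have -> : N = - (B' * D) by rewrite DB opprK.
  by field.
exists (cp r1 1), (cp r2 0), r1, r2; split => //.
- by rewrite !sc1 !fc1 /r1 /r2; split; [ring|field; rewrite D0 gt_eqF|field; rewrite D0 gt_eqF].
rewrite ltNge; apply/negP => bad.
have m0 := solution_multiplier z1 gp geometric0 (shift_power0 z).
rewrite Bz energy0 -/D -/N -/t -/C in m0.
have m1 := solution_multiplier z1 (gcp r1 1) (geometric_comb r1 0 gp gp) (scp r1 1).
have m2 := solution_multiplier z1 (gcp r2 0) (geometric_comb r2 0 gp gp) (scp r2 0).
rewrite sc1 fc1 energy_scale// -/t -/C -/N in m1.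
rewrite sc1 fc1 energy_scale// -/t -/C -/N in m2.
have e1 : - (r1 * N / D) = - k2 * D by rewrite /r1; field; rewrite D0 gt_eqF.
have e2 : - (r2 * N / D) = k1 * D by rewrite /r2; field; rewrite D0 gt_eqF.
rewrite e1 in m1; rewrite e2 in m2.
move: (energy (cp r1 1)) (energy (cp r2 0)) bad m1 m2 => E1 E2 bad m1 m2.
have C1 : 1 <= C by rewrite /C; lra.
pose k := k1 ^+ 2 + k2 ^+ 2.
have k0 : 0 <= k by rewrite addr_ge0 ?sqr_ge0.
have rN : (r1 ^+ 2 + r2 ^+ 2) * N = D ^+ 2 * (D ^+ 2 / N) * k.
  by rewrite /r1 /r2 /k; field; rewrite gt_eqF.
have DN : t * (D ^+ 2 / N) <= C.
  rewrite mulrA ler_pdivrMr// -(ler_pM2l (lt_le_trans ltr01 z1)).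
  by move: m0; lra.
have X0 : 0 <= D ^+ 2 / N by rewrite divr_ge0 ?ltW.
move: (D ^+ 2 / N) X0 DN rN => X X0 DN rN; rewrite rN in bad.
have z0 : 0 < z by lra.
have sum : t * (z * t + 2 * Tm * k2) <= z * (C ^+ 2 * (Cs + 1) * k).
  rewrite -(ler_pM2r D20).
  have W0 : 0 <= D ^+ 2 * X * k by rewrite mulr_ge0// mulr_ge0// ltW.
  have h1 : D ^+ 2 * (z * t + 2 * Tm * k2) <= C * (z * (E1 + E2) + D ^+ 2 * X * k).
    have a1 : 0 <= (k1 * D) ^+ 2 by exact: sqr_ge0.
    have a2 : 0 <= (- k2 * D) ^+ 2 by exact: sqr_ge0.
    by rewrite -rN; move: m1 m2 a1 a2; lra.
  have h2 : C * (z * (E1 + E2)) <= C * (z * (Cs * (D ^+ 2 * X * k))).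
    by apply: ler_wpM2l; [lra|apply: ler_wpM2l => //; lra].
  have h3 : 0 <= C * ((z - 1) * (D ^+ 2 * X * k)).
    by apply: mulr_ge0; [lra|apply: mulr_ge0 => //; lra].
  have h4 : D ^+ 2 * (z * t + 2 * Tm * k2) <= C * z * (Cs + 1) * (D ^+ 2 * X * k).
    by move: h1 h2 h3; lra.
  have h5 : 0 <= (C * z * (Cs + 1) * (D ^+ 2 * k)) * (C - t * X).
    apply: mulr_ge0; last by rewrite subr_ge0.
    apply: mulr_ge0; last by apply: mulr_ge0 => //; exact: ltW.
    by apply: mulr_ge0; [apply: mulr_ge0; lra|lra].
  have h6 : t * (D ^+ 2 * (z * t + 2 * Tm * k2)) <=
      t * (C * z * (Cs + 1) * (D ^+ 2 * X * k)) by apply: ler_wpM2l => //; exact: ltW.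
  move: h5 h6; move: (D ^+ 2) (t) (C) (k) => d u c k'; lra.
have kZ' : k * Z <= t ^+ 2 by rewrite -ler_pdivlMr.
have Ck : C ^+ 2 * (Cs + 1) * k <= t ^+ 2 / 4.
  have h : 0 <= Tm ^+ 2 * k by rewrite mulr_ge0// sqr_ge0.
  by move: kZ' k0 h; rewrite /Z; lra.
have Tk : 4 * Tm ^+ 2 * k2 ^+ 2 <= t ^+ 2 / 4.
  have h : 0 <= C ^+ 2 * (Cs + 1) * k by rewrite mulr_ge0.
  have h' : 0 <= Tm ^+ 2 * k1 ^+ 2 by rewrite mulr_ge0// sqr_ge0.
  by move: kZ' k0 h h'; rewrite /Z /k; lra.
have low : 3 / 4 * t <= - (2 * Tm * k2).
  have zCk : z * (C ^+ 2 * (Cs + 1) * k) <= z * (t ^+ 2 / 4) by apply: ler_wpM2l => //; lra.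
  have h : t * (3 / 4 * z * t) <= t * - (2 * Tm * k2) by move: sum zCk; lra.
  rewrite ler_pM2l in h; last exact: t0.
  have : 0 <= (z - 1) * t by apply: mulr_ge0; [lra|exact: ltW].
  by move: h; lra.
have low2 : (3 / 4 * t) ^+ 2 <= (2 * Tm * k2) ^+ 2.
  rewrite -[leRHS]sqrrN; apply: lerXn2r => //; rewrite nnegrE.
    by apply: mulr_ge0; [lra|exact: ltW].
  by apply: le_trans low; apply: mulr_ge0; [lra|exact: ltW].
have : 0 < t ^+ 2 by rewrite exprn_gt0.
by move: low2 Tk; lra.
Qed.

End SturmLiouville.

(** * Exponential stability bounds the resolvent on the imaginary axis *)
Section ResolventBound.
Local Open Scope complex_scope.
Context {R : realType} {V : lmodType R[i]} (nrm : V -> R).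
Hypothesis nrmD : forall u v, nrm (u + v) <= nrm u + nrm v.
Hypothesis nrmZ : forall (a : R[i]) u, nrm (a *: u) = normc a * nrm u.
Implicit Types (u v : V).

Let nrm_ge0 u : 0 <= nrm u.
Proof.
have := nrmD u (- u); have <- : nrm u = nrm (- u).
  by rewrite -scaleN1r nrmZ normcN normc1 mul1r.
rewrite subrr; have -> : nrm 0 = 0 by rewrite -(scale0r 0) nrmZ normc0 mul0r.
lra.
Qed.

Lemma normc_real (r : R) : normc r%:C = `|r|.
Proof. by rewrite /normc /= expr0n addr0 sqrtr_sqr. Qed.

(** The supremum defining [opnorm] runs over the unit ball; since [nrm] may vanish
outside [0], [u] is scaled by [nrm u] plus a small positive number. *)
Lemma opnorm_le (F : V -> V) (X : R) u : linear F ->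
  (opnorm nrm F <= X%:E)%E -> nrm (F u) <= X * nrm u.
Proof.
move=> linF FX.
have h y : nrm y <= 1 -> nrm (F y) <= X.
  move=> y1; rewrite -lee_fin; apply: le_trans FX; apply: ereal_sup_ubound.
  by exists y.
have Fz a y : F (a *: y) = a *: F y.
  have F0 : F 0 = 0.
    have := linF 1 0 0; rewrite scaler0 addr0 scale1r => /eqP.
    by rewrite -subr_eq0 opprD addNKr oppr_eq0 => /eqP.
  by rewrite -[a *: y]addr0 linF F0 addr0.
have X0 : 0 <= X.
  apply: le_trans (h 0 _); first exact: nrm_ge0.
  by rewrite -(scale0r 0) nrmZ normc0 mul0r ler01.
apply/ler_addgt0Pr => e e0.
have X1 : 0 < X + 1 by rewrite ltr_wpDl.
pose s := nrm u + e / (X + 1).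
have s0 : 0 < s by rewrite /s ltr_wpDl ?nrm_ge0// divr_gt0.
have := h ((s^-1)%:C *: u); rewrite Fz !nrmZ normc_real ger0_norm ?invr_ge0 ?(ltW s0)//.
rewrite !(mulrC s^-1) !ler_pdivrMr// mul1r => /(_ _).
have us : nrm u <= s by rewrite /s lerDl ltW// divr_gt0.
move=> /(_ us) /le_trans; apply; rewrite /s mulrDr lerD2l.
rewrite mulrCA ler_piMr ?(ltW e0)// ler_pdivrMr// mul1r; lra.
Qed.

Variable S : R -> V -> V.
Hypothesis C0S : C0_semigroup nrm S.

(** Telescoping [S (n h) - z ^+ n] as the sum of the [z ^+ (n - 1 - k) S (k h) (S h - z)]. *)
Lemma semigroup_power_dist (M h : R) (z : R[i]) u (n : nat) : 0 <= h -> 0 <= M ->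
  (forall t v, 0 <= t -> nrm (S t v) <= M * nrm v) -> 1 <= normc z ->
  nrm (S (n%:R * h) u - z ^+ n *: u) <=
  normc z ^+ n * (n%:R * (M * nrm (S h u - z *: u))).
Proof.
move=> h0 M0 SM z1; elim: n => [|n IHn].
  rewrite !mul0r mulr0 (C0_zero C0S) expr0 scale1r subrr.
  by rewrite -(scale0r 0) nrmZ normc0 mul0r.
have nh0 : 0 <= n%:R * h by rewrite mulr_ge0.
have lin := C0_linear C0S nh0.
have linB a x y : S (n%:R * h) (x - a *: y) = S (n%:R * h) x - a *: S (n%:R * h) y.
  have -> : x - a *: y = (- a) *: y + x by rewrite scaleNr addrC.
  by rewrite lin scaleNr addrC.
have -> : n.+1%:R * h = n%:R * h + h by rewrite -natr1 mulrDl mul1r.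
rewrite (C0_add C0S)//.
have -> : S (n%:R * h) (S h u) - z ^+ n.+1 *: u =
    S (n%:R * h) (S h u - z *: u) + z *: (S (n%:R * h) u - z ^+ n *: u).
  rewrite linB scalerBr scalerA -exprS.
  by rewrite addrA subrK.
apply: le_trans (nrmD _ _) _; rewrite nrmZ.
have zn : 1 <= normc z ^+ n.+1 by rewrite exprn_ege1.
set d := nrm _ in IHn *.
have d0 : 0 <= M * nrm (S h u - z *: u) by rewrite mulr_ge0.
have h1 : nrm (S (n%:R * h) (S h u - z *: u)) <=
    normc z ^+ n.+1 * (M * nrm (S h u - z *: u)).
  by apply: le_trans (SM _ _ nh0) _; rewrite ler_peMl.
have h2 : normc z * d <= normc z ^+ n.+1 * (n%:R * (M * nrm (S h u - z *: u))).
  by rewrite exprS -mulrA; apply: ler_wpM2l => //; lra.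
rewrite -natr1; move: h1 h2; lra.
Qed.

(** At a time [t] with [M * expR (- om * t) = 1 / 2] the orbit of [u] has lost half of
its norm.  On the other hand [S t u] is close to [z ^+ n *: u] for [z = 1 + i a h] and
[h = t / n], up to [t * M * nrm (v - i a u)] as [n] grows, and [z] has modulus at least
[1], so no norm is lost along the powers of [z]. *)
Lemma exponentially_stable_resolvent_bound : exponentially_stable nrm S ->
  exists2 C : R, 0 <= C & forall u v (a : R), infinitesimal_generator nrm S u v ->
    nrm u <= C * nrm (v - ('i * a%:C) *: u).
Proof.
move=> [M [om [M1 om0 SM]]].
have M0 : 0 < M by lra.
have bd t u : 0 <= t -> nrm (S t u) <= M * expR (- om * t) * nrm u.
  by move=> t0; apply: opnorm_le; [exact: C0_linear C0S t t0|exact: SM].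
have bdM t u : 0 <= t -> nrm (S t u) <= M * nrm u.
  move=> t0; apply: le_trans (bd t u t0) _; apply: ler_wpM2r => //.
  apply: ler_piMr; first exact: ltW.
  by rewrite -expR0 ler_expR mulNr oppr_le0 mulr_ge0// ltW.
pose t := ln (2 * M) / om.
have t0 : 0 < t by rewrite divr_gt0// ln_gt0//; lra.
have half : M * expR (- om * t) = 2^-1.
  rewrite /t mulNr mulrC (mulrC om) divfK ?gt_eqF// expRN lnK ?posrE; last lra.
  by field; rewrite gt_eqF.
exists (2 * (t * M)); first by rewrite mulr_ge0// mulr_ge0// ltW.
move=> u v a gen; apply/ler_addgt0Pr => e e0.
pose e' := e / (2 * (t * M)).
have tM : 0 < 2 * (t * M) by rewrite mulr_gt0// mulr_gt0.
have e'0 : 0 < e' by rewrite divr_gt0.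
move: gen; rewrite /infinitesimal_generator => /cvgrPdist_lt/(_ _ e'0) [d /= d0 gend].
have [n] : exists n : nat, t / d < n%:R.
  by exists (Num.truncn (t / d)).+1; exact: truncnS_gt.
move=> tdn; have n0 : 0 < n%:R :> R by apply: lt_trans tdn; rewrite divr_gt0.
pose h := t / n%:R.
have h0 : 0 < h by rewrite divr_gt0.
have hd : h < d by rewrite /h ltr_pdivrMr// mulrC -ltr_pdivrMr.
have nh : n%:R * h = t by rewrite /h mulrC divfK// gt_eqF.
pose z : R[i] := 1 + (h * a)%:C * 'i.
have zn : 1 <= normc z.
  rewrite /z /normc /=; rewrite -[X in X <= _]sqrtr1 ler_wsqrtr//.
  rewrite !(mul0r, mulr0, mulr1, addr0, add0r, subr0, oppr0) expr1n lerDl sqr_ge0//.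
have close : nrm (S h u - z *: u) <= h * (e' + nrm (v - ('i * a%:C) *: u)).
  have -> : S h u - z *: u = h%:C *: (((h^-1)%:C *: (S h u - u) - v) +
      (v - ('i * a%:C) *: u)).
    rewrite addrA subrK scalerBr !scalerA -rmorphM mulfV ?gt_eqF// scale1r.
    rewrite /z scalerDl scale1r opprD addrA; congr (_ - _ *: _).
    by rewrite rmorphM/= -mulrA (mulrC 'i).
  rewrite nrmZ normc_real gtr0_norm//; apply: ler_wpM2l; first exact: ltW.
  apply: le_trans (nrmD _ _) _; rewrite lerD2r.
  have /= := gend h; rewrite sub0r normrN gtr0_norm// => /(_ hd h0).
  rewrite sub0r normrN ger0_norm// => hh; exact: ltW.
have := semigroup_power_dist u n (ltW h0) (ltW M0) bdM zn; rewrite nh => dist.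
have zn0 : 0 < normc z ^+ n by rewrite exprn_gt0//; lra.
have zn1 : 1 <= normc z ^+ n by rewrite exprn_ege1.
have key : normc z ^+ n * nrm u <=
    2^-1 * nrm u + normc z ^+ n * (n%:R * (M * nrm (S h u - z *: u))).
  have -> : normc z ^+ n * nrm u = nrm (z ^+ n *: u).
    by rewrite nrmZ; congr (_ * _); elim: (n) => [|k IHk]; rewrite ?normc1// !exprS normcM IHk.
  have -> : z ^+ n *: u = S t u + (- 1) *: (S t u - z ^+ n *: u).
    by rewrite scaleN1r opprB addrC subrK.
  apply: le_trans (nrmD _ _) _; rewrite nrmZ normcN normc1 mul1r; apply: lerD => //.
  by rewrite -half; exact: bd (ltW t0).
set c := nrm (v - _) in close *.
have close' : n%:R * (M * nrm (S h u - z *: u)) <= t * M * (e' + c).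
  have -> : t * M * (e' + c) = n%:R * (M * (h * (e' + c))) by rewrite -nh; ring.
  by apply: ler_wpM2l; [exact: ltW|apply: ler_wpM2l => //; exact: ltW].
have key2 : nrm u <= 2^-1 * nrm u + t * M * (e' + c).
  rewrite -(ler_pM2l zn0) mulrDr; apply: le_trans key _; apply: lerD.
    by rewrite ler_peMl// mulr_ge0.
  by rewrite ler_pM2l.
have -> : e = 2 * (t * M) * e' by rewrite /e' mulrC divfK// gt_eqF.
by move: key2; lra.
Qed.

End ResolventBound.

(** * The norm of the state space *)
Section L2Norm.
Local Open Scope complex_scope.
Local Open Scope quotient_scope.
Context {R : realType} (I : interval R).
Local Notation mu := (@lebesgue_measure R).
Local Notation D := [set` I].

Let mD : measurable D. Proof. exact: measurable_itv. Qed.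

(** The real part of [y * z^*]. *)
Definition cdot (y z : R[i]) : R := cRe y * cRe z + cIm y * cIm z.

Lemma cdot_norm_le (y z : R[i]) : `|cdot y z| <= normc y ^+ 2 + normc z ^+ 2.
Proof.
rewrite !normc2E /cdot; case: y z => a b [c d] /=; rewrite ler_norml.
have := sqr_ge0 (a + c); have := sqr_ge0 (a - c); have := sqr_ge0 (b + d).
have := sqr_ge0 (b - d); have := sqr_ge0 a; have := sqr_ge0 b; have := sqr_ge0 c.
have := sqr_ge0 d; lra.
Qed.

Lemma cdot_integrable (f g : R -> R[i]) : f \in sqint I -> g \in sqint I ->
  mu.-integrable D (EFin \o (fun x => cdot (f x) (g x))).
Proof.
move=> /sqintP[f1 f2 f3] /sqintP[g1 g2 g3].
apply: (@le_integrable _ _ _ mu D mD _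
  (fun x => ((normc (f x) ^+ 2)%:E + (normc (g x) ^+ 2)%:E)%E)).
- by apply/measurable_EFinP; apply: measurable_funD; apply: measurable_funM.
- move=> x _; rewrite /= lee_fin; apply: le_trans (cdot_norm_le _ _) _.
  exact: ler_norm.
- exact: integrableD.
Qed.

Definition fdot (f g : R -> R[i]) : R := \int[mu]_(x in D) cdot (f x) (g x).

Lemma Rintegral_ae_eq (f g : R -> R) : measurable_fun D f -> measurable_fun D g ->
  f = g %[ae mu in D] -> \int[mu]_(x in D) f x = \int[mu]_(x in D) g x.
Proof.
move=> mf mg fg; rewrite /Rintegral; congr fine.
apply: ae_eq_integral => //; [exact/measurable_EFinP|exact/measurable_EFinP|].
exact: (ae_eq_comp EFin fg).
Qed.

Lemma cdot_measurable (f g : R -> R[i]) : f \in sqint I -> g \in sqint I ->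
  measurable_fun D (fun x => cdot (f x) (g x)).
Proof.
move=> /sqintP[f1 f2 f3] /sqintP[g1 g2 g3].
by apply: measurable_funD; apply: measurable_funM.
Qed.

Lemma fdot_ae (f f' g g' : R -> R[i]) : f \in sqint I -> f' \in sqint I ->
  g \in sqint I -> g' \in sqint I ->
  f = f' %[ae mu in D] -> g = g' %[ae mu in D] -> fdot f g = fdot f' g'.
Proof.
move=> hf hf' hg hg' ff gg; apply: Rintegral_ae_eq; try exact: cdot_measurable.
move: ff gg; apply: filterS2; first exact: (ae_filter_ringOfSetsType mu).
by move=> x fx gx Ix; rewrite fx// gx.
Qed.

Lemma fdotC f g : fdot f g = fdot g f.
Proof. by apply: eq_Rintegral => x _; rewrite /cdot !(mulrC (_ (f x))). Qed.

Lemma fdotDl (s : R) f f' g : f \in sqint I -> f' \in sqint I -> g \in sqint I ->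
  fdot (fun x => f x + s%:C * f' x) g = fdot f g + s * fdot f' g.
Proof.
move=> hf hf' hg; rewrite /fdot -RintegralZl//; last exact: cdot_integrable.
rewrite -RintegralD//; last 2 first.
- exact: cdot_integrable.
- rewrite (_ : EFin \o _ = (fun x => (s%:E * (cdot (f' x) (g x))%:E)%E)).
    by apply: integrableZl => //; exact: cdot_integrable.
  by apply/funext => x; rewrite /= EFinM.
apply: eq_Rintegral => x _; rewrite /cdot.
by case: (f x) (f' x) (g x) => ? ? [? ?] [? ?] /=; ring.
Qed.

Lemma fdot_ge0 f : 0 <= fdot f f.
Proof. by apply: Rintegral_ge0 => x _; rewrite /cdot addr_ge0// -expr2 sqr_ge0. Qed.

Lemma fdotZ (a : R[i]) f : f \in sqint I ->
  fdot (fun x => a * f x) (fun x => a * f x) = normc a ^+ 2 * fdot f f.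
Proof.
move=> hf; rewrite /fdot -RintegralZl//; last exact: cdot_integrable.
apply: eq_Rintegral => x _; rewrite normc2E /cdot.
by case: a (f x) => ? ? [? ?] /=; ring.
Qed.

Lemma repr_sqint (x : L2 I) : (repr x : R -> R[i]) \in sqint I.
Proof. exact: sqint_valP. Qed.

Definition L2dot (x y : L2 I) : R := fdot (repr x) (repr y).

Lemma Re_L2inner (x y : L2 I) : cRe (L2inner x y) = L2dot x y.
Proof.
rewrite /L2inner /cintegral /L2dot /fdot /=; apply: eq_Rintegral => t _.
by rewrite /cdot; case: (repr x t) (repr y t) => ? ? [? ?] /=; ring.
Qed.

Lemma L2dotC x y : L2dot x y = L2dot y x. Proof. exact: fdotC. Qed.

Lemma L2dotDl (s : R) x x' y : L2dot (x + s%:C *: x') y = L2dot x y + s * L2dot x' y.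
Proof.
rewrite /L2dot -fdotDl; try exact: repr_sqint.
have e : (repr (x + s%:C *: x') : R -> R[i]) =
    (fun t => repr x t + s%:C * repr x' t) %[ae mu in D].
  have := reprL2Z s%:C x'; have := reprL2D x (s%:C *: x').
  apply: filterS2; first exact: (ae_filter_ringOfSetsType mu).
  by move=> t h1 h2 It; rewrite h1// h2.
apply: fdot_ae e _; try exact: repr_sqint; last exact: aeW.
have -> : (fun t => repr x t + s%:C * repr x' t) = s%:C *: (repr x' : R -> R[i]) + repr x.
  by apply/funext => t; rewrite addrC.
by apply: rpredD; [apply: rpredZ|]; exact: repr_sqint.
Qed.

Lemma L2dotZ (a : R[i]) x : L2dot (a *: x) (a *: x) = normc a ^+ 2 * L2dot x x.
Proof.
rewrite /L2dot -fdotZ; last exact: repr_sqint.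
have h : (fun t => a * repr x t) \in sqint I.
  by have := @rpredZ _ _ (sqint I) a _ (repr_sqint x).
by apply: fdot_ae (reprL2Z a x) (reprL2Z a x) => //; exact: repr_sqint.
Qed.

Lemma L2dot_ge0 x : 0 <= L2dot x x. Proof. exact: fdot_ge0. Qed.

End L2Norm.

Section StateNorm.
Local Open Scope complex_scope.
Context {R : realType}.
Variables (rho alpha : R).
Hypothesis z0 : 0 <= zeta rho alpha.
Implicit Types u v : state R.

Definition state_dot u v : R := L2dot u.1 v.1 + zeta rho alpha * L2dot u.2 v.2.

Lemma state_normE u : state_norm rho alpha u = Num.sqrt (state_dot u u).
Proof.
rewrite /state_norm /state_inner /state_dot; congr Num.sqrt.
rewrite -!Re_L2inner; move: (L2inner _ _) (L2inner _ _) => [a b] [c d] /=.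
by rewrite mul0r subr0.
Qed.

Lemma state_dot_ge0 u : 0 <= state_dot u u.
Proof.
by apply: addr_ge0; [exact: L2dot_ge0|apply: mulr_ge0 => //; exact: L2dot_ge0].
Qed.

Lemma state_dotDl (s : R) u u' v :
  state_dot (u + s%:C *: u') v = state_dot u v + s * state_dot u' v.
Proof. by rewrite /state_dot /= !L2dotDl; ring. Qed.

Lemma state_dotC u v : state_dot u v = state_dot v u.
Proof. by rewrite /state_dot (L2dotC u.1) (L2dotC u.2). Qed.

(** The quadratic [s |-> state_dot (u + s v) (u + s v)] is nonnegative. *)
Lemma state_dot_cauchy u v : state_dot u v <= Num.sqrt (state_dot u u) * Num.sqrt (state_dot v v).
Proof.
set A := state_dot u u; set B := state_dot u v; set C := state_dot v v.
have A0 : 0 <= A by exact: state_dot_ge0.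
have C0 : 0 <= C by exact: state_dot_ge0.
have q s : 0 <= A + 2 * s * B + s ^+ 2 * C.
  have := state_dot_ge0 (u + s%:C *: v).
  rewrite state_dotDl (state_dotC u) (state_dotC v) !state_dotDl.
  by rewrite (state_dotC v u) -/A -/B -/C; congr (_ <= _); ring.
rewrite -sqrtrM//; apply: le_trans (ler_norm B) _.
rewrite -sqrtr_sqr ler_wsqrtr//.
have [C00|C00] := eqVneq C 0.
  have [->|B0] := eqVneq B 0; first by rewrite expr0n C00 mulr0.
  have := q (- (A + 1) / (2 * B)); rewrite C00 mulr0 addr0.
  have -> : A + 2 * (- (A + 1) / (2 * B)) * B = - 1 by field.
  by rewrite oppr_ge0 ler10.
have Cp : 0 < C by rewrite lt0r C00.
have := q (- B / C); rewrite -(ler_pM2r Cp) mul0r.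
have -> : (A + 2 * (- B / C) * B + (- B / C) ^+ 2 * C) * C = A * C - B ^+ 2 by field.
by rewrite subr_ge0.
Qed.

Lemma state_normD u v :
  state_norm rho alpha (u + v) <= state_norm rho alpha u + state_norm rho alpha v.
Proof.
rewrite !state_normE -[leRHS]ger0_norm ?addr_ge0 ?sqrtr_ge0// -sqrtr_sqr.
rewrite ler_wsqrtr// sqrrD !sqr_sqrtr ?state_dot_ge0//.
have -> : u + v = u + 1%:C *: v by rewrite scale1r.
rewrite state_dotDl (state_dotC u) (state_dotC v) !state_dotDl (state_dotC v u).
have := state_dot_cauchy u v; lra.
Qed.

Lemma state_normZ (a : R[i]) u : state_norm rho alpha (a *: u) = normc a * state_norm rho alpha u.
Proof.
rewrite !state_normE /state_dot /= !L2dotZ mulrCA -mulrDr sqrtrM ?sqr_ge0//.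
rewrite sqrtr_sqr ger0_norm//; case: a => x y; exact: sqrtr_ge0.
Qed.

End StateNorm.

(** * Integrability of the memory kernel *)
Section EvenIntegral.
Context {R : realType}.
Local Notation mu := (@lebesgue_measure R).
Implicit Types (f : R -> R).

Lemma oy_bigcup_segment :
  `]0 : R, +oo[%classic = \bigcup_n `[(n.+2%:R)^-1 : R, n.+2%:R]%classic.
Proof.
apply/seteqP; split => y /=.
  rewrite in_itv/= andbT => y0.
  have ty : y < (Num.truncn y).+1%:R by exact: truncnS_gt.
  have tyV : y^-1 < (Num.truncn y^-1).+1%:R by exact: truncnS_gt.
  exists (Num.truncn y + Num.truncn y^-1)%N => //=; rewrite in_itv/=; apply/andP; split.
    rewrite -[leRHS]invrK lef_pV2 ?posrE ?invr_gt0//.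
    by apply: le_trans (ltW tyV) _; rewrite ler_nat ltnS leqW// leq_addl.
  by apply: le_trans (ltW ty) _; rewrite ler_nat ltnS leqW// leq_addr.
move=> [n _] /=; rewrite !in_itv/= andbT => /andP[ny _].
by apply: lt_le_trans ny; rewrite invr_gt0 ltr0n.
Qed.

(** Both half-lines are exhausted by segments that stay away from [0] and from
infinity, on which the change of variables [x |-> - x] is elementary. *)
Lemma even_integrable f : measurable_fun setT f -> (forall x, 0 <= f x) ->
  (forall x, f (- x) = f x) -> (forall x, 0 < x -> {for x, continuous f}) ->
  mu.-integrable `]0, +oo[ (EFin \o f) -> mu.-integrable setT (EFin \o f).
Proof.
move=> mf f0 fN cf /integrableP[_ fi].
have mEf (A : set R) : measurable_fun A (EFin \o f).
  by apply/measurable_EFinP; exact: measurable_funTS.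
have {fi} fi : (\int[mu]_(x in `]0%R, +oo[) (f x)%:E < +oo)%E.
  move: fi; congr (_ < _)%E; apply: eq_integral => x _ /=.
  by rewrite ger0_norm.
have NE : `]-oo, (0 : R)[%classic =
    \bigcup_n `[- (n.+2%:R), - (n.+2%:R)^-1 : R]%classic.
  have -> : `]-oo, (0 : R)[%classic = -%R @^-1` `]0 : R, +oo[%classic.
    by apply/seteqP; split => y /=; rewrite !in_itv/= andbT oppr_gt0.
  rewrite oy_bigcup_segment preimage_bigcup; apply: eq_bigcup => // n _.
  apply/seteqP; split => y /=; rewrite !in_itv/= => /andP[h1 h2]; apply/andP.
    by split; [rewrite lerNl|rewrite lerNr].
  by split; [rewrite lerNr|rewrite lerNl].
have leN : (\int[mu]_(x in `]-oo, 0%R[) (f x)%:E <=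
            \int[mu]_(x in `]0%R, +oo[) (f x)%:E)%E.
  rewrite NE; apply: integral_bigcup_le.
  - apply/nondecreasing_seqP => n; rewrite subsetEset => y /=.
    rewrite !in_itv/= => /andP[h1 h2].
    have h3 : n.+2%:R <= n.+3%:R :> R by rewrite ler_nat.
    have h4 : n.+3%:R^-1 <= n.+2%:R^-1 :> R by rewrite lef_pV2 ?posrE ?ltr0n.
    apply/andP; split; [apply: le_trans h1|apply: le_trans h2 _]; by rewrite lerN2.
  - by move=> n; exact: measurable_itv.
  - by move=> n; exact: mEf.
  - by move=> x; rewrite lee_fin.
  move=> n; rewrite integration_by_substitution_oppr; last 2 first.
  - by rewrite (@le_trans _ _ 1)// ?ler1n// invf_le1 ?ler1n// ltr0n.
  - apply: continuous_in_within => x /=; rewrite in_itv/= => /andP[_ xn].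
    have x0 : 0 < - x.
      by apply: (@lt_le_trans _ _ n.+2%:R^-1); [rewrite invr_gt0 ltr0n|rewrite lerNr].
    have e : f = f \o -%R by apply/funext => y; rewrite /= fN.
    rewrite e; apply: continuous_comp; first exact: opp_continuous.
    exact: cf.
  under eq_integral do rewrite /= fN.
  apply: ge0_subset_integral => //; first exact: mEf.
    by move=> x _; rewrite lee_fin.
  move=> x /=; rewrite !in_itv/= andbT => /andP[h _].
  by apply: lt_le_trans h; rewrite invr_gt0 ltr0n.
have e0 : [set: R] `\` [set 0] = `]-oo, (0 : R)[%classic `|` `]0 : R, +oo[%classic.
  apply/seteqP; split => y /=; rewrite !in_itv/= andbT.
    by move=> [_ /eqP]; rewrite neq_lt => /orP.
  by move=> [] y0; split=> // yE; move: y0; rewrite yE ltxx.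
have mu0 : mu [set (0 : R)] = 0%E by exact: lebesgue_measure_set1.
apply/(@negligible_integrable _ _ _ mu setT [set (0 : R)]) => //.
  exact: mEf.
rewrite e0.
apply/integrableP; split; first exact: mEf.
under eq_integral do rewrite /= ger0_norm//.
rewrite ge0_integral_setU//=; last 3 first.
- exact: mEf.
- by move=> x _; rewrite lee_fin.
- apply/disj_setPS => x /=; rewrite !in_itv/= andbT => -[h1 h2].
  by have := lt_trans h1 h2; rewrite ltxx.
by rewrite lte_add_pinfty//; exact: le_lt_trans leN fi.
Qed.

End EvenIntegral.

Section Majorant.
Context {R : realType}.
Variable alpha : R.
Hypothesis a0 : 0 < alpha.
Hypothesis a1 : alpha < 1.
Local Notation mu := (@lebesgue_measure R).

(** This is [eta alpha x ^+ 2] damped at infinity: it behaves like [|x| ^ (alpha - 2)]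
there and like [|x| ^ (2 alpha - 1)] at [0], so that [0 < alpha < 1] makes it
integrable. *)
Definition majorant (x : R) : R :=
  `|x| `^ (2 * alpha - 1) * (Num.max 1 (x ^+ 2)) `^ (- ((1 + alpha) / 2)).

Lemma majorant_ge0 x : 0 <= majorant x.
Proof. by rewrite mulr_ge0 ?powR_ge0. Qed.

Let measurable_normpow c : measurable_fun setT (fun x : R => `|x| `^ c).
Proof.
exact: (measurableT_comp (measurable_powR c) (@normr_measurable R setT)).
Qed.

Lemma measurable_majorant : measurable_fun setT majorant.
Proof.
apply: measurable_funM => //.
apply: (measurableT_comp (measurable_powR _)).
by apply: measurable_maxr => //; exact: exprn_measurable.
Qed.

Lemma majorant_integrable : mu.-integrable setT (EFin \o majorant).
Proof.
apply: even_integrable.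
- exact: measurable_majorant.
- exact: majorant_ge0.
- by move=> x; rewrite /majorant normrN sqrrN.
- have cn c x : 0 < x -> {for x, continuous (fun x : R => `|x| `^ c)}.
    move=> x0; apply: (@is_derive_continuous _ _ _ (c * x `^ (c - 1))).
    apply: is_derive_near (is_derive1_powR c x0); near=> y.
    by rewrite gtr0_norm//; near: y; exact: lt_nbhsr.
  move=> x x0; have max0 : 0 < Num.max 1 (x ^+ 2) by rewrite lt_max ltr01.
  have cmax : {for x, continuous (fun x : R => Num.max 1 (x ^+ 2))}.
    apply: continuous_max; first exact: cvg_cst.
    exact: is_derive_continuous (is_derive_expf 2 (is_derive_idf x)).
  have cpow : {for Num.max 1 (x ^+ 2),
      continuous (fun y => y `^ (- ((1 + alpha) / 2)))}.
    exact: is_derive_continuous (is_derive1_powR _ max0).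
  have c2 := continuous_comp cmax cpow.
  by apply: cvgM; [exact: cn|exact: c2].
have mM (A : set R) : measurable_fun A (EFin \o majorant).
  by apply/measurable_EFinP; exact: measurable_funTS measurable_majorant.
apply/integrableP; split; first exact: mM.
under eq_integral do rewrite /= ger0_norm ?majorant_ge0//.
have e : `]0 : R, +oo[%classic = `]0 : R, 1]%classic `|` `]1 : R, +oo[%classic.
  apply/seteqP; split => y /=; rewrite !in_itv/= !andbT.
    by move=> y0; rewrite y0 /=; have [?|?] := leP y 1; [left|right].
  by move=> [/andP[]//|]; exact: lt_trans.
rewrite e ge0_integral_setU//=; last 3 first.
- exact: mM.
- by move=> x _; rewrite lee_fin majorant_ge0.
- apply/disj_setPS => x /=; rewrite !in_itv/= andbT => -[/andP[_ h1] h2].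
  by have := lt_le_trans h2 h1; rewrite ltxx.
apply: lte_add_pinfty.
- have c1 : -1 < 2 * alpha - 1 by move: a0; lra.
  apply: (@le_lt_trans _ _ (1 `^ (2 * alpha - 1 + 1) / (2 * alpha - 1 + 1))%:E);
    last exact: ltry.
  apply: le_trans (integral_powR_le c1 ltr01); apply: ge0_le_integral => //.
  + by move=> x _; rewrite lee_fin majorant_ge0.
  + exact: mM.
  + by apply/measurable_EFinP; exact: measurable_funTS (measurable_powR _).
  + move=> x /=; rewrite in_itv/= => /andP[x0 _].
    rewrite lee_fin /majorant gtr0_norm// ler_piMr ?powR_ge0//.
    rewrite powRN invf_le1 ?powR_gt0 ?lt_max ?ltr01//.
    rewrite -[leLHS](powRr0 (Num.max 1 (x ^+ 2))) ler_powR ?le_max ?lexx//.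
    by move: a0; lra.
- have -> : `]1 : R, +oo[%classic = \bigcup_n `]1 : R, 1 + n.+1%:R]%classic.
    apply/seteqP; split => y /=; rewrite ?in_itv/= ?andbT.
      move=> y1; exists (Num.truncn y) => //=; rewrite in_itv/= y1/=.
      have := truncnS_gt y; lra.
    by move=> [n _] /=; rewrite in_itv/= => /andP[].
  apply: (@le_lt_trans _ _ ((1 - alpha)^-1)%:E); last exact: ltry.
  apply: integral_bigcup_le.
  + apply/nondecreasing_seqP => n; rewrite subsetEset => y /=.
    rewrite !in_itv/= => /andP[-> h] /=; apply: le_trans h _.
    by rewrite lerD2l ler_nat.
  + by move=> n; exact: measurable_itv.
  + by move=> n; exact: mM.
  + by move=> x; rewrite lee_fin majorant_ge0.
  move=> n; apply: (@le_trans _ _ (\int[mu]_(x in `[1%R, (1 + n.+1%:R)%R]) (x `^ (alpha - 2))%:E)%E).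
    rewrite integral_itv_obnd_cbnd; last exact: mM.
    apply: ge0_le_integral => //.
    * by move=> x _; rewrite lee_fin majorant_ge0.
    * exact: mM.
    * by apply/measurable_EFinP; exact: measurable_funTS (measurable_powR _).
    * move=> x /=; rewrite in_itv/= => /andP[x1 _].
      have x0 : 0 < x by lra.
      rewrite lee_fin /majorant gtr0_norm// max_r ?exprn_ege1//.
      rewrite -powR_mulrn ?(ltW x0)// -powRrM -powRD ?(gt_eqF x0) ?implybT//.
      by rewrite le_eqVlt; apply/orP; left; apply/eqP; congr (_ `^ _); field.
  rewrite integral_powR_segment//; last 2 first.
  * by rewrite lt_eqF//; move: a1; lra.
  * by rewrite ltrDl ltr0n.
  rewrite lee_fin powR1.
  have -> : alpha - 2 + 1 = - (1 - alpha) by ring.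
  set p := _ `^ _; rewrite [leLHS](_ : _ = (1 - alpha)^-1 - p / (1 - alpha)); last first.
    by field; rewrite gt_eqF//; move: a1; lra.
  rewrite gerBl; by rewrite divr_ge0 ?powR_ge0//; move: a1; lra.
Unshelve. all: by end_near. Qed.

Lemma eta_sqr x : eta alpha x ^+ 2 = `|x| `^ (2 * alpha - 1).
Proof. by rewrite /eta -powR_mulrn ?powR_ge0// -powRrM; congr (_ `^ _); field. Qed.

(** Interpolation: [A] dominates both [s] and [max(1, x^2)], hence their weighted
geometric mean with exponents [(1 - alpha) / 2] and [(1 + alpha) / 2]. *)
Lemma eta_sqr_le (s x A : R) : 1 <= s -> s <= A -> x ^+ 2 <= A ->
  eta alpha x ^+ 2 / A <= s `^ (- ((1 - alpha) / 2)) * majorant x.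
Proof.
move=> s1 sA xA; have A0 : 0 < A by lra.
have s0 : 0 < s by lra.
rewrite eta_sqr /majorant mulrCA; apply: ler_wpM2l; first exact: powR_ge0.
set M := Num.max 1 (x ^+ 2).
have MA : M <= A by rewrite ge_max xA andbT; lra.
have M0 : 0 < M by rewrite lt_max ltr01.
rewrite !powRN -invfM lef_pV2 ?posrE ?mulr_gt0 ?powR_gt0//.
have -> : A = A `^ ((1 - alpha) / 2) * A `^ ((1 + alpha) / 2).
  rewrite -powRD; last by rewrite (gt_eqF A0) implybT.
  by rewrite -[LHS](powRr1 (ltW A0)); congr (_ `^ _); field.
by apply: ler_pM; rewrite ?powR_ge0//; apply: ge0_ler_powR;
  rewrite ?nnegrE ?(ltW A0) ?(ltW s0) ?(ltW M0)//; move: a0 a1; lra.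
Qed.

End Majorant.

(** * The memory variable of a time-harmonic state *)
Section Coupling.
Local Open Scope complex_scope.
Context {R : realType}.
Variables (rho alpha wp z : R).
Hypothesis rho0 : 0 < rho.
Hypothesis a0 : 0 < alpha.
Hypothesis a1 : alpha < 1.
Hypothesis wp0 : 0 <= wp.
Hypothesis z1 : 1 <= z.
Local Notation mu := (@lebesgue_measure R).
Local Notation line := (`]-oo, +oo[ : interval R).
Local Notation eta := (eta alpha).

Lemma zeta_gt0 : 0 < zeta rho alpha.
Proof.
rewrite /zeta mulr_gt0// ?divr_gt0// ?pi_gt0// sin_gt0_pi//.
by rewrite mulr_gt0 ?pi_gt0//= gtr_pMl ?pi_gt0.
Qed.

(** The squared modulus of [xi^2 + wp - i z]. *)
Definition symbol_sqr (x : R) : R := (x ^+ 2 + wp) ^+ 2 + z ^+ 2.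

(** The solution [eta D / (xi^2 + wp - i z)] of the second equation for a boundary
value [D]. *)
Definition memory (D x : R) : R[i] :=
  (eta x * D * (x ^+ 2 + wp) / symbol_sqr x) +i* (eta x * D * z / symbol_sqr x).

Let A x := Num.sqrt (symbol_sqr x).

Let symbol_sqr_gt0 x : 0 < symbol_sqr x.
Proof. by rewrite ltr_wpDl ?sqr_ge0// exprn_gt0//; move: z1; lra. Qed.

Let A2 x : A x ^+ 2 = symbol_sqr x. Proof. by rewrite sqr_sqrtr// ltW. Qed.

Let s0 (x : R) : 0 <= x ^+ 2 + wp. Proof. by rewrite addr_ge0 ?sqr_ge0. Qed.

Let zA x : z <= A x.
Proof.
rewrite -[leLHS]ger0_norm; last by move: z1; lra.
by rewrite -sqrtr_sqr ler_wsqrtr// lerDr sqr_ge0.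
Qed.

Let sA (x : R) : x ^+ 2 + wp <= A x.
Proof. by rewrite -[leLHS]ger0_norm// -sqrtr_sqr ler_wsqrtr// lerDl sqr_ge0. Qed.

Let xA (x : R) : x ^+ 2 <= A x.
Proof. by apply: le_trans (sA x); rewrite lerDl. Qed.

Let A1 x : 1 <= A x. Proof. exact: le_trans z1 (zA x). Qed.

(** The rate at which the coupling to the memory variable fades as the frequency
[z] grows. *)
Definition decay_factor : R := z `^ (- ((1 - alpha) / 2)).

Let etaA x : eta x ^+ 2 / A x <= decay_factor * majorant alpha x.
Proof. exact: eta_sqr_le. Qed.

Let frac_le (x u : R) : 0 <= u -> u <= A x -> eta x ^+ 2 * u / symbol_sqr x <= decay_factor * majorant alpha x.
Proof.
move=> u0 uA; apply: le_trans (etaA x); have Ax0 : 0 < A x := lt_le_trans ltr01 (A1 x).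
rewrite -mulrA; apply: ler_wpM2l; first exact: sqr_ge0.
rewrite -A2 ler_pdivrMr ?exprn_gt0// expr2 mulrA mulVf ?gt_eqF// mul1r//.
Qed.

Let setline : [set` line] = [set: R]. Proof. by rewrite set_itvNyy. Qed.

Let measurable_eta : measurable_fun [set: R] eta.
Proof.
exact: (measurableT_comp (measurable_powR _) (@normr_measurable R setT)).
Qed.

Let measurable_symbol_sqr_inv : measurable_fun [set: R] (fun x => (symbol_sqr x)^-1).
Proof.
apply: continuous_measurable_fun => x.
apply: (@is_derive_continuous _ _ _ (- (2%:R * (x ^+ 2 + wp) ^+ 1 * (2%:R * x ^+ 1 * 1 + 0) + 0) / symbol_sqr x ^+ 2)).
apply: is_derive_invf; first by rewrite gt_eqF.
exact: (is_derive_addf (is_derive_expf 2 (is_derive_addf (is_derive_expf 2 (is_derive_idf x)) (is_derive_cstf wp x))) (is_derive_cstf _ x)).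
Qed.

Let measurable_symbol : measurable_fun [set: R] (fun x : R => x ^+ 2 + wp).
Proof. by apply: measurable_funD => //; exact: exprn_measurable. Qed.

Let integrable_of_le (f : R -> R) (C : R) : measurable_fun [set: R] f ->
  (forall x, `|f x| <= C * majorant alpha x) -> mu.-integrable [set` line] (EFin \o f).
Proof.
move=> mf fC; rewrite setline.
apply: (@le_integrable _ _ _ mu _ _ _ (fun x => (C%:E * (majorant alpha x)%:E)%E)) => //.
- exact/measurable_EFinP.
- by move=> x _; rewrite /= lee_fin; apply: le_trans (fC x) (ler_norm _).
- by apply: integrableZl => //; exact: majorant_integrable.
Qed.

Lemma measurable_Re_memory D : measurable_fun [set: R] (fun x => cRe (memory D x)).
Proof.
by apply: measurable_funM => //; apply: measurable_funM => //; apply: measurable_funM.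
Qed.

Lemma measurable_Im_memory D : measurable_fun [set: R] (fun x => cIm (memory D x)).
Proof.
by apply: measurable_funM => //; apply: measurable_funM => //; apply: measurable_funM.
Qed.

Let normc_memory D x : normc (memory D x) ^+ 2 = D ^+ 2 * (eta x ^+ 2 * 1 / symbol_sqr x).
Proof.
rewrite normc2E /memory /=; have := symbol_sqr_gt0 x; rewrite /symbol_sqr => d0.
by field; rewrite gt_eqF.
Qed.

Lemma memory_sqint D : memory D \in sqint line.
Proof.
apply/sqintP; rewrite setline; split.
- exact: measurable_Re_memory.
- exact: measurable_Im_memory.
rewrite -setline; apply: (@integrable_of_le _ (D ^+ 2 * decay_factor)).
  rewrite (_ : (fun x => _) = (fun x => cRe (memory D x) ^+ 2 + cIm (memory D x) ^+ 2)).
    apply: measurable_funD; apply: measurable_funX.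
      exact: measurable_Re_memory.
    exact: measurable_Im_memory.
  by apply/funext => x; rewrite normc2E.
move=> x; rewrite ger0_norm ?sqr_ge0// normc_memory -[leRHS]mulrA.
by apply: ler_wpM2l; [exact: sqr_ge0|apply: frac_le].
Qed.

Lemma weighted_memory_sqint D : (fun x => `|x|%:C * memory D x) \in sqint line.
Proof.
have Re x : cRe (`|x|%:C * memory D x) = `|x| * cRe (memory D x).
  by rewrite /memory /=; ring.
have Im x : cIm (`|x|%:C * memory D x) = `|x| * cIm (memory D x).
  by rewrite /memory /=; ring.
have mRe : measurable_fun [set: R] (fun x => cRe (`|x|%:C * memory D x)).
  rewrite (_ : (fun x => _) = (fun x => `|x| * cRe (memory D x))); last exact/funext.
  by apply: measurable_funM; [exact: normr_measurable|exact: measurable_Re_memory].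
have mIm : measurable_fun [set: R] (fun x => cIm (`|x|%:C * memory D x)).
  rewrite (_ : (fun x => _) = (fun x => `|x| * cIm (memory D x))); last exact/funext.
  by apply: measurable_funM; [exact: normr_measurable|exact: measurable_Im_memory].
apply/sqintP; rewrite setline; split => //.
rewrite -setline; apply: (@integrable_of_le _ (D ^+ 2 * decay_factor)).
  rewrite (_ : (fun x => _) = (fun x => cRe (`|x|%:C * memory D x) ^+ 2 +
      cIm (`|x|%:C * memory D x) ^+ 2)).
    by apply: measurable_funD; apply: measurable_funX.
  by apply/funext => x; rewrite normc2E.
move=> x; rewrite ger0_norm ?sqr_ge0// normcM exprMn normc_memory.
have -> : normc `|x|%:C ^+ 2 = x ^+ 2.
  by rewrite normc2E /= expr0n addr0 real_normK ?num_real.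
rewrite [leLHS](_ : _ = D ^+ 2 * (eta x ^+ 2 * x ^+ 2 / symbol_sqr x)); last by ring.
rewrite -[leRHS]mulrA; apply: ler_wpM2l; first exact: sqr_ge0.
by apply: frac_le => //; exact: sqr_ge0.
Qed.

(** The complex number [kappa1 + i kappa2] is [zeta] times the integral of
[eta^2 / (xi^2 + wp - i z)]: the impedance at [1] once the memory variable has been
eliminated. *)
Definition kappa1 : R := zeta rho alpha * \int[mu]_(x in [set` line]) (eta x ^+ 2 * (x ^+ 2 + wp) / symbol_sqr x).
Definition kappa2 : R := zeta rho alpha * \int[mu]_(x in [set` line]) (eta x ^+ 2 * z / symbol_sqr x).

Let frac_integral (f : R -> R) : measurable_fun [set: R] f ->
  (forall x, 0 <= f x) -> (forall x, f x <= A x) ->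
  mu.-integrable [set` line] (EFin \o (fun x => eta x ^+ 2 * f x / symbol_sqr x)) /\
  `|\int[mu]_(x in [set` line]) (eta x ^+ 2 * f x / symbol_sqr x)| <=
    decay_factor * \int[mu]_(x in [set` line]) majorant alpha x.
Proof.
move=> mf f0 fA.
have p x : 0 <= eta x ^+ 2 * f x / symbol_sqr x.
  by rewrite divr_ge0 ?(ltW (symbol_sqr_gt0 x))// mulr_ge0 ?sqr_ge0.
have i : mu.-integrable [set` line] (EFin \o (fun x => eta x ^+ 2 * f x / symbol_sqr x)).
  apply: (@integrable_of_le _ decay_factor).
    by apply: measurable_funM => //; apply: measurable_funM => //; exact: measurable_funX.
  by move=> x; rewrite ger0_norm//; exact: frac_le.
split=> //.
have im : mu.-integrable [set` line] (EFin \o majorant alpha).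
  by rewrite setline; exact: majorant_integrable.
rewrite ger0_norm; last by apply: Rintegral_ge0.
rewrite -RintegralZl//; apply: le_Rintegral => //.
- rewrite (_ : EFin \o _ = (fun x => (decay_factor%:E * (majorant alpha x)%:E)%E)).
    by apply: integrableZl.
  by apply/funext => x; rewrite /= EFinM.
- by move=> x _; exact: frac_le.
Qed.

Lemma kappa_bound : kappa1 ^+ 2 + kappa2 ^+ 2 <=
  2 * (zeta rho alpha * \int[mu]_(x in [set` line]) majorant alpha x) ^+ 2 * decay_factor ^+ 2.
Proof.
have [_ h1] := frac_integral measurable_symbol s0 sA.
have z0 : 0 <= z by move: z1; lra.
have [_ h2] := @frac_integral (fun=> z) (measurable_cst _) (fun=> z0) zA.
set I := \int[mu]_(x in _) majorant alpha x in h1 h2 *.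
have sq (k : R) : `|k| <= decay_factor * I -> (zeta rho alpha * k) ^+ 2 <= (zeta rho alpha * I) ^+ 2 * decay_factor ^+ 2.
  move=> kI; rewrite [leRHS](_ : _ = zeta rho alpha ^+ 2 * (decay_factor * I) ^+ 2); last by ring.
  rewrite exprMn; apply: ler_wpM2l; first exact: sqr_ge0.
  rewrite -[k ^+ 2]real_normK ?num_real//.
  by apply: lerXn2r => //; rewrite nnegrE (le_trans _ kI).
have := sq _ h1; have := sq _ h2; rewrite -/kappa1 -/kappa2; lra.
Qed.

Lemma cintegral_memory (D : R) :
  zeta rho alpha * cRe (cintegral line (fun x => (eta x)%:C * memory D x)) = kappa1 * D /\
  zeta rho alpha * cIm (cintegral line (fun x => (eta x)%:C * memory D x)) = kappa2 * D.
Proof.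
have z0 : 0 <= z by move: z1; lra.
have [i1 _] := frac_integral measurable_symbol s0 sA.
have [i2 _] := @frac_integral (fun=> z) (measurable_cst _) (fun=> z0) zA.
rewrite /cintegral /= /kappa1 /kappa2 -!(mulrA (zeta rho alpha)); split; congr (_ * _).
- rewrite (mulrC _ D) -RintegralZl//; apply: eq_Rintegral => x _ /=.
  by rewrite mul0r subr0; ring.
- rewrite (mulrC _ D) -RintegralZl//; apply: eq_Rintegral => x _ /=.
  by rewrite mul0r addr0; ring.
Qed.

Lemma opA_snd_memory (psi : R -> R[i]) (D x : R) : psi 1 = D%:C ->
  opA_snd alpha wp psi (memory D) x = ('i * (- z)%:C) * memory D x.
Proof.
move=> e; rewrite /opA_snd e /memory; apply/eqP; rewrite eq_complex /=.
by apply/andP; split; apply/eqP; have := symbol_sqr_gt0 x; rewrite /symbol_sqr => d0;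
  field; rewrite gt_eqF.
Qed.

End Coupling.

(** * The degenerate coefficient *)
Section Coefficient.
Context {R : realType}.
Variable tau : R -> R.
Hypothesis tauC0 : {within `[0, 1], continuous tau}.
Hypothesis tauC1 : forall x : R, `]0, 1]%classic x ->
  cvg (diff_quotient tau x y @[y --> within `]0, 1] x^']).
Hypothesis tau_gt0 : forall x : R, 0 < x -> x <= 1 -> 0 < tau x.
Hypothesis m_tau2 : (m_tau tau < 2%:E)%E.

Let dtau := derive_in `]0, 1] tau.

Lemma is_derive_diff_quotient (f : R -> R) (x l : R) :
  diff_quotient f x y @[y --> x^'] --> l -> is_derive x 1 f l.
Proof.
move=> fl.
have h : (fun h : R => h^-1 *: ((f \o shift x) (h *: 1) - f x)) @ 0^' --> l.
  apply/cvgrPdist_lt => e e0.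
  move/cvgrPdist_lt : fl => /(_ _ e0) [d /= d0 fd].
  exists d => // h /=; rewrite sub0r normrN => hd h0.
  have /= := fd (x + h); rewrite opprD addrA subrr sub0r normrN => /(_ hd).
  have xh : x + h != x by rewrite -subr_eq0 addrC addKr.
  move=> /(_ xh); rewrite /diff_quotient (_ : x + h - x = h); last by rewrite addrC addKr.
  by rewrite /GRing.scale/= mulr1 (mulrC h^-1) (addrC h).
split; first by apply/cvg_ex; exists l.
exact: cvg_lim h.
Qed.

Lemma is_derive_tau (x : R) : 0 < x < 1 -> is_derive x 1 tau (dtau x).
Proof.
move=> /andP[x0 x1]; apply: is_derive_diff_quotient.
have Ax : `]0, 1]%classic x by rewrite /= in_itv/= x0 ltW.
have w : within `]0, 1] x^' = x^'.
  apply/seteqP; split => P /=; last first.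
    by rewrite /within /=; apply: filterS => y Py _.
  rewrite /within /= => h; near=> y.
  have Ay : `]0, 1]%classic y.
    rewrite /= in_itv/=; apply/andP; split; near: y; apply: cvg_within.
    - exact: lt_nbhsr.
    - by near=> y; apply: ltW; near: y; exact: lt_nbhsl.
  by move: Ay; near: y.
have := tauC1 Ax; rewrite w => h; rewrite /dtau /derive_in w.
exact: h.
Unshelve. all: by end_near. Qed.

(** Extending [tau] by a constant beyond [1] makes the solutions differentiable on
both sides of the endpoint. *)
Definition tauext (x : R) : R := tau (Num.min x 1).

Lemma tauextE (x : R) : x <= 1 -> tauext x = tau x.
Proof. by move=> x1; rewrite /tauext min_l. Qed.

Lemma tauext_gt0 (x : R) : 0 < x < 2 -> 0 < tauext x.
Proof. by move=> /andP[x0 _]; apply: tau_gt0; rewrite ?lt_min ?x0 ?ltr01// ge_min lexx orbT. Qed.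

Lemma tauext_continuous (x : R) : 0 < x < 2 -> {for x, continuous tauext}.
Proof.
move=> /andP[x0 _]; have h01 (y : R) : 0 < y -> `[0, 1]%classic (Num.min y 1).
  by move=> y0; rewrite /= in_itv/= le_min (ltW y0) ler01/= ge_min lexx orbT.
have /subspace_continuousP /(_ _ (h01 x x0)) h := tauC0.
apply: cvg_comp h; move=> P /= [d d0 dP].
have cm : {for x, continuous (fun y : R => Num.min y 1)}.
  by apply: continuous_min; [exact: cvg_id|exact: cvg_cst].
have := cm _ (nbhsx_ballx (Num.min x 1) d d0); rewrite nbhs_simpl /= => c.
near=> y; apply: dP; last by apply: h01; near: y; exact: lt_nbhsr.
by near: y.
Unshelve. all: by end_near. Qed.

Lemma tauext_bounded : exists Tm : R, forall x : R, 0 < x < 2 -> tauext x <= Tm.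
Proof.
have [c c01 tc] := EVT_max ler01 tauC0; exists (tau c) => x /andP[x0 _].
by apply: tc; rewrite in_itv/= le_min (ltW x0) ler01/= ge_min lexx orbT.
Qed.

Lemma is_derive_tauext (x : R) : 0 < x < 1 -> is_derive x 1 tauext (dtau x).
Proof.
move=> x1; apply: is_derive_near (is_derive_tau x1); near=> y.
rewrite tauextE//; apply: ltW; near: y; case/andP: x1 => _; exact: lt_nbhsl.
Unshelve. all: by end_near. Qed.

Lemma m_tau_bound (x : R) : 0 < x -> x <= 1 ->
  ((x * `|dtau x| / tau x)%:E <= m_tau tau)%E.
Proof. by move=> x0 x1; apply: ereal_sup_ubound; exists x => //=; rewrite in_itv/= x0. Qed.

Lemma m_tau_ge0 : (0 <= m_tau tau)%E.
Proof.
apply: le_trans (m_tau_bound ltr01 (lexx 1)); rewrite lee_fin mul1r.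
by rewrite divr_ge0// ltW// tau_gt0.
Qed.

Let m := fine (m_tau tau).

Lemma fine_m_tauE : m_tau tau = m%:E.
Proof. by rewrite fineK// ge0_fin_numE ?m_tau_ge0// (lt_trans m_tau2) ?ltry. Qed.

Lemma fine_m_tau_ge0 : 0 <= m. Proof. by rewrite -lee_fin -fine_m_tauE m_tau_ge0. Qed.

Lemma fine_m_tau_lt2 : m < 2. Proof. by rewrite -lte_fin -fine_m_tauE. Qed.

Lemma dtau_le (x : R) : 0 < x < 1 -> x * `|dtau x| <= m * tau x.
Proof.
move=> /andP[x0 x1]; have t0 := tau_gt0 x0 (ltW x1).
by have := m_tau_bound x0 (ltW x1); rewrite fine_m_tauE lee_fin ler_pdivrMr.
Qed.

Lemma dtauext_le (x : R) : 0 < x < 1 -> x * `|dtau x| <= 2 * tauext x.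
Proof.
move=> x1; have [x0 x1'] := andP x1; rewrite (tauextE (ltW x1')).
apply: le_trans (dtau_le x1) _; apply: ler_wpM2r; last exact: ltW fine_m_tau_lt2.
exact: ltW (tau_gt0 x0 (ltW x1')).
Qed.

(** The function [tau x / x `^ m] is nonincreasing, since [x * tau' x <= m * tau x]. *)
Lemma tau_lower_bound (x : R) : 0 < x -> x <= 1 -> tau 1 * x `^ m <= tau x.
Proof.
move=> x0; rewrite le_eqVlt => /predU1P[->|x1]; first by rewrite powR1 mulr1.
pose g y := tauext y * y `^ (- m).
have dg (y : R) : 0 < y < 1 ->
    is_derive y 1 g (dtau y * y `^ (- m) + tauext y * (- m * y `^ (- m - 1))).
  by move=> y1; apply: is_derive_mulf (is_derive_tauext y1) (is_derive1_powR _ _); case/andP: y1.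
have : g 1 - g x <= 0.
  have [y yx1||y] := @MVT R g (fun y => dtau y * y `^ (- m) +
      tauext y * (- m * y `^ (- m - 1))) x 1 x1.
  - by apply: dg; move: yx1; rewrite in_itv/= => /andP[xy ->]; rewrite (lt_trans x0).
  - apply: continuous_in_within => y /=; rewrite in_itv/= => /andP[xy y1].
    have y0 : 0 < y by exact: lt_le_trans xy.
    apply: cvgM; first by apply: tauext_continuous; lra.
    exact: is_derive_continuous (is_derive1_powR (- m) y0).
  - rewrite in_itv/= => /andP[xy y1] ->.
    have y0 : 0 < y by exact: lt_trans xy.
    have y01 : 0 < y < 1 by rewrite y0.
    apply: mulr_le0_ge0; last by rewrite subr_ge0 ltW.
    have -> : y `^ (- m - 1) = y `^ (- m) / y.
      by rewrite powRB ?powRr1 ?(ltW y0)// (gt_eqF y0) implybT.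
    have -> : dtau y * y `^ (- m) + tauext y * (- m * (y `^ (- m) / y)) =
      y `^ (- m) / y * (y * dtau y - m * tauext y) by field; rewrite gt_eqF.
    apply: mulr_ge0_le0; first by rewrite divr_ge0 ?powR_ge0// ltW.
    rewrite subr_le0 (tauextE (ltW y1)); apply: le_trans (dtau_le y01).
    by rewrite ler_pM2l// ler_norm.
rewrite subr_le0 /g !tauextE ?(ltW x1)// powR1 mulr1 powRN.
by rewrite ler_pdivlMr// powR_gt0.
Qed.

Definition weight (x : R) : R := (tauext x)^-1.

Let Cw := 2 `^ m / tau 1.

Lemma weight_continuous (x : R) : 0 < x < 2 -> {for x, continuous weight}.
Proof.
move=> x2; apply: continuousV; last exact: tauext_continuous.
by rewrite gt_eqF// tauext_gt0.
Qed.

Lemma weight_gt0 (x : R) : 0 < x < 2 -> 0 < weight x.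
Proof. by move=> x2; rewrite invr_gt0 tauext_gt0. Qed.

Lemma weight_le (x : R) : 0 < x < 2 -> `|weight x| <= Cw * x `^ (- m).
Proof.
move=> x2; have [x0 x2'] := andP x2; rewrite (gtr0_norm (weight_gt0 x2)).
have t1 : 0 < tau 1 := tau_gt0 ltr01 (lexx 1).
have px : 0 < x `^ m by exact: powR_gt0.
rewrite /weight /Cw powRN.
have -> : 2 `^ m / tau 1 * (x `^ m)^-1 = (tau 1 * x `^ m / 2 `^ m)^-1.
  by field; rewrite !gt_eqF ?powR_gt0.
rewrite lef_pV2 ?posrE ?tauext_gt0// ?divr_gt0 ?mulr_gt0 ?powR_gt0//.
have p2 : 1 <= 2 `^ m.
  have := @ler_powR R 2 (ler1n _ 2) 0 m fine_m_tau_ge0; by rewrite powRr0.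
rewrite ler_pdivrMr ?powR_gt0//; have [x1|x1] := leP x 1.
  rewrite tauextE//; apply: le_trans (tau_lower_bound x0 x1) _.
  by rewrite ler_peMr// ltW// tau_gt0.
rewrite /tauext min_r ?(ltW x1)// ler_pM2l//.
by apply: ge0_ler_powR; rewrite ?nnegrE ?fine_m_tau_ge0//; lra.
Qed.

Lemma tauext_weight (x : R) : 0 < x < 2 -> tauext x * weight x = 1.
Proof. by move=> x2; rewrite mulfV// gt_eqF// tauext_gt0. Qed.

Lemma neumann_data : fundamental_data weight (fun=> 1) 0 Cw m 1.
Proof.
split.
- exact: weight_continuous.
- exact: weight_le.
- exact: fine_m_tau_ge0.
- exact: fine_m_tau_lt2.
- by move=> y _; rewrite mul0r; exact: is_derive_cstf.
- by move=> y _; rewrite normr1.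
- by under eq_fun do rewrite mul0r; exact: cvg_cst.
Qed.

Hypothesis m1 : m < 1.

Lemma primitive_weight_le (x : R) : 0 < x < 2 ->
  `|primitive weight x| <= Cw * (x `^ (1 - m) / (1 - m)).
Proof.
move=> x2; have c1 : -1 < - m by move: m1; lra.
have := primitive_normr_le weight_continuous weight_le c1 x2.
by rewrite (addrC (- m)).
Qed.

Lemma primitive_weight_cvg0 : primitive weight x @[x --> (0 : R)^'+] --> (0 : R).
Proof.
apply: norm_cvg0; apply: (@squeeze_cvgr _ _ _ _ (fun=> 0)
  (fun x => Cw * (x `^ (1 - m) / (1 - m)))).
- near=> x; rewrite normr_ge0/=; apply: primitive_weight_le; apply/andP; split.
    by near: x; exact: nbhs_right_gt.
  by near: x; exact: nbhs_right_lt.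
- exact: cvg_cst.
- have e : Cw * (0 / (1 - m)) = 0 by rewrite mul0r mulr0.
  rewrite -[X in _ --> X]e; apply: cvgMr; apply: cvgMl; apply: powR_cvg0.
  by rewrite subr_gt0.
Unshelve. all: by end_near. Qed.

Lemma dirichlet_data : fundamental_data weight (primitive weight) 1 Cw m
  (Cw * (2 `^ (1 - m) / (1 - m))).
Proof.
have c1 : -1 < - m by move: m1; lra.
have c0 : 0 < 1 - m by rewrite subr_gt0.
split.
- exact: weight_continuous.
- exact: weight_le.
- exact: fine_m_tau_ge0.
- exact: fine_m_tau_lt2.
- move=> y y2; rewrite mul1r.
  exact: (is_derive_primitive weight_continuous weight_le c1 y2).
- move=> y y2; apply: le_trans (primitive_weight_le y2) _.
  have [y0 y2'] := andP y2.
  apply: ler_wpM2l; first by rewrite divr_ge0 ?powR_ge0// ltW// tau_gt0.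
  apply: ler_wpM2r; first by rewrite invr_ge0 ltW.
  by apply: ge0_ler_powR; rewrite ?nnegrE ?(ltW c0) ?(ltW y0) ?(ltW y2').
- by under eq_fun do rewrite mul1r; exact: primitive_weight_cvg0.
Qed.

End Coefficient.

(** * Membership in the weighted spaces *)
Section Membership.
Local Open Scope complex_scope.
Context {R : realType}.
Local Notation mu := (@lebesgue_measure R).
Local Notation I01 := (`]0, 1[ : interval R).

Lemma normc_le_norms (x y : R) : normc (x +i* y) <= `|x| + `|y|.
Proof.
rewrite /normc -[leRHS]ger0_norm ?addr_ge0// -sqrtr_sqr ler_wsqrtr//.
rewrite sqrrD -[x ^+ 2]real_normK ?num_real// -[y ^+ 2]real_normK ?num_real//.
have : 0 <= `|x| * `|y| by rewrite mulr_ge0.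
lra.
Qed.

Lemma lipschitz_absolutely_continuous (a b : R) (f g : R -> R) (Lf Lg : R) :
  (forall x y, a <= x -> x <= y -> y <= b -> `|f y - f x| <= Lf * (y - x)) ->
  (forall x y, a <= x -> x <= y -> y <= b -> `|g y - g x| <= Lg * (y - x)) ->
  absolutely_continuous a b (fun x => f x +i* g x).
Proof.
move=> fL gL e e0; pose L := `|Lf| + `|Lg| + 1.
have L0 : 0 < L by rewrite ltr_wpDl// addr_ge0.
exists (e / L); first by rewrite divr_gt0.
move=> n x y xy _ sxy; apply: (@le_lt_trans _ _ (\sum_(i < n) L * (y i - x i))).
  apply: ler_sum => i _; have [axi [xyi yib]] := xy i.
  have d0 : 0 <= y i - x i by rewrite subr_ge0.
  rewrite (_ : (f (y i) +i* g (y i)) - (f (x i) +i* g (x i)) =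
    (f (y i) - f (x i)) +i* (g (y i) - g (x i))); last by [].
  apply: le_trans (normc_le_norms _ _) _; rewrite /L !mulrDl mul1r.
  have h1 := fL _ _ axi xyi yib; have h2 := gL _ _ axi xyi yib.
  have h3 : Lf * (y i - x i) <= `|Lf| * (y i - x i).
    by apply: ler_wpM2r => //; exact: ler_norm.
  have h4 : Lg * (y i - x i) <= `|Lg| * (y i - x i).
    by apply: ler_wpM2r => //; exact: ler_norm.
  lra.
by rewrite -mulr_sumr mulrC -ltr_pdivlMr.
Qed.

Lemma sqint_I01 (f g : R -> R) (C e : R) : -1 < e ->
  (forall x : R, 0 < x < 1 -> {for x, continuous f}) ->
  (forall x : R, 0 < x < 1 -> {for x, continuous g}) ->
  (forall x : R, 0 < x < 1 -> f x ^+ 2 + g x ^+ 2 <= C * x `^ e) ->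
  (fun x => f x +i* g x) \in sqint I01.
Proof.
move=> e1 cf cg fgC.
have mo (h : R -> R) : (forall x : R, 0 < x < 1 -> {for x, continuous h}) ->
    measurable_fun [set` I01] h.
  move=> ch; apply: open_continuous_measurable_fun => // x /set_mem /=.
  by rewrite in_itv/=; exact: ch.
have mf := mo f cf; have mg := mo g cg.
have n2 : (fun x => normc (f x +i* g x) ^+ 2) = (fun x => f x ^+ 2 + g x ^+ 2).
  by apply/funext => x; rewrite normc2E.
have ip : mu.-integrable [set` I01] (fun x => (x `^ e)%:E).
  apply: (@integrableS _ _ _ mu `]0 : R, 1]%classic) => //.
    by move=> x /=; rewrite !in_itv/= => /andP[-> /ltW].
  apply/integrableP; split.
    by apply/measurable_EFinP; exact: measurable_funTS (measurable_powR _).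
  under eq_integral do rewrite gee0_abs ?lee_fin ?powR_ge0//.
  exact: le_lt_trans (integral_powR_le e1 ltr01) (ltry _).
apply/sqintP; split => //.
apply: (@le_integrable _ _ _ mu _ _ _ (fun x => (C%:E * (x `^ e)%:E)%E)) => //.
- apply/measurable_EFinP; rewrite n2.
  by apply: measurable_funD; apply: measurable_funX.
- move=> x /=; rewrite in_itv/= => x1; rewrite lee_fin.
  rewrite ger0_norm ?sqr_ge0// (congr1 (fun h => h x) n2).
  by apply: le_trans (fgC x x1) (ler_norm _).
- exact: integrableZl.
Qed.

Lemma inL2_I01 (f g : R -> R[i]) : g \in sqint I01 ->
  (forall x : R, 0 < x < 1 -> f x = g x) -> inL2 I01 f.
Proof.
move=> gs fg; exists g => //; apply: aeW => x /=; rewrite in_itv/=; exact: fg.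
Qed.

Lemma cderiveE (f g : R -> R) (x a b : R) : is_derive x 1 f a -> is_derive x 1 g b ->
  cderive (fun x => f x +i* g x) x = a +i* b.
Proof. by move=> [_ <-] [_ <-]; rewrite /cderive/= !derive1E. Qed.

Section Solutions.
Variables (w phi0 : R -> R) (p0 Cw m C0 : R).
Hypothesis H : fundamental_data w phi0 p0 Cw m C0.
Hypothesis w0 : forall x : R, 0 < x < 2 -> 0 < w x.
Hypothesis p0m : p0 = 0 \/ m < 1.
Local Notation sol := (solution w phi0).
Local Notation flx := (flux w phi0 p0).

Lemma flux_bounded c : geometric c ->
  exists K : R, forall x : R, 0 < x < 2 -> `|flx c x| <= K.
Proof.
by move=> cg; have [K bK] := bounded_solution H cg cg; exists K => x /bK[].
Qed.

Lemma solution_lipschitz c (a : R) : geometric c -> 0 < a ->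
  exists L : R, forall x y, a <= x -> x <= y -> y <= 1 ->
    `|sol c y - sol c x| <= L * (y - x).
Proof.
move=> cg a0; have [K fK] := flux_bounded cg.
exists (K * (Cw * a `^ (- m))) => x y ax xy y1.
apply: (mean_value_bound (f' := fun z => flx c z * w z) xy) => z /andP[xz zy].
  by apply: (is_derive_solution H cg); lra.
have z2 : 0 < z < 2 by lra.
rewrite normrM; apply: ler_pM => //; first exact: fK.
apply: le_trans (fd_le H z2) _.
have Cw0 : 0 <= Cw.
  have h : 0 < (1 : R) < 2 by lra.
  by have := le_trans (normr_ge0 _) (fd_le H h); rewrite powR1 mulr1.
apply: ler_wpM2l => //; rewrite !powRN lef_pV2 ?posrE ?powR_gt0//; last by lra.
by apply: ge0_ler_powR; rewrite ?nnegrE ?(fd_m_ge0 H)//; lra.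
Qed.

Lemma flux_lipschitz c : geometric c ->
  exists L : R, forall x y, 0 <= x -> x <= y -> y <= 1 ->
    `|flx c y - flx c x| <= L * (y - x).
Proof.
move=> cg; have [K bK] := bounded_solution H (geometric_shift cg) cg.
have [K' [K'0 bK']] := solution_flux_bound H cg.
exists (K + K') => x y x0 xy y1.
have K0 : 0 <= K.
  have h : 0 < (1 : R) < 2 by lra.
  by have [h1 _ _] := bK 1 h; exact: le_trans (normr_ge0 _) h1.
have d0 : 0 <= y - x by rewrite subr_ge0.
move: x0; rewrite le_eqVlt => /predU1P[x0|x0].
  move: d0 xy; rewrite -x0 subr0 => y0 _.
  have [->|yn0] := eqVneq y 0; first by rewrite mulr0 subrr normr0.
  have y2 : 0 < y < 2 by rewrite lt0r yn0 y0/=; lra.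
  have [_ _] := bK' y y2; rewrite flux0 => h; apply: le_trans h _.
  by apply: ler_wpM2r => //; rewrite lerDr.
apply: (@le_trans _ _ (K * (y - x))); last by apply: ler_wpM2r => //; rewrite lerDl.
apply: (mean_value_bound (f' := sol (shift_coeff c)) xy) => z /andP[xz zy].
  by apply: (is_derive_flux H cg); lra.
have z2 : 0 < z < 2 by lra.
by have [] := bK z z2.
Qed.

(** Either the flux is [O(x)] at [0], or [w] itself is integrable there. *)
Lemma weighted_flux_bound c : geometric c -> exists K e : R, -1 < e /\
  forall x : R, 0 < x < 1 -> w x * flx c x ^+ 2 <= K * x `^ e.
Proof.
move=> cg; have [K [K0 bK]] := solution_flux_bound H cg.
have wle x (x1 : 0 < x < 1) : 0 <= w x /\ w x <= Cw * x `^ (- m).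
  have x2 : 0 < x < 2 by lra.
  have := fd_le H x2; rewrite (gtr0_norm (w0 x2)) => h; split=> //.
  exact: ltW (w0 x2).
have [p00|m1] := p0m.
  exists (Cw * K ^+ 2), (2 - m); split.
    have := fd_m_lt2 H; lra.
  move=> x x1; have [x0 _] := andP x1; have [wx0 wx] := wle x x1.
  have x2 : 0 < x < 2 by lra.
  have [_ _] := bK x x2; rewrite p00 mulr0 subr0 => qK.
  have -> : Cw * K ^+ 2 * x `^ (2 - m) = (Cw * x `^ (- m)) * (K * x) ^+ 2.
    rewrite powRD; last by rewrite (gt_eqF x0) implybT.
    by rewrite powR_mulrn ?(ltW x0)//; ring.
  apply: ler_pM => //; first exact: sqr_ge0.
  rewrite -[leLHS]real_normK ?num_real//; apply: lerXn2r => //; rewrite nnegrE//.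
  by rewrite mulr_ge0// ltW.
have [K' fK] := flux_bounded cg.
exists (Cw * K' ^+ 2), (- m); split; first by lra.
move=> x x1; have [x0 _] := andP x1; have [wx0 wx] := wle x x1.
have x2 : 0 < x < 2 by lra.
rewrite mulrAC; apply: ler_pM => //; first exact: sqr_ge0.
rewrite -[leLHS]real_normK ?num_real//; apply: lerXn2r; rewrite ?nnegrE//.
  exact: le_trans (fK x x2).
exact: fK.
Qed.

Lemma solution_cvg0 c : geometric c -> phi0 x @[x --> (0 : R)^'+] --> (0 : R) ->
  sol c x @[x --> (0 : R)^'+] --> (0 : R).
Proof.
move=> cg phi00; have [K [K0 bK]] := solution_flux_bound H cg.
have b0 : 0 < 2 - m by rewrite subr_gt0; exact: fd_m_lt2 H.
apply: norm_cvg0; apply: (@squeeze_cvgr _ _ _ _ (fun=> 0)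
  (fun x => K * x `^ (2 - m) + `|c 0%N| * `|phi0 x|)).
- near=> x; rewrite normr_ge0/=.
  have x2 : 0 < x < 2.
    by apply/andP; split; near: x; [exact: nbhs_right_gt|exact: nbhs_right_lt].
  have [_ h _] := bK x x2.
  rewrite -[sol c x](subrK (c 0%N * phi0 x)) -normrM.
  by apply: le_trans (ler_normD _ _) _; rewrite lerD2r.
- exact: cvg_cst.
- have e : K * 0 + `|c 0%N| * `|0 : R| = 0 by rewrite normr0 !mulr0 addr0.
  rewrite -[X in _ --> X]e; apply: cvgD; apply: cvgMr; first exact: powR_cvg0.
  exact: cvg_norm.
Unshelve. all: by end_near. Qed.

End Solutions.
End Membership.

(** * Quasi-modes in the domain of the operator *)
Section Quasimode.
Local Open Scope complex_scope.
Local Open Scope quotient_scope.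
Context {R : realType}.
Variables (rho alpha wp : R) (tau : R -> R).
Hypothesis rho0 : 0 < rho.
Hypothesis a0 : 0 < alpha.
Hypothesis a1 : alpha < 1.
Hypothesis wp0 : 0 <= wp.
Hypothesis tau_gt0 : forall x : R, 0 < x -> x <= 1 -> 0 < tau x.
Local Notation mu := (@lebesgue_measure R).
Local Notation I01 := (`]0, 1[ : interval R).
Local Notation line := (`]-oo, +oo[ : interval R).
Local Notation w := (weight tau).
Variables (phi0 : R -> R) (p0 Cw m C0 : R).
Hypothesis H : fundamental_data w phi0 p0 Cw m C0.
Hypothesis tau_c : forall x : R, 0 < x < 2 -> {for x, continuous (tauext tau)}.
Hypothesis p0m : p0 = 0 \/ m < 1.
Hypothesis bc : (m_tau tau < 1)%E -> phi0 x @[x --> (0 : R)^'+] --> (0 : R).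
Local Notation sol := (solution w phi0).
Local Notation flx := (flux w phi0 p0).
Local Notation energy := (solution_energy w phi0).

Let w0 (x : R) : 0 < x < 2 -> 0 < w x.
Proof. exact: weight_gt0. Qed.

Let lt01_02 (x : R) : 0 < x < 1 -> 0 < x < 2.
Proof. by lra. Qed.

Lemma sqint_lift (I : interval R) (f : R -> R[i]) : f \in sqint I ->
  exists x : L2 I, (repr x : R -> R[i]) = f %[ae mu in [set` I]].
Proof.
by move=> fI; exists (\pi_(L2 I) (SqintFun fI)); exact: (repr_piL2 (SqintFun fI)).
Qed.

Lemma L2dot_lift (I : interval R) (x : L2 I) (f : R -> R[i]) : f \in sqint I ->
  (repr x : R -> R[i]) = f %[ae mu in [set` I]] -> L2dot x x = fdot I f f.
Proof. by move=> fI xf; apply: (fdot_ae _ _ _ _ xf xf) => //; exact: repr_sqint. Qed.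

Lemma solution_pair_sqint c d : geometric c -> geometric d ->
  (fun x => sol c x +i* sol d x) \in sqint I01.
Proof.
move=> cg dg; have [K bK] := bounded_solution H cg dg.
apply: (@sqint_I01 _ _ _ (K ^+ 2 + K ^+ 2) 0) => [|x x1|x x1|x x1].
- by rewrite ltrN10.
- by apply: (solution_continuous H cg); lra.
- by apply: (solution_continuous H dg); lra.
- have x2 : 0 < x < 2 by lra.
  have [h1 _ h2] := bK x x2; rewrite powRr0 mulr1.
  have sq (a : R) : `|a| <= K -> a ^+ 2 <= K ^+ 2.
    move=> aK; rewrite -[leLHS]real_normK ?num_real//.
    by apply: lerXn2r => //; rewrite nnegrE (le_trans _ aK).
  by apply: lerD; exact: sq.
Qed.

Lemma fdot_solution_pair c d : geometric c -> geometric d ->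
  fdot I01 (fun x => sol c x +i* sol d x) (fun x => sol c x +i* sol d x) =
  energy c + energy d.
Proof.
move=> cg dg; rewrite /fdot /solution_energy /primitive.
have i e : geometric e -> mu.-integrable [set` I01] (EFin \o (fun x => sol e x ^+ 2)).
  move=> eg; have /sqintP[_ _] := solution_pair_sqint eg (@geometric0 R).
  apply: eq_integrable => // x /set_mem xI.
  have x1 : 0 < x < 1 by move: xI; rewrite /= in_itv.
  have x2 : 0 < x < 2 by lra.
  by rewrite normc2E /= (solution0 H x2) expr0n addr0.
rewrite -!Rintegral_itv_bndo_bndc; try exact: i.
by rewrite -RintegralD//; exact: i.
Qed.

Lemma H1tau_solution_pair c d : geometric c -> geometric d ->
  H1tau tau (fun x => sol c x +i* sol d x).
Proof.
move=> cg dg; split.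
- exact: (inL2_I01 (solution_pair_sqint cg dg)).
- move=> a a_0 _; have [L hL] := solution_lipschitz H cg a_0.
  have [L' hL'] := solution_lipschitz H dg a_0.
  exact: (lipschitz_absolutely_continuous hL hL').
have [K [e [e1 hK]]] := weighted_flux_bound H w0 p0m cg.
have [K' [e' [e'1 hK']]] := weighted_flux_bound H w0 p0m dg.
pose e2 := Num.min e e'.
apply: (@inL2_I01 _ _ (fun x => (Num.sqrt (tauext tau x) * (flx c x * w x)) +i*
   (Num.sqrt (tauext tau x) * (flx d x * w x)))); last first.
  move=> x x1; have x2 : 0 < x < 2 by lra.
  rewrite (cderiveE (is_derive_solution H cg x2) (is_derive_solution H dg x2)).
  rewrite tauextE; last by lra.
  by apply/eqP; rewrite eq_complex/= !mul0r subr0 addr0 !eqxx.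
have cs (x : R) : 0 < x < 1 -> {for x, continuous (fun x => Num.sqrt (tauext tau x))}.
  move=> x1; apply: (@continuous_comp _ _ _ (tauext tau) Num.sqrt).
    by apply: tau_c; lra.
  exact: sqrt_continuous.
have cq e3 (x : R) : geometric e3 -> 0 < x < 1 ->
    {for x, continuous (fun x => Num.sqrt (tauext tau x) * (flx e3 x * w x))}.
  move=> g x1; have x2 : 0 < x < 2 by lra.
  apply: cvgM; first exact: cs.
  apply: cvgM; last exact: (fd_continuous H).
  exact: is_derive_continuous (is_derive_flux H g x2).
have sqE (x q : R) : 0 < x < 2 ->
    (Num.sqrt (tauext tau x) * (q * w x)) ^+ 2 = w x * q ^+ 2.
  move=> x2; rewrite exprMn sqr_sqrtr ?ltW ?tauext_gt0//.
  have tw := tauext_weight tau_gt0 x2.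
  by rewrite -[RHS]mul1r -tw; ring.
apply: (@sqint_I01 _ _ _ (`|K| + `|K'|) e2) => [|x x1|x x1|x x1].
- by rewrite /e2 lt_min e1.
- exact: cq.
- exact: cq.
have x2 : 0 < x < 2 by lra.
rewrite !sqE// mulrDl; apply: lerD.
  apply: le_trans (hK x x1) _.
  apply: (@le_trans _ _ (`|K| * x `^ e)).
    by apply: ler_wpM2r; [exact: powR_ge0|exact: ler_norm].
  apply: ler_wpM2l => //; apply: ger_powR; first lra.
  by rewrite ge_min lexx.
apply: le_trans (hK' x x1) _.
apply: (@le_trans _ _ (`|K'| * x `^ e')).
  by apply: ler_wpM2r; [exact: powR_ge0|exact: ler_norm].
apply: ler_wpM2l => //; apply: ger_powR; first lra.
by rewrite ge_min lexx orbT.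
Qed.

Lemma H1_flux_pair c d : geometric c -> geometric d -> H1 (fun x => flx c x +i* flx d x).
Proof.
move=> cg dg; have sc := geometric_shift cg; have sd := geometric_shift dg; split.
- have [L hL] := flux_lipschitz H cg; have [L' hL'] := flux_lipschitz H dg.
  exact: (lipschitz_absolutely_continuous hL hL').
- have [K fK] := flux_bounded H cg; have [K' fK'] := flux_bounded H dg.
  apply: (@inL2_I01 _ _ (fun x => flx c x +i* flx d x)) => //.
  apply: (@sqint_I01 _ _ _ (K ^+ 2 + K' ^+ 2) 0) => [|x x1|x x1|x x1].
  + by rewrite ltrN10.
  + have x2 : 0 < x < 2 by lra.
    exact: is_derive_continuous (is_derive_flux H cg x2).
  + have x2 : 0 < x < 2 by lra.
    exact: is_derive_continuous (is_derive_flux H dg x2).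
  + have x2 : 0 < x < 2 by lra.
    have sq (a k : R) : `|a| <= k -> a ^+ 2 <= k ^+ 2.
      move=> aK; rewrite -[leLHS]real_normK ?num_real//.
      by apply: lerXn2r => //; rewrite nnegrE (le_trans _ aK).
    by rewrite powRr0 mulr1; apply: lerD; apply: sq; [exact: fK|exact: fK'].
- apply: (inL2_I01 (solution_pair_sqint sc sd)) => x x1.
  have x2 : 0 < x < 2 by lra.
  exact: (cderiveE (is_derive_flux H cg x2) (is_derive_flux H dg x2)).
Qed.

Lemma W1tau_solution_pair c d : geometric c -> geometric d ->
  W1tau tau (fun x => sol c x +i* sol d x).
Proof.
move=> cg dg; rewrite /W1tau; case: ifPn => [mt1|_]; last exact: H1tau_solution_pair.
split; first exact: H1tau_solution_pair.
have s1 := solution_cvg0 H cg (bc mt1); have s2 := solution_cvg0 H dg (bc mt1).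
apply: (@squeeze_cvgr _ _ _ _ (fun=> 0) (fun x => `|sol c x| + `|sol d x|)).
- by near=> x; rewrite normc_le_norms andbT; exact: sqrtr_ge0.
- exact: cvg_cst.
- have e : `|0 : R| + `|0 : R| = 0 by rewrite normr0 addr0.
  by rewrite -[X in _ --> X]e; apply: cvgD; exact: cvg_norm.
Unshelve. all: by end_near. Qed.

Lemma cintegral_ae (I : interval R) (g : R -> R) (f f' : R -> R[i]) :
  measurable_fun [set` I] g -> f \in sqint I -> f' \in sqint I ->
  f = f' %[ae mu in [set` I]] ->
  cintegral I (fun x => (g x)%:C * f x) = cintegral I (fun x => (g x)%:C * f' x).
Proof.
move=> mg fI f'I ff'.
have mh (h : R -> R[i]) : h \in sqint I ->
    measurable_fun [set` I] (fun x => cRe ((g x)%:C * h x)) /\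
    measurable_fun [set` I] (fun x => cIm ((g x)%:C * h x)).
  move=> /sqintP[hR hI _]; split.
    rewrite (_ : (fun x => _) = (fun x => g x * cRe (h x))).
      exact: measurable_funM.
    by apply/funext => x; case: (h x) => ? ? /=; rewrite mul0r subr0.
  rewrite (_ : (fun x => _) = (fun x => g x * cIm (h x))).
    exact: measurable_funM.
  by apply/funext => x; case: (h x) => ? ? /=; rewrite mul0r addr0.
have [m1 m2] := mh f fI; have [m3 m4] := mh f' f'I.
rewrite /cintegral; congr (_ +i* _); apply: Rintegral_ae_eq => //;
  move: ff'; apply: filterS; try exact: (ae_filter_ringOfSetsType mu);
  by move=> x + Ix => ->.
Qed.

(** The second component solves its equation exactly, so the whole error [e] is in
the first one: it is [r2 - i r1] times the solution for the parameter [z]. *)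
Lemma generator_quasimode (z r1 r2 : R) (c1 c2 : R ^nat) : 1 <= z ->
  geometric c1 -> geometric c2 ->
  shift_coeff c1 = (fun k => (- z) * c1 k + (- 1) *
    (r1 * power_coeff z k + 0 * power_coeff z k)) ->
  shift_coeff c2 = (fun k => (- z) * c2 k + (- 1) *
    (r2 * power_coeff z k + 0 * power_coeff z k)) ->
  sol c2 1 = 0 ->
  flx c1 1 = - kappa2 rho alpha wp z * sol c1 1 ->
  flx c2 1 = kappa1 rho alpha wp z * sol c1 1 ->
  exists u e : state R, [/\
    opA rho alpha wp tau u (('i * (- z)%:C) *: u + e),
    energy c1 + energy c2 <= state_dot rho alpha u u &
    state_dot rho alpha e e = (r1 ^+ 2 + r2 ^+ 2) * energy (power_coeff z)].
Proof.
move=> z1 g1 g2 s1 s2 v2 q1 q2.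
have gp := geometric_power z.
pose D := sol c1 1.
pose psi x := sol c1 x +i* sol c2 x.
pose q x := flx c1 x +i* flx c2 x.
have g0 := @geometric0 R.
(* the function sol (fun=> 0) stands for 0, so that err is a solution pair *)
pose zc : R[i] := r2 +i* (- r1).
pose err x : R[i] := zc * (sol (power_coeff z) x +i* sol (fun=> 0) x).
have psi1 : psi 1 = D%:C by rewrite /psi v2.
have errs : err \in sqint I01.
  by have := @rpredZ _ _ (sqint I01) zc _ (solution_pair_sqint gp g0).
have ms := memory_sqint a0 a1 wp0 z1 D.
have [x1 x1E] := sqint_lift (solution_pair_sqint g1 g2).
have [x2 x2E] := sqint_lift ms.
have [e1 e1E] := sqint_lift errs.
exists (x1, x2), (e1, 0); split; last 2 first.
- rewrite /state_dot /= (L2dot_lift (solution_pair_sqint g1 g2) x1E) fdot_solution_pair//.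
  by rewrite lerDl mulr_ge0 ?L2dot_ge0// ltW// zeta_gt0.
- have -> : state_dot rho alpha (e1, 0) (e1, 0) = L2dot e1 e1.
    have d0 : L2dot (0 : L2 line) 0 = 0.
      by have := L2dotZ 0 (0 : L2 line); rewrite scaler0 normc0 expr0n mul0r.
    by rewrite /state_dot /= d0 mulr0 addr0.
  rewrite (L2dot_lift errs e1E) fdotZ ?fdot_solution_pair//; last first.
    exact: solution_pair_sqint.
  by rewrite normc2E /= sqrrN (energy0 H) addr0 (addrC (r1 ^+ 2)).
have err_eq (x : R) : 0 < x < 1 ->
    ('i * (- z)%:C) * psi x + err x = 'i * cderive q x.
  move=> x01; have x02 := lt01_02 x01.
  have d1 := is_derive_flux_eq H g1 (geometric_comb r1 0 gp gp) s1 x02.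
  have d2 := is_derive_flux_eq H g2 (geometric_comb r2 0 gp gp) s2 x02.
  rewrite (cderiveE d1 d2) !(solution_comb H)// /err /psi (solution0 H x02) /zc.
  by apply/eqP; rewrite eq_complex/=; apply/andP; split; apply/eqP; ring.
have snd_eq (x : R) : repr x2 x = memory alpha wp z D x ->
    opA_snd alpha wp psi (repr x2) x = ('i * (- z)%:C) * memory alpha wp z D x.
  by move=> h; rewrite -(opA_snd_memory _ _ z1 x psi1) /opA_snd h.
have FF := ae_filter_ringOfSetsType mu.
exists psi, q; split.
- split.
  + exact: x1E.
  + split; last exact: W1tau_solution_pair.
    split; [exact: H1tau_solution_pair|exact: H1_flux_pair|].
    apply: aeW => x /=; rewrite in_itv/= => x01; have x02 := lt01_02 x01.
    rewrite /psi (cderiveE (is_derive_solution H g1 x02) (is_derive_solution H g2 x02)).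
    rewrite -[tau x]tauextE; last by case/andP: x01 => _ /ltW.
    have tw := tauext_weight tau_gt0 x02.
    apply/eqP; rewrite eq_complex/=; apply/andP; split; apply/eqP.
      by rewrite mul0r subr0 mulrCA tw mulr1.
    by rewrite mul0r addr0 mulrCA tw mulr1.
  + rewrite (@cintegral_ae line (eta alpha) _ (memory alpha wp z D)) //; last 2 first.
    * apply: measurable_funTS.
      exact: (measurableT_comp (measurable_powR _) (@normr_measurable R setT)).
    * exact: repr_sqint.
    have [k1 k2] := cintegral_memory rho a0 a1 wp0 z1 D.
    rewrite /q q1 q2; move: k1 k2; case: (cintegral _ _) => x y /= k1 k2.
    apply/eqP; rewrite eq_complex/=; apply/andP; split; apply/eqP.
      by rewrite mulNr -k2; ring.
    by rewrite -k1; ring.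
  + exists (fun x => ('i * (- z)%:C) * memory alpha wp z D x).
      by have := @rpredZ _ _ (sqint line) ('i * (- z)%:C) _ ms.
    by move: x2E; apply: filterS => x h lx; apply: snd_eq; exact: h.
  + exists (fun x => `|x|%:C * memory alpha wp z D x).
      exact: weighted_memory_sqint.
    by move: x2E; apply: filterS => x h lx; rewrite /= h.
- have hD := reprL2D (('i * (- z)%:C) *: x1) e1; have hZ := reprL2Z ('i * (- z)%:C) x1.
  have h12 : (repr (('i * (- z)%:C) *: x1 + e1) : R -> R[i]) =
      (fun t => ('i * (- z)%:C) * repr x1 t + repr e1 t) %[ae mu in [set` I01]].
    by move: hD hZ; apply: filterS2 => t k1 k2 It; rewrite k1// k2.
  move: x1E e1E h12; apply: filterS3 => x k1 k2 k3 Ix; rewrite k3// k1// k2//.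
  by apply: err_eq; move: Ix; rewrite /= in_itv.
- have -> : (('i * (- z)%:C) *: ((x1, x2) : state R) + (e1, 0)).2 = ('i * (- z)%:C) *: x2.
    by rewrite /= addr0.
  move: x2E (reprL2Z ('i * (- z)%:C) x2); apply: filterS2 => x h1 h2 lx.
  by rewrite h2// (snd_eq _ (h1 lx)) h1.
Qed.

End Quasimode.

(** The solution vanishes at [0] when [m < 1], which makes [1 / tau] integrable there;
otherwise it starts from [1] with a vanishing flux. *)
Lemma regular_data (R : realType) (tau : R -> R)
    (tauC0 : {within `[0, 1], continuous tau})
    (tauC1 : forall x : R, `]0, 1]%classic x ->
      cvg (diff_quotient tau x y @[y --> within `]0, 1] x^']))
    (tau_gt0 : forall x : R, 0 < x -> x <= 1 -> 0 < tau x)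
    (m_tau2 : (m_tau tau < 2%:E)%E) :
  exists (phi0 : R -> R) (p0 Cw m C0 : R),
  [/\ fundamental_data (weight tau) phi0 p0 Cw m C0,
     p0 = 1 \/ (forall x : R, 0 < x < 2 -> phi0 x = 1), p0 = 0 \/ m < 1 &
     (m_tau tau < 1)%E -> phi0 x @[x --> (0 : R)^'+] --> (0 : R)].
Proof.
have [m1|m1] := boolP (m_tau tau < 1)%E.
  have m1' : fine (m_tau tau) < 1 by rewrite -lte_fin -fine_m_tauE.
  do 5 eexists; split.
  - exact: (dirichlet_data tauC0 tauC1 tau_gt0 m_tau2 m1').
  - by left.
  - by right.
  - by move=> _; exact: (primitive_weight_cvg0 tauC0 tauC1 tau_gt0 m_tau2 m1').
do 5 eexists; split.
- exact: (neumann_data tauC0 tauC1 tau_gt0 m_tau2).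
- by right.
- by left.
- by [].
Qed.

Lemma decay_factor_sqr (R : realType) (alpha z : R) : 0 < z ->
  decay_factor alpha z ^+ 2 = (z `^ (1 - alpha))^-1.
Proof.
move=> z0; rewrite /decay_factor -powR_mulrn ?powR_ge0// -powRrM -powRN.
by congr (_ `^ _); field.
Qed.

Theorem theorem5p1 (R : realType) (rho alpha wp : R) (tau : R -> R)
  (S : R -> state R -> state R)
  (hrho : 0 < rho) (halpha0 : 0 < alpha) (halpha1 : alpha < 1)
  (hwp : 0 <= wp)
  (htauC0 : continuously_differentiable 0 `[0, 1] tau)
  (htauC1 : continuously_differentiable 1 `]0, 1] tau)
  (htau0 : tau 0 = 0)
  (htau_gt0 : forall x, 0 < x -> x <= 1 -> 0 < tau x)
  (hm_tau : (m_tau tau < 2%:E)%E)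
  (htau_reg :
    continuously_differentiable (Num.truncn (fine (m_tau tau))) `[0, 1] tau)
  (hS : generates (state_norm rho alpha) (opA rho alpha wp tau) S) :
  ~ exponentially_stable (state_norm rho alpha) S.
Proof.
move=> stable; have [C0S gen] := hS.
have zeta0 : 0 <= zeta rho alpha by apply: ltW; exact: zeta_gt0.
have [C C0 bound] := exponentially_stable_resolvent_bound
  (@state_normD R rho alpha zeta0) (@state_normZ R rho alpha) C0S stable.
have [tauC0 _] := htauC0; have [_ [tauC1 _]] := htauC1.
have [phi0 [p0 [Cw [m [K0 [H nt p0m bc]]]]]] :=
  regular_data tauC0 tauC1 htau_gt0 hm_tau.
have [Tm tauTm] := tauext_bounded tauC0.
have T0 := tauext_gt0 htau_gt0; have Tw := tauext_weight htau_gt0.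
have Tc := tauext_continuous tauC0; have dT := is_derive_tauext tauC1.
have xdT := dtauext_le htau_gt0 hm_tau.
have C20 : 0 <= C ^+ 2 by exact: sqr_ge0.
have [e e0 qm] := quasimode H T0 Tw tauTm Tc dT xdT nt C20.
pose Z := 2 * (zeta rho alpha *
  \int[@lebesgue_measure R]_(x in [set` `]-oo, +oo[]) majorant alpha x) ^+ 2.
have Z0 : 0 <= Z by rewrite mulr_ge0// sqr_ge0.
(* z `^ (1 - alpha) >= Z / e is what kappa_bound requires *)
pose X := Z / e + 1.
have X1 : 1 <= X by rewrite /X lerDr divr_ge0// ltW.
have a1 : 0 < 1 - alpha by rewrite subr_gt0.
have [z Mz Bz] := eigenvalues_unbounded H T0 Tw tauTm Tc dT xdT
  (1 + X `^ (1 - alpha)^-1).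
have z1 : 1 <= z by apply: le_trans Mz; rewrite lerDl powR_ge0.
have z0 : 0 < z by exact: lt_le_trans ltr01 z1.
have Xz : X <= z `^ (1 - alpha).
  have -> : X = (X `^ (1 - alpha)^-1) `^ (1 - alpha).
    by rewrite -powRrM mulVf ?gt_eqF// powRr1// (le_trans ler01).
  apply: ge0_ler_powR; rewrite ?nnegrE ?powR_ge0// ?(ltW a1) ?(ltW z0)//.
  by apply: le_trans Mz; rewrite lerDr.
have small : kappa1 rho alpha wp z ^+ 2 + kappa2 rho alpha wp z ^+ 2 <= e.
  apply: le_trans (kappa_bound rho halpha0 halpha1 hwp z1) _.
  rewrite -/Z decay_factor_sqr// ler_pdivrMr ?powR_gt0//.
  rewrite mulrC -ler_pdivrMr//; apply: le_trans Xz.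
  by rewrite /X lerDl.
have [c1 [c2 [r1 [r2 [[g1 g2] s1 s2 [v2 q1 q2] lt12]]]]] := qm _ _ _ z1 Bz small.
have [u [f [Auf uE fE]]] := generator_quasimode hrho halpha0 halpha1 hwp
  htau_gt0 H Tc p0m bc z1 g1 g2 s1 s2 v2 q1 q2.
have := bound _ _ (- z) ((gen _ _).1 Auf).
rewrite addrC addKr => uf.
have : state_dot rho alpha u u <= C ^+ 2 * state_dot rho alpha f f.
  have dot_ge0 := @state_dot_ge0 R rho alpha zeta0.
  rewrite -[leLHS]sqr_sqrtr ?dot_ge0// -[X in _ <= _ * X]sqr_sqrtr ?dot_ge0//.
  rewrite -!state_normE// -exprMn; apply: lerXn2r uf; rewrite nnegrE.
    exact: sqrtr_ge0.
  by apply: mulr_ge0 => //; exact: sqrtr_ge0.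
by rewrite fE; apply/negP; rewrite -ltNge; exact: lt_le_trans lt12 uE.
Qed.
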